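(* Let $F:M\to\Lambda$ be an $L$-isothermic (Legendre) immersion of a surface $M$ and let $A=(a_0;a_1,a_2,a_3,a_4):M\to L$ be any principal framing along $F$, with connection form $\alpha=(\alpha_0,\alpha')=A^{-1}dA$. Let $\rho$ be a smooth positive function on $M$ with $$2(\alpha^1_1-*\alpha^3_2)=-d\log\rho ,$$ and let $$\alpha'_\rho=\begin{pmatrix}\alpha^1_1&\alpha^1_2+\rho\alpha^2_1&\alpha^1_3-\rho\alpha^3_1&0\\ \alpha^2_1&0&-\alpha^3_2&\alpha^1_2+\rho\alpha^2_1\\ \alpha^3_1&\alpha^3_2&0&\alpha^1_3-\rho\alpha^3_1\\ 0&\alpha^2_1&\alpha^3_1&-\alpha^1_1\end{pmatrix}.$$ Then any solution $v={}^t(v^1,v^2,v^3,v^4):M\to\mathcal L^+$ of the (completely integrable) linear system $$dv=-\alpha'_\rho v$$ defines an $L$-isothermic immersion $$\hat F:=[\,a_0+sa_1,\;v^1a_1+v^2a_2+v^3a_3+v^4a_4\,]:M\to\Lambda ,$$ which is a Bianchi--Darboux transform of $F$. Here $s=r/v^4$, where $r$ is a function which (locally) integrates the closed $1$-form $\gamma=v^2\alpha^2_0+v^3\alpha^3_0-v^4\alpha^1_0$, that is, $dr=\gamma$.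
   Context: Minkowski space $\mathbb R^4_1$ has coordinates $u^1,\dots,u^4$ with $\langle u,u\rangle=(u^1)^2+(u^2)^2+(u^3)^2-(u^4)^2$, and also linear coordinates $x^1,\dots,x^4$ with $u^1=(x^1-x^4)/\sqrt2$, $u^2=x^2$, $u^3=x^3$, $u^4=(x^1+x^4)/\sqrt2$, in which $\langle x,x\rangle=-2x^1x^4+(x^2)^2+(x^3)^2$; it is oriented by $dx^1\wedge\dots\wedge dx^4$ and time-oriented by $x^1+x^4>0$. $\mathcal L^+=\{v\neq 0:\ -2v^1v^4+(v^2)^2+(v^3)^2=0,\ v^1+v^4>0\}$ (in $x$-coordinates) is the positive light-cone. A contact element $(x,n)\in\Lambda=\mathbb R^3\times S^2$ is identified with the null line $\{(x-tn,t):t\in\mathbb R\}$ (in $u$-coordinates). For a point $a$ and a null vector $w$, $[a,w]\in\Lambda$ denotes the null line through $a$ with direction $w$. $L=\mathbb R^4\rtimes SO_0(3,1)$ is the identity component of the isometry group of $\mathbb R^4_1$. An element $A=(a_0,a)\in L$ is viewed as a frame $(a_0;a_1,\dots,a_4)$, where the $a_j$ are the columns of $a$ in $x$-coordinates; thus $\langle a_1,a_4\rangle=-1$, $\langle a_2,a_2\rangle=\langle a_3,a_3\rangle=1$ and all other products vanish. For $A:M\to L$ the connection form $\alpha=(\alpha_0,\alpha')$ is given by $da_0=\sum_i\alpha^i_0a_i$, $da_j=\sum_i\alpha^i_ja_i$. A map $F=(f,n):M\to\Lambda$ is Legendre if $df\cdot n=0$. Put $\mathrm{III}=dn\cdot dn$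 (assumed positive definite) and let $\mathrm{II}=-df\cdot dn$. Give $M$ the complex structure determined by $\mathrm{III}$ and the orientation; $F$ is $L$-isothermic if there are a holomorphic quadratic differential $q$ and a smooth real function $\mu$ with $\mathrm{II}^{(2,0)}=\mu q$. A principal framing along $F$ is a smooth map $A:M\to L$ with $[a_0,a_1]=F$, $\alpha^4_0=0$, $\alpha^2_1\wedge\alpha^3_1\neq0$ everywhere, and $\alpha^2_0\wedge\alpha^2_1=\alpha^3_0\wedge\alpha^3_1=0$. The operator $*$ on $1$-forms is the function-linear map with $*\alpha^2_1=\alpha^3_1$, $*\alpha^3_1=-\alpha^2_1$. A sphere congruence is an immersion $S:M\to\mathbb R^4_1$ (points of $\mathbb R^4_1$ being identified with oriented spheres and points of $\mathbb R^3$). If $S$ is space-like and its normal bundle has null line subbundles spanned by $N_1,N_2$, its two envelopes are $[S,N_1]$ and $[S,N_2]$. $S$ is a Darboux congruence if the resulting correspondence between the two envelopes preserves curvature lines and is conformal with respect to their third fundamental forms. It is nondegenerate if the two envelopes have opposite orientations; what is excluded is the case in which the normals of the two envelopes are Möbius equivalent in $S^2$ (the envelopes are then Laguerre equivalent, i.e. related by an element of $L$, with the same orientation). Two $L$-isothermic surfaces are Bianchi--Darboux transforms of each other if they are the two envelopes of a nondegenerate Darboux congruence.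
   Formalization: The Bianchi–Darboux conclusion is stated on open sets where S=a_0+sa_1 is an immersion (and v^4≠0, so that s is defined); without this it fails, e.g. if F consists of the null lines through one fixed point and r=0, so that S is constant. *)

(* Defs.v *)
From HB Require Import structures.
From mathcomp Require Import all_boot all_order all_algebra.
From mathcomp Require Import all_classical all_reals all_analysis.
From mathcomp Require Import complex.
From mathcomp Require Import ring.

Set Implicit Arguments.
Unset Strict Implicit.
Unset Printing Implicit Defensive.

Import Order.TTheory GRing.Theory Num.Theory.
Import numFieldNormedType.Exports.

Local Open Scope classical_set_scope.
Local Open Scope ring_scope.
Local Open Scope complex_scope.

Section SmoothMaps.
Variable R : realType.

Definition e0 : 'rV[R]_2 := delta_mx 0 ord0.
Definition e1 : 'rV[R]_2 := delta_mx 0 ord_max.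

(* [Ck k U f] : f is of class C^k at the points of U; meant for U open. *)
Fixpoint Ck (W : normedModType R) (k : nat) (U : set 'rV[R]_2)
    (f : 'rV[R]_2 -> W) {struct k} : Prop :=
  match k with
  | 0%N => forall x, U x -> {for x, continuous f}
  | k'.+1 => [/\ forall x, U x -> differentiable f x,
                 Ck k' U (fun x => 'D_e0 f x)
               & Ck k' U (fun x => 'D_e1 f x)]
  end.

Definition smooth_on (W : normedModType R) (U : set 'rV[R]_2)
    (f : 'rV[R]_2 -> W) : Prop :=
  forall k, Ck k U f.

End SmoothMaps.

Section Surfaces.
Variable R : realType.

(* Only the values of [cmap] on [cdom], and of [cinv] on the image of [cdom],
   are meaningful. *)
Record chart (M : topologicalType) := Chart {
  cdom : set M;
  cmap : M -> 'rV[R]_2;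
  cinv : 'rV[R]_2 -> M }.

Definition is_chart (M : topologicalType) (c : chart M) : Prop :=
  [/\ open (cdom c), open (cmap c @` cdom c),
      forall p, cdom c p -> cinv c (cmap c p) = p,
      forall p, cdom c p -> {for p, continuous (cmap c)}
    & forall x, (cmap c @` cdom c) x -> {for x, continuous (cinv c)}].

Definition jacobian (f : 'rV[R]_2 -> 'rV[R]_2) (x : 'rV[R]_2) : 'M[R]_2 :=
  \matrix_(i < 2, j < 2) ('D_(delta_mx 0 i) f x) 0 j.

Definition compatible (M : topologicalType) (c d : chart M) : Prop :=
  let W := cmap c @` (cdom c `&` cdom d) in
  let t := cmap d \o cinv c in
  smooth_on W t /\ forall x, W x -> 0 < \det (jacobian t x).

(* An oriented smooth surface, presented by its maximal oriented atlas. *)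
Record surface := Surface {
  surface_carrier :> topologicalType;
  surface_hausdorff : hausdorff_space surface_carrier;
  surface_countable : @second_countable surface_carrier;
  atlas : set (chart surface_carrier);
  atlas_chart : forall c, atlas c -> is_chart c;
  atlas_cover : forall p, exists2 c, atlas c & cdom c p;
  atlas_compatible : forall c d, atlas c -> atlas d -> compatible c d;
  atlas_maximal : forall c, is_chart c ->
    (forall d, atlas d -> compatible c d /\ compatible d c) -> atlas c }.

End Surfaces.

Section Calculus.
Variables (R : realType) (M : surface R).

(* All notions below are relative to an open set U of M, so that they apply to
   maps which are only defined on U. *)

Definition smooth_map (W : normedModType R) (U : set M) (g : M -> W) : Prop :=
  forall c, atlas c -> smooth_on (cmap c @` (cdom c `&` U)) (g \o cinv c).

(* A tangent vector at p is given by its coordinates X in a chart c; [dmap] is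
   the differential of g at p applied to it. *)
Definition dmap (W : normedModType R) (c : chart R M) (g : M -> W) (p : M)
    (X : 'rV[R]_2) : W :=
  'D_X (g \o cinv c) (cmap c p).

Definition immersion (W : normedModType R) (U : set M) (g : M -> W) : Prop :=
  smooth_map U g /\
  forall c p, atlas c -> cdom c p -> U p ->
    forall X, dmap c g p X = 0 -> X = 0.

(* Differential 1-forms, read in the charts. *)
Definition form1 (W : Type) := chart R M -> M -> 'rV[R]_2 -> W.

(* The coefficient of dx /\ dy of a wedge product of two covectors and of an
   exterior derivative, (x, y) being the coordinates of the chart. *)
Definition wedge (a b : 'rV[R]_2 -> R) : R :=
  a (e0 R) * b (e1 R) - a (e1 R) * b (e0 R).

Definition extd (W : normedModType R) (w : form1 W) (c : chart R M) (p : M) : W :=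
  dmap c (fun q => w c q (e1 R)) p (e0 R) -
  dmap c (fun q => w c q (e0 R)) p (e1 R).

Definition closed_form (W : normedModType R) (w : form1 W) : Prop :=
  forall c p, atlas c -> cdom c p -> extd w c p = 0.

(* Frobenius condition d a + a /\ a = 0 for the linear system dv = - a v. *)
Definition completely_integrable n (a : form1 'M[R]_n.+1) : Prop :=
  forall c p, atlas c -> cdom c p ->
    extd a c p + (a c p (e0 R) *m a c p (e1 R) - a c p (e1 R) *m a c p (e0 R)) = 0.

(* The linear operator on covectors with th2 |-> th3 and th3 |-> - th2, for a
   basis (th2, th3); cf. [star_th2], [star_th3]. *)
Definition star (th2 th3 w : 'rV[R]_2 -> R) : 'rV[R]_2 -> R := fun X =>
  wedge w th3 / wedge th2 th3 * th3 X - wedge th2 w / wedge th2 th3 * th2 X.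

Lemma star_th2 th2 th3 X : wedge th2 th3 != 0 -> star th2 th3 th2 X = th3 X.
Proof.
by move=> h; rewrite /star divff // [wedge th2 th2]/wedge mulrC; ring.
Qed.

Lemma star_th3 th2 th3 X : wedge th2 th3 != 0 -> star th2 th3 th3 X = - th2 X.
Proof.
by move=> h; rewrite /star divff // [wedge th3 th3]/wedge; ring.
Qed.

End Calculus.

Section Minkowski.
Variable R : realType.

Definition i1 : 'I_4 := @Ordinal 4 0 isT.
Definition i2 : 'I_4 := @Ordinal 4 1 isT.
Definition i3 : 'I_4 := @Ordinal 4 2 isT.
Definition i4 : 'I_4 := @Ordinal 4 3 isT.

(* Points and vectors of R^4_1 are columns of x-coordinates. *)
Definition mink (x y : 'cV[R]_4) : R :=
  - (x i1 0 * y i4 0 + x i4 0 * y i1 0) + x i2 0 * y i2 0 + x i3 0 * y i3 0.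

(* u-coordinates: [uspace x] = (u^1, u^2, u^3) and [utime x] = u^4. *)
Definition uspace (x : 'cV[R]_4) : 'rV[R]_3 :=
  \row_(j < 3) nth 0 [:: (x i1 0 - x i4 0) / Num.sqrt 2; x i2 0; x i3 0] j.
Definition utime (x : 'cV[R]_4) : R := (x i1 0 + x i4 0) / Num.sqrt 2.

Definition Lplus (x : 'cV[R]_4) : Prop :=
  [/\ x != 0, mink x x = 0 & 0 < x i1 0 + x i4 0].

Definition dot (x y : 'rV[R]_3) : R := \sum_(j < 3) x 0 j * y 0 j.

Lemma mink_u (x y : 'cV[R]_4) :
  mink x y = dot (uspace x) (uspace y) - utime x * utime y.
Proof.
have h : Num.sqrt 2 ^+ 2 = 2 :> R by rewrite sqr_sqrtr.
have h0 : Num.sqrt 2 != 0 :> R by rewrite sqrtr_eq0 -ltNge.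
rewrite /dot !big_ord_recl big_ord0 !mxE /= /mink /utime.
set s := Num.sqrt 2 in h h0 *.
have -> a b : a / s * (b / s) = a * b / 2 by rewrite -h; field.
have -> a b : a / s * (b / s) = a * b / 2 by rewrite -h; field.
by field.
Qed.

(* An element (x, n) of Lambda = R^3 x S^2; the condition |n| = 1 is part of
   [legendre] below. *)
Definition contact := ('rV[R]_3 * 'rV[R]_3)%type.

Definition contact_line (C : contact) : set 'cV[R]_4 :=
  [set P | exists t : R, uspace P = C.1 - t *: C.2 /\ utime P = t].

Definition null_line (a w : 'cV[R]_4) : set 'cV[R]_4 :=
  [set P | exists t : R, P = a + t *: w].

(* The element [a, w] of Lambda, for w null with u^4(w) != 0; it is
   characterized by [contact_of_line], [contact_of_unit], [contact_line_inj]. *)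
Definition contact_of (a w : 'cV[R]_4) : contact :=
  let n := - (utime w)^-1 *: uspace w in (uspace a + utime a *: n, n).

Lemma uspaceD x y : uspace (x + y) = uspace x + uspace y.
Proof.
by apply/rowP => -[[|[|[|//]]] h]; rewrite !mxE /=; ring.
Qed.

Lemma uspaceZ t x : uspace (t *: x) = t *: uspace x.
Proof.
by apply/rowP => -[[|[|[|//]]] h]; rewrite !mxE /=; ring.
Qed.

Lemma utimeD x y : utime (x + y) = utime x + utime y.
Proof. by rewrite /utime !mxE; ring. Qed.

Lemma utimeZ t x : utime (t *: x) = t * utime x.
Proof. by rewrite /utime !mxE; ring. Qed.

Lemma u_inj x y : uspace x = uspace y -> utime x = utime y -> x = y.
Proof.
move=> /rowP hs; rewrite /utime => ht.
have h0 : Num.sqrt 2 != 0 :> R by rewrite sqrtr_eq0 -ltNge.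
have hV : (Num.sqrt 2)^-1 != 0 :> R by rewrite invr_eq0.
have := hs (@Ordinal 3 0 isT); have := hs (@Ordinal 3 1 isT).
have := hs (@Ordinal 3 2 isT); rewrite !mxE /= => h3 h2 /(mulIf hV) hm.
move/(mulIf hV): ht => hp.
have h1 : x i1 0 = y i1 0.
  apply: (mulfI (_ : 2 != 0 :> R)) => //.
  have -> : 2 * x i1 0 = (x i1 0 + x i4 0) + (x i1 0 - x i4 0) by ring.
  by rewrite hp hm; ring.
have h4 : x i4 0 = y i4 0 by move: hp; rewrite h1 => /addrI.
apply/colP => -[[|[|[|[|//]]]] h].
- by rewrite (_ : Ordinal h = i1) //; apply/val_inj.
- by rewrite (_ : Ordinal h = i2) //; apply/val_inj.
- by rewrite (_ : Ordinal h = i3) //; apply/val_inj.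
- by rewrite (_ : Ordinal h = i4) //; apply/val_inj.
Qed.

Lemma contact_of_line a w :
  utime w != 0 -> contact_line (contact_of a w) = null_line a w.
Proof.
move=> hw; apply/seteqP; split=> P /=.
- move=> [t [hs ht]]; exists ((t - utime a) / utime w); apply: u_inj.
  + rewrite hs uspaceD uspaceZ; apply/rowP => j.
    by rewrite /contact_of !mxE; ring.
  + by rewrite ht utimeD utimeZ; field.
- move=> [t ->]; exists (utime a + t * utime w).
  rewrite uspaceD uspaceZ utimeD utimeZ; split=> //.
  have -> : t *: uspace w = (t * utime w / utime w) *: uspace w.
    by rewrite mulfK.
  by rewrite /contact_of; apply/rowP => j; rewrite !mxE; ring.
Qed.

Lemma contact_of_unit a w :
  utime w != 0 -> mink w w = 0 -> dot (contact_of a w).2 (contact_of a w).2 = 1.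
Proof.
move=> hw /eqP; rewrite mink_u subr_eq0 => /eqP h.
have -> : dot (contact_of a w).2 (contact_of a w).2 =
          (utime w)^-2 * dot (uspace w) (uspace w).
  rewrite /dot mulr_sumr; apply: eq_bigr => j _.
  by rewrite /contact_of /= mxE; field.
by rewrite h; field.
Qed.

Lemma contact_line_inj C D : contact_line C = contact_line D -> C = D.
Proof.
pose pt (x : 'rV[R]_3) (t : R) : 'cV[R]_4 := \col_(j < 4)
  nth 0 [:: (x 0 ord0 + t) / Num.sqrt 2; x 0 (@Ordinal 3 1 isT);
            x 0 ord_max; (t - x 0 ord0) / Num.sqrt 2] j.
have h : Num.sqrt 2 ^+ 2 = 2 :> R by rewrite sqr_sqrtr.
have h0 : Num.sqrt 2 != 0 :> R by rewrite sqrtr_eq0 -ltNge.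
have hP x t : uspace (pt x t) = x /\ utime (pt x t) = t.
  split.
    apply/rowP => -[[|[|[|//]]] hj]; rewrite !mxE /=.
    - rewrite -mulrBl -mulrA -invfM -expr2 h.
      rewrite (_ : x 0 (Ordinal hj) = x 0 ord0); first by field.
      by congr (x 0 _); apply/val_inj.
    - by congr (x 0 _); apply/val_inj.
    - by congr (x 0 _); apply/val_inj.
  by rewrite /utime !mxE /= -mulrDl -mulrA -invfM -expr2 h; field.
move=> hCD.
have key t : C.1 - t *: C.2 = D.1 - t *: D.2.
  have [hs ht] := hP (C.1 - t *: C.2) t.
  have : contact_line C (pt (C.1 - t *: C.2) t) by exists t.
  by rewrite hCD => -[t' []]; rewrite hs ht => -> <-.
have k0 : C.1 = D.1 by have := key 0; rewrite !scale0r !subr0.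
have k1 : C.2 = D.2.
  by have := key 1; rewrite !scale1r k0 => /addrI /oppr_inj.
by case: C D k0 k1 {hCD key} => [? ?] [? ?] /= -> ->.
Qed.

(* (a_0, a), the a_j being the columns of a. *)
Definition frame := ('cV[R]_4 * 'M[R]_4)%type.

Definition in_SO0 (a : 'M[R]_4) : Prop :=
  [/\ forall x y, mink (a *m x) (a *m y) = mink x y,
      \det a = 1
    & forall x, Lplus x -> Lplus (a *m x)].

End Minkowski.

Section LaguerreGeometry.
Variables (R : realType) (M : surface R).

Section LegendreMaps.
Variable F : M -> contact R.

Let f p := (F p).1.
Let n p := (F p).2.

Definition legendre (U : set M) : Prop :=
  [/\ smooth_map U F,
      forall p, U p -> dot (n p) (n p) = 1
    & forall c p, atlas c -> cdom c p -> U p ->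
        forall X, dot (dmap c f p X) (n p) = 0].

Definition III (c : chart R M) (p : M) (X Y : 'rV[R]_2) : R :=
  dot (dmap c n p X) (dmap c n p Y).

Definition II (c : chart R M) (p : M) (X Y : 'rV[R]_2) : R :=
  - dot (dmap c f p X) (dmap c n p Y).

Definition III_posdef (U : set M) : Prop :=
  forall c p, atlas c -> cdom c p -> U p -> forall X, X != 0 -> 0 < III c p X X.

(* The holomorphic charts z = x + iy of the complex structure of U given by the
   conformal class of III and the orientation. *)
Definition complex_chart (U : set M) (c : chart R M) : Prop :=
  [/\ atlas c, cdom c `<=` U
    & forall p, cdom c p ->
        III c p (e0 R) (e0 R) = III c p (e1 R) (e1 R) /\
        III c p (e0 R) (e1 R) = 0].

(* dz_c / dz_d *)
Definition dz_dz (c d : chart R M) (p : M) : R[i] :=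
  dmap d (fun q => cmap c q 0 ord0) p (e0 R) +i*
  dmap d (fun q => cmap c q 0 ord_max) p (e0 R).

(* [h c] is the coefficient of dz_c^2 in a quadratic differential. *)
Definition holomorphic_quadratic_differential (U : set M)
    (h : chart R M -> M -> R[i]) : Prop :=
  [/\ forall c, complex_chart U c ->
        smooth_map (cdom c) (fun p => complex.Re (h c p)) /\
        smooth_map (cdom c) (fun p => complex.Im (h c p)),
      forall c p, complex_chart U c -> cdom c p ->
        dmap c (fun q => complex.Re (h c q)) p (e0 R) =
          dmap c (fun q => complex.Im (h c q)) p (e1 R) /\
        dmap c (fun q => complex.Re (h c q)) p (e1 R) =
          - dmap c (fun q => complex.Im (h c q)) p (e0 R)
    & forall c d p, complex_chart U c -> complex_chart U d ->
        cdom c p -> cdom d p -> h d p = h c p * dz_dz c d p ^+ 2].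

(* The coefficient of dz^2 in II, from dx = (dz + dzbar) / 2 and
   dy = (dz - dzbar) / 2i. *)
Definition II20 (c : chart R M) (p : M) : R[i] :=
  ((II c p (e0 R) (e0 R) - II c p (e1 R) (e1 R)) / 4) +i*
  (- (II c p (e0 R) (e1 R) / 2)).

Definition L_isothermic (U : set M) : Prop :=
  exists (h : chart R M -> M -> R[i]) (mu : M -> R),
    [/\ holomorphic_quadratic_differential U h, smooth_map U mu
      & forall c p, complex_chart U c -> cdom c p ->
          II20 c p = (mu p)%:C * h c p].

Definition L_isothermic_immersion (U : set M) : Prop :=
  [/\ immersion U F, legendre U, III_posdef U & L_isothermic U].

Definition curvature_direction (c : chart R M) (p : M) (X : 'rV[R]_2) : Prop :=
  X != 0 /\ exists k : R, dmap c f p X = k *: dmap c n p X.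

End LegendreMaps.

Section Framings.
Variable A : M -> frame R.

(* alpha^i_0 and alpha^i_j, from da_0 = \sum_i alpha^i_0 a_i and
   da_j = \sum_i alpha^i_j a_i. *)
Definition alpha0 (i : 'I_4) : form1 M R := fun c p X =>
  (invmx (A p).2 *m dmap c (fun q => (A q).1) p X) i 0.
Definition alpha (i j : 'I_4) : form1 M R := fun c p X =>
  (invmx (A p).2 *m dmap c (fun q => (A q).2) p X) i j.

Definition principal_framing (F : M -> contact R) : Prop :=
  [/\ smooth_map setT A,
      forall p, in_SO0 (A p).2,
      forall p, F p = contact_of (A p).1 (col i1 (A p).2)
    & forall c p, atlas c -> cdom c p ->
        [/\ forall X, alpha0 i4 c p X = 0,
            wedge (alpha i2 i1 c p) (alpha i3 i1 c p) != 0,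
            wedge (alpha0 i2 c p) (alpha i2 i1 c p) = 0
          & wedge (alpha0 i3 c p) (alpha i3 i1 c p) = 0]].

Definition framing_star (c : chart R M) (p : M) :=
  star (alpha i2 i1 c p) (alpha i3 i1 c p).

Definition alpha_rho (rho : M -> R) : form1 M 'M[R]_4 := fun c p X =>
  let a i j := alpha i j c p X in
  let r := rho p in
  \matrix_(i < 4, j < 4) nth 0 (nth [::]
    [:: [:: a i1 i1; a i1 i2 + r * a i2 i1; a i1 i3 - r * a i3 i1; 0];
        [:: a i2 i1; 0; - a i3 i2; a i1 i2 + r * a i2 i1];
        [:: a i3 i1; a i3 i2; 0; a i1 i3 - r * a i3 i1];
        [:: 0; a i2 i1; a i3 i1; - a i1 i1]] i) j.

Definition gamma (v : M -> 'cV[R]_4) : form1 M R := fun c p X =>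
  v p i2 0 * alpha0 i2 c p X + v p i3 0 * alpha0 i3 c p X
  - v p i4 0 * alpha0 i1 c p X.

End Framings.

(* S is space-like and its null normal line bundles are spanned by N1, N2
   (which can be taken in the positive cone, up to sign). *)
Definition spacelike_with_normals (U : set M) (S N1 N2 : M -> 'cV[R]_4) : Prop :=
  [/\ forall c p, atlas c -> cdom c p -> U p ->
        forall X, X != 0 -> 0 < mink (dmap c S p X) (dmap c S p X),
      smooth_map U N1 /\ smooth_map U N2,
      forall p, U p -> [/\ Lplus (N1 p), Lplus (N2 p)
                         & forall t : R, N1 p != t *: N2 p]
    & forall c p, atlas c -> cdom c p -> U p -> forall X,
        mink (N1 p) (dmap c S p X) = 0 /\ mink (N2 p) (dmap c S p X) = 0].

(* The nets of curvature lines of F1 and F2 correspond: there are two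
   independent directions which are principal for both maps (any pair of
   principal directions may be used at an umbilic of one of them). *)
Definition preserves_curvature_lines (U : set M) (F1 F2 : M -> contact R) : Prop :=
  forall c p, atlas c -> cdom c p -> U p ->
    exists X Y : 'rV[R]_2,
      [/\ forall s t : R, s *: X + t *: Y = 0 -> s = 0 /\ t = 0,
          curvature_direction F1 c p X /\ curvature_direction F2 c p X
        & curvature_direction F1 c p Y /\ curvature_direction F2 c p Y].

Definition conformal_III (U : set M) (F1 F2 : M -> contact R) : Prop :=
  forall c p, atlas c -> cdom c p -> U p ->
    exists2 l : R, 0 < l & forall X Y, III F2 c p X Y = l * III F1 c p X Y.

(* The orientation of the envelope [S, N] is the one carried by the map
   TM -> dS(TM), X |-> tangential part of dN(X); its determinant has the sign of
   the number below.  For a Darboux congruence these maps for N1 and N2 have,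
   in a common eigenbasis, eigenvalues (x, y) and l(x, y) or l(x, -y).  In the
   first case (equal orientations) S lies in a hyperplane, the reflection in
   which exchanges the envelopes: this is the degenerate case. *)
Definition envelope_orientation (S N : M -> 'cV[R]_4) (c : chart R M) (p : M) : R :=
  \det (\matrix_(i < 2, j < 2)
    mink (dmap c N p (delta_mx 0 i)) (dmap c S p (delta_mx 0 j))).

Definition opposite_orientations (U : set M) (S N1 N2 : M -> 'cV[R]_4) : Prop :=
  forall c p, atlas c -> cdom c p -> U p ->
    envelope_orientation S N1 c p * envelope_orientation S N2 c p < 0.

Definition bianchi_darboux (U : set M) (F1 F2 : M -> contact R) : Prop :=
  [/\ L_isothermic_immersion F1 U, L_isothermic_immersion F2 U
    & exists S N1 N2 : M -> 'cV[R]_4,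
        [/\ immersion U S, spacelike_with_normals U S N1 N2,
            forall p, U p -> F1 p = contact_of (S p) (N1 p) /\
                             F2 p = contact_of (S p) (N2 p),
            preserves_curvature_lines U F1 F2 /\ conformal_III U F1 F2
          & opposite_orientations U S N1 N2]].

End LaguerreGeometry.

(* Main.v *)
(* Write the frame derivative as [da = a alpha'] and put [x = alpha^2_1],
   [y = alpha^3_1]; a principal framing has [alpha^2_0 = k x], [alpha^3_0 = l y].
   The equation for [rho] says that [sqrt rho x] and [sqrt rho y] are closed, which
   is what makes [alpha'_rho] flat and [rho (x +- i y)^2] holomorphic.
   For [V = \sum_j v^j a_j] one finds [dV = - rho (... a_1 + v^4 (x a_2 - y a_3))]:
   the form [gamma = <V, da_0>] is closed, and the choice [s = r / v^4] is exactly
   what makes [S = a_0 + s a_1] orthogonal to [V], so that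
   [dS = ... a_1 + (k + s) x a_2 + (l + s) y a_3].  Hence III is proportional to
   [x^2 + y^2] for both envelopes, x and y are principal for both, and the
   trace-free parts of II are multiples of [x^2 - y^2].  The tangential parts of [da_1]
   and [dV], namely [x a_2 + y a_3] and [- rho v^4 (x a_2 - y a_3)], have opposite
   orientations. *)

Require Import Defs.
From HB Require Import structures.
From mathcomp Require Import all_boot all_order all_algebra.
From mathcomp Require Import all_classical all_reals all_analysis.
From mathcomp Require Import complex.
From mathcomp Require Import ring lra.

Set Implicit Arguments.
Unset Strict Implicit.
Unset Printing Implicit Defensive.

Import Order.TTheory GRing.Theory Num.Theory.
Import numFieldNormedType.Exports.

Local Open Scope classical_set_scope.
Local Open Scope ring_scope.

(** * Calculus in two variables *)

(** Two degenerations shape the result. Since [v^4 = - <V, a_1>] vanishes where [V] is parallel to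
    [a_1], the function [s] and the map [S] live on an open set [U] that avoids such points. And [S]
    is an immersion exactly where [k + s] and [l + s] are both nonzero, whereas the transform is
    immersed on all of [U]: its III is a positive multiple of [x^2 + y^2], so its normal alone has
    injective differential. Immersion of [S] is therefore assumed only for the Darboux property.
    Holomorphy needs one more idea than closedness. In a chart conformal for [x^2 + y^2], the forms
    [sqrt rho x] and [sqrt rho y] are Hodge duals of each other up to sign, so being closed they are
    also coclosed, which gives the Cauchy-Riemann equations. The sign of [x /\ y] is not prescribed;
    the [dz^2] coefficient of [rho (x^2 - y^2)] serves both signs, so it is used in place of the
    square of [x + i y] or [x - i y]. Roots and logarithms are cleared: closedness is kept as
    [2 rho dx = - d rho /\ x]. All metric computations take place in frame components, because the
    frame is an isometry. *)

Section Derivatives.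
Variables (R : realType) (V : normedModType R).

(** Differentiability is local: [g - f] vanishes near [x], hence is negligible against the increment
    and has zero differential there. *)
Lemma near_eq_differentiable (W : normedModType R) (f g : V -> W) x :
  (\near x, f x = g x) -> differentiable f x -> differentiable g x.
Proof.
move=> fg df; rewrite (_ : g = f + (g - f)); last first.
  by apply/funext => y; rewrite !fctE addrC subrK.
apply: differentiableD; first exact: df.
have gf0 : (g - f) \o shift x = cst ((g - f) x) + cst 0 +o_ 0 id.
  apply/eqaddoP => _/posnumP[e].
  have fg0 := nbhs_singleton fg.
  have : \forall y \near 0, f (y + x) = g (y + x).
    by move: fg; rewrite (near_shift 0 x) subr0.
  apply: filterS => y /= fgy; rewrite !fctE /= fg0 fgy !subrr addr0 subrr.
  by rewrite normr0 mulr_ge0.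
pose l : {linear V -> W} := \0.
have l0 : (l : V -> W) = cst 0 by [].
apply/diff_locallyP; rewrite (@diff_unique _ _ _ _ l).
- by split=> //; rewrite l0; exact: cst_continuous.
- by rewrite l0; exact: cst_continuous.
- by [].
Qed.

Lemma derive_comp_linear (W W' : normedModType R) (L : {linear W -> W'})
    (f : V -> W) x v :
  continuous L -> differentiable f x -> 'D_v (L \o f) x = L ('D_v f x).
Proof.
move=> cL df; have dL : differentiable L (f x) by exact: linear_differentiable.
rewrite !deriveE //; last exact: differentiable_comp.
by rewrite diff_comp //= diff_lin.
Qed.

Lemma derive_pair (W W' : normedModType R) (f : V -> W) (g : V -> W') x v :
  differentiable f x -> differentiable g x ->
  'D_v (fun y => (f y, g y)) x = ('D_v f x, 'D_v g x).
Proof.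
move=> df dg; rewrite !deriveE //; last exact: differentiable_pair.
by rewrite diff_pair.
Qed.

Lemma differentiable_mx m n (f : V -> 'M[R]_(m, n)) x :
  (forall i j, differentiable (fun y => f y i j : R) x) -> differentiable f x.
Proof.
move=> df; rewrite (_ : f = \sum_(i < m) \sum_(j < n)
    (fun y => f y i j *: delta_mx i j)); last first.
  apply/funext => y; rewrite {1}(matrix_sum_delta (f y)) fct_sumE.
  by apply: eq_bigr => i _; rewrite fct_sumE.
by do 2 (apply: differentiable_sum => ?); exact: differentiableZl.
Qed.

Lemma differentiable_entry m n (f : V -> 'M[R]_(m, n)) i j x :
  differentiable f x -> differentiable (fun y => f y i j : R) x.
Proof.
move=> df; rewrite (_ : (fun y => f y i j) = (fun N : 'M[R]_(m, n) => N i j : R) \o f) //.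
by apply: differentiable_comp => //; exact: differentiable_coord.
Qed.

Lemma derive_entry m n (f : V -> 'M[R]_(m, n)) x v i j :
  differentiable f x -> 'D_v (fun y => f y i j) x = ('D_v f x) i j.
Proof. by move=> df; rewrite derive_mx ?mxE //; exact: diff_derivable. Qed.

Lemma differentiable_mulmx m n p (f : V -> 'M[R]_(m, n)) (g : V -> 'M[R]_(n, p)) x :
  differentiable f x -> differentiable g x ->
  differentiable (fun y => f y *m g y) x.
Proof.
move=> df dg; apply: differentiable_mx => i j.
rewrite (_ : (fun y => _) = \sum_(k < n) ((fun y => f y i k) * (fun y => g y k j))).
  by apply: differentiable_sum => k; apply: differentiableM; exact: differentiable_entry.
by apply/funext => y; rewrite mxE fct_sumE.
Qed.

Lemma derive_mulmx m n p (f : V -> 'M[R]_(m, n)) (g : V -> 'M[R]_(n, p)) x v :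
  differentiable f x -> differentiable g x ->
  'D_v (fun y => f y *m g y) x = 'D_v f x *m g x + f x *m 'D_v g x.
Proof.
move=> df dg; apply/matrixP => i j.
rewrite -derive_entry; last exact: differentiable_mulmx.
rewrite (_ : (fun y => _) = \sum_(k < n) ((fun y => f y i k) * (fun y => g y k j))).
  rewrite derive_sum; last first.
    move=> k; apply/diff_derivable/differentiableM; exact: differentiable_entry.
  rewrite !mxE -big_split /=; apply: eq_bigr => k _.
  rewrite deriveM; try by apply/diff_derivable/differentiable_entry.
  by rewrite !derive_entry // addrC; congr (_ + _); exact: mulrC.
by apply/funext => y; rewrite mxE fct_sumE.
Qed.

Lemma differentiable_scale m n (k : V -> R) (f : V -> 'M[R]_(m, n)) x :
  differentiable k x -> differentiable f x -> differentiable (fun y => k y *: f y) x.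
Proof.
move=> dk df; apply: differentiable_mx => i j.
rewrite (_ : (fun y => _) = k * (fun y => f y i j)).
  by apply: differentiableM => //; exact: differentiable_entry.
by apply/funext => y; rewrite mxE.
Qed.

Lemma derive_scale m n (k : V -> R) (f : V -> 'M[R]_(m, n)) x v :
  differentiable k x -> differentiable f x ->
  'D_v (fun y => k y *: f y) x = 'D_v k x *: f x + k x *: 'D_v f x.
Proof.
move=> dk df; apply/matrixP => i j.
rewrite -derive_entry; last exact: differentiable_scale.
rewrite (_ : (fun y => _) = k * (fun y => f y i j)).
  rewrite deriveM; try exact: diff_derivable.
    by rewrite !mxE derive_entry // addrC; congr (_ + _); exact: mulrC.
  by apply/diff_derivable/differentiable_entry.
by apply/funext => y; rewrite mxE.
Qed.

End Derivatives.

(** * Closure properties of the classes [Ck] on open subsets of the plane *)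

Section SmoothCalculus.
Variable R : realType.
Local Notation E := 'rV[R]_2.

Section OnOpen.
Variables (U : set E) (oU : open U).

(** Derivatives look at nearby points, so agreement on [U] passes to them only because [U] is open.
    The closure properties below use this to replace a derivative by its explicit formula on [U]. *)
Lemma Ck_ext (W : normedModType R) k (f g : E -> W) :
  (forall x, U x -> f x = g x) -> Ck k U f -> Ck k U g.
Proof.
elim: k f g => [|k IHk] f g fg.
  move=> cf x Ux; rewrite /prop_for /continuous_at -(fg _ Ux).
  have := cf x Ux; apply: cvg_trans; apply: (@near_eq_cvg _ _ (nbhs x)).
  by apply: filterS (open_nbhs_nbhs (conj oU Ux)); exact: fg.
move=> [df C0 C1]; have near_fg x : U x -> \near x, f x = g x.
  by move=> Ux; apply: filterS (open_nbhs_nbhs (conj oU Ux)); exact: fg.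
split.
- by move=> x Ux; apply: near_eq_differentiable (df x Ux); exact: near_fg.
- by apply: IHk C0 => x Ux; apply: near_eq_derive; exact: near_fg.
- by apply: IHk C1 => x Ux; apply: near_eq_derive; exact: near_fg.
Qed.

Lemma CkW (W : normedModType R) k (f : E -> W) : Ck k.+1 U f -> Ck k U f.
Proof.
elim: k f => [|k IHk] f.
  by move=> /= [df _ _] x Ux; exact/differentiable_continuous/df.
by move=> [df C0 C1]; split; [exact: df|exact: (IHk _ C0)|exact: (IHk _ C1)].
Qed.

Lemma Ck_linear (W W' : normedModType R) (L : {linear W -> W'}) k (f : E -> W) :
  continuous L -> Ck k U f -> Ck k U (L \o f).
Proof.
move=> cL; elim: k f => [|k IHk] f /=.
  by move=> cf x Ux; apply: continuous_comp; [exact: cf|exact: cL].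
move=> [df C0 C1]; split.
- move=> x Ux; apply: differentiable_comp; first exact: df.
  exact: linear_differentiable.
- apply: Ck_ext (IHk _ C0) => x Ux /=.
  by rewrite -[X in _ = X]/('D_(e0 R) (L \o f) x) derive_comp_linear //; exact: df.
- apply: Ck_ext (IHk _ C1) => x Ux /=.
  by rewrite -[X in _ = X]/('D_(e1 R) (L \o f) x) derive_comp_linear //; exact: df.
Qed.

Lemma Ck_cst (W : normedModType R) k (w : W) : Ck k U (fun=> w).
Proof.
elim: k w => [|k IHk] w; first by move=> x _; exact: (@cst_continuous E W w x).
split; first by move=> x _; exact: differentiable_cst.
- by apply: Ck_ext (IHk 0) => x _; rewrite derive_cst.
- by apply: Ck_ext (IHk 0) => x _; rewrite derive_cst.
Qed.

Lemma CkD (W : normedModType R) k (f g : E -> W) :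
  Ck k U f -> Ck k U g -> Ck k U (fun x => f x + g x).
Proof.
elim: k f g => [|k IHk] f g /=.
  by move=> cf cg x Ux; apply: continuousD; [exact: cf|exact: cg].
move=> [df f0 f1] [dg g0 g1]; split.
- by move=> x Ux; apply: differentiableD; [exact: df|exact: dg].
- by apply: Ck_ext (IHk _ _ f0 g0) => x Ux; rewrite -[RHS]/('D_(e0 R) (f + g) x)
    deriveD //; apply: diff_derivable; [exact: df|exact: dg].
- by apply: Ck_ext (IHk _ _ f1 g1) => x Ux; rewrite -[RHS]/('D_(e1 R) (f + g) x)
    deriveD //; apply: diff_derivable; [exact: df|exact: dg].
Qed.

Lemma CkM k (f g : E -> R) :
  Ck k U f -> Ck k U g -> Ck k U (fun x => f x * g x).
Proof.
elim: k f g => [|k IHk] f g.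
  by move=> /= cf cg x Ux; apply: continuousM; [exact: cf|exact: cg].
(* The Leibniz rule multiplies a derivative of class [k] by an undifferentiated factor of class
   [k.+1], which has to be lowered to [k] first. *)
move=> Cf Cg; have [Cf' Cg'] := (CkW Cf, CkW Cg).
move: Cf Cg => [df f0 f1] [dg g0 g1]; split.
- by move=> x Ux; apply: differentiableM; [exact: df|exact: dg].
- apply: Ck_ext (CkD (IHk _ _ Cf' g0) (IHk _ _ Cg' f0)) => x Ux.
  by rewrite -[RHS]/('D_(e0 R) (f * g) x) deriveM //; apply: diff_derivable;
    [exact: df|exact: dg].
- apply: Ck_ext (CkD (IHk _ _ Cf' g1) (IHk _ _ Cg' f1)) => x Ux.
  by rewrite -[RHS]/('D_(e1 R) (f * g) x) deriveM //; apply: diff_derivable;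
    [exact: df|exact: dg].
Qed.

(** The derivative of [f^-1] is [- f^-1 * f^-1] times that of [f], so the induction hypothesis on
    [f^-1] itself raises its class by one. *)
Lemma CkV k (f : E -> R) :
  (forall x, U x -> f x != 0) -> Ck k U f -> Ck k U (fun x => (f x)^-1).
Proof.
move=> f0; elim: k => [|k IHk].
  by move=> /= cf x Ux; apply: continuousV; [exact: f0|exact: cf].
move=> Cf; have CV := IHk (CkW Cf); move: Cf => [df C0 C1]; split.
- by move=> x Ux; apply: differentiableV; [exact: df|exact: f0].
- apply: Ck_ext (CkM (CkM (Ck_cst k (-1 : R)) (CkM CV CV)) C0) => x Ux.
  rewrite -[RHS]/('D_(e0 R) (fun y => (f y)^-1) x) deriveV ?f0 //.
    by rewrite mulN1r -expr2 exprVn.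
  exact/diff_derivable/df.
- apply: Ck_ext (CkM (CkM (Ck_cst k (-1 : R)) (CkM CV CV)) C1) => x Ux.
  rewrite -[RHS]/('D_(e1 R) (fun y => (f y)^-1) x) deriveV ?f0 //.
    by rewrite mulN1r -expr2 exprVn.
  exact/diff_derivable/df.
Qed.

Lemma smooth_on_ext (W : normedModType R) (f g : E -> W) :
  (forall x, U x -> f x = g x) -> smooth_on U f -> smooth_on U g.
Proof. by move=> fg sf k; exact: Ck_ext (sf k). Qed.

Lemma smooth_on_differentiable (W : normedModType R) (f : E -> W) x :
  smooth_on U f -> U x -> differentiable f x.
Proof. by move=> sf Ux; have [df _ _] := sf 1%N; exact: df. Qed.

Lemma smooth_on_derive0 (W : normedModType R) (f : E -> W) :
  smooth_on U f -> smooth_on U (fun x => 'D_(e0 R) f x).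
Proof. by move=> sf k; have [] := sf k.+1. Qed.

Lemma smooth_on_derive1 (W : normedModType R) (f : E -> W) :
  smooth_on U f -> smooth_on U (fun x => 'D_(e1 R) f x).
Proof. by move=> sf k; have [] := sf k.+1. Qed.

Lemma smooth_on_linear (W W' : normedModType R) (L : {linear W -> W'}) (f : E -> W) :
  continuous L -> smooth_on U f -> smooth_on U (L \o f).
Proof. by move=> cL sf k; exact: Ck_linear. Qed.

Lemma smooth_on_cst (W : normedModType R) (w : W) : smooth_on U (fun=> w).
Proof. by move=> k; exact: Ck_cst. Qed.

Lemma smooth_onD (W : normedModType R) (f g : E -> W) :
  smooth_on U f -> smooth_on U g -> smooth_on U (fun x => f x + g x).
Proof. by move=> sf sg k; exact: CkD. Qed.

Lemma smooth_onM (f g : E -> R) :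
  smooth_on U f -> smooth_on U g -> smooth_on U (fun x => f x * g x).
Proof. by move=> sf sg k; exact: CkM. Qed.

Lemma smooth_onV (f : E -> R) : (forall x, U x -> f x != 0) ->
  smooth_on U f -> smooth_on U (fun x => (f x)^-1).
Proof. by move=> f0 sf k; exact: CkV. Qed.

Lemma smooth_on_sum (W : normedModType R) n (f : 'I_n -> E -> W) :
  (forall i, smooth_on U (f i)) -> smooth_on U (fun x => \sum_(i < n) f i x).
Proof.
elim: n f => [|n IHn] f sf.
  apply: smooth_on_ext (smooth_on_cst 0) => x _; first by rewrite big_ord0.
apply: smooth_on_ext (smooth_onD (sf ord0) (IHn (fun i => f (lift ord0 i)) _)) => //.
by move=> x _; rewrite big_ord_recl.
Qed.

Lemma smooth_on_entry m n (f : E -> 'M[R]_(m, n)) i j :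
  smooth_on U f -> smooth_on U (fun x => f x i j : R).
Proof.
have l1 : linear (fun N : 'M[R]_(m, n) => N i j : R) by move=> a u v; rewrite !mxE.
pose L : {linear 'M[R]_(m, n) -> R} := HB.pack (fun N : 'M[R]_(m, n) => N i j : R)
  (GRing.isLinear.Build _ _ _ _ _ l1).
by move=> sf; apply: (@smooth_on_linear _ _ L) => //; exact: coord_continuous.
Qed.

Lemma smooth_on_mx m n (f : E -> 'M[R]_(m, n)) :
  (forall i j, smooth_on U (fun x => f x i j : R)) -> smooth_on U f.
Proof.
move=> sf.
have sfD i j : smooth_on U (fun x => f x i j *: (delta_mx i j : 'M[R]_(m, n))).
  have l1 : linear (fun k : R => k *: (delta_mx i j : 'M[R]_(m, n))).
    by move=> a u v; rewrite scalerDl scalerA.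
  pose L : {linear R -> 'M[R]_(m, n)} := HB.pack
    (fun k : R => k *: (delta_mx i j : 'M[R]_(m, n)))
    (GRing.isLinear.Build _ _ _ _ _ l1).
  have cL : continuous L by exact: scalel_continuous.
  exact: (smooth_on_linear cL (sf i j)).
apply: smooth_on_ext (smooth_on_sum (fun i => smooth_on_sum (sfD i))) => x _.
by rewrite -matrix_sum_delta.
Qed.

Lemma smooth_on_pair (W W' : normedModType R) (f : E -> W) (g : E -> W') :
  smooth_on U f -> smooth_on U g -> smooth_on U (fun x => (f x, g x)).
Proof.
have l1 : linear (fun w : W => (w, 0 : W')).
  by move=> a u v; congr (_, _); rewrite /= scaler0 addr0.
have l2 : linear (fun w : W' => (0 : W, w)).
  by move=> a u v; congr (_, _); rewrite /= scaler0 addr0.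
pose L1 : {linear W -> (W * W')%type} := HB.pack (fun w : W => (w, 0 : W'))
  (GRing.isLinear.Build _ _ _ _ _ l1).
pose L2 : {linear W' -> (W * W')%type} := HB.pack (fun w : W' => (0 : W, w))
  (GRing.isLinear.Build _ _ _ _ _ l2).
have c1 : continuous L1 by move=> w; apply: cvg_pair; [exact: cvg_id|exact: cvg_cst].
have c2 : continuous L2 by move=> w; apply: cvg_pair; [exact: cvg_cst|exact: cvg_id].
move=> sf sg.
apply: smooth_on_ext (smooth_onD (smooth_on_linear c1 sf) (smooth_on_linear c2 sg)).
by move=> x _; congr (_, _); rewrite /= ?addr0 ?add0r.
Qed.

Lemma smooth_on_fst (W W' : normedModType R) (f : E -> (W * W')%type) :
  smooth_on U f -> smooth_on U (fun x => (f x).1).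
Proof. by apply: (@smooth_on_linear _ _ (@fst W W')) => w; exact: cvg_fst. Qed.

Lemma smooth_on_snd (W W' : normedModType R) (f : E -> (W * W')%type) :
  smooth_on U f -> smooth_on U (fun x => (f x).2).
Proof. by apply: (@smooth_on_linear _ _ (@snd W W')) => w; exact: cvg_snd. Qed.

End OnOpen.

Lemma smooth_on_sub (W : normedModType R) (U V : set E) (f : E -> W) :
  U `<=` V -> smooth_on V f -> smooth_on U f.
Proof.
move=> UV sf k; move: (sf k) => {sf}; elim: k f => [|k IHk] f.
  by move=> cf x Ux; apply: cf; exact: UV.
move=> [df C0 C1]; split; [|exact: (IHk _ C0)|exact: (IHk _ C1)].
by move=> x Ux; apply: df; exact: UV.
Qed.

End SmoothCalculus.

(** * Symmetry of second derivatives *)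

Section MixedDerivatives.
Variables (R : realType).

(** Turns a directional derivative into a derivative in one real variable, to which the mean value
    theorem applies. *)
Lemma is_derive_line (V : normedModType R) (f : V -> R) (p u : V) (t : R) :
  differentiable f (p + t *: u) ->
  is_derive t 1 (fun t : R => f (p + t *: u)) ('D_u f (p + t *: u)).
Proof.
move=> df.
pose g := (fun=> p) + ( *:%R^~ u) : R -> V.
have ds : is_diff t ( *:%R^~ u : R -> V) ( *:%R^~ u) by exact: is_diff_scalel.
have dg : differentiable g t.
  by apply: differentiableD; [exact: differentiable_cst|case: ds].
have gE : 'd g t = *:%R^~ u :> (R -> V).
  rewrite /g diffD; [|exact: differentiable_cst|by case: ds].
  by case: ds => _ ds; apply/funext => y /=; rewrite diff_cst ds /= add0r.
rewrite (_ : (fun t : R => f (p + t *: u)) = f \o g) //.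
have dc : differentiable (f \o g) t by exact: differentiable_comp.
apply: DeriveDef; first exact: diff_derivable.
by rewrite deriveE // diff_comp //= gE scale1r deriveE.
Qed.

(** A second difference over the parallelogram with edges [h *: u] and [h *: w]. The mean value
    theorem is applied along [u] to the difference [phi] of [f] on two opposite edges, then along
    [w] to the derivative that results. *)
Lemma mean_value_square (V : normedModType R) (f : V -> R) (U : set V)
    (x u w : V) (h : R) :
  0 < h ->
  (forall a b, 0 <= a <= h -> 0 <= b <= h -> U (x + a *: u + b *: w)) ->
  (forall y, U y -> differentiable f y) ->
  (forall y, U y -> differentiable (fun z => 'D_u f z) y) ->
  exists a b, [/\ 0 <= a <= h, 0 <= b <= h &
    f (x + h *: u + h *: w) - f (x + h *: u) - f (x + h *: w) + f x =
    'D_w (fun z => 'D_u f z) (x + a *: u + b *: w) * h * h].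
Proof.
move=> h0 Uxh df dDf; have h0' := ltW h0.
have h00 : (0 : R) <= 0 <= h by rewrite lexx h0'.
have hh : 0 <= h <= h by rewrite lexx h0'.
pose phi t := f (x + h *: w + t *: u) - f (x + t *: u).
pose dphi t := 'D_u f (x + h *: w + t *: u) - 'D_u f (x + t *: u).
have dphiP t : 0 <= t <= h -> is_derive t 1 phi (dphi t).
  move=> ht; apply: is_deriveB; apply: is_derive_line; apply: df.
    by rewrite addrAC; exact: Uxh.
  by have := Uxh _ _ ht h00; rewrite scale0r addr0.
have cphi : {within `[0, h], continuous phi}.
  apply: derivable_within_continuous => t; rewrite in_itv /= => ht.
  by have [] := dphiP _ ht.
have [|a] := @MVT_segment R phi dphi 0 h h0' _ cphi.
  by move=> t; rewrite in_itv /= => /andP[t0 th]; apply: dphiP; rewrite !ltW.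
rewrite in_itv /= => ha phiE.
pose psi t := 'D_u f (x + a *: u + t *: w).
pose dpsi t := 'D_w (fun z => 'D_u f z) (x + a *: u + t *: w).
have dpsiP t : 0 <= t <= h -> is_derive t 1 psi (dpsi t).
  by move=> ht; apply: (@is_derive_line _ (fun z => 'D_u f z)); apply: dDf; exact: Uxh.
have cpsi : {within `[0, h], continuous psi}.
  apply: derivable_within_continuous => t; rewrite in_itv /= => ht.
  by have [] := dpsiP _ ht.
have [|b] := @MVT_segment R psi dpsi 0 h h0' _ cpsi.
  by move=> t; rewrite in_itv /= => /andP[t0 th]; apply: dpsiP; rewrite !ltW.
rewrite in_itv /= => hb psiE; exists a, b; split=> //.
move: psiE phiE; rewrite /psi /phi /dphi /dpsi !scale0r !addr0 !subr0.
rewrite (addrAC x (h *: w) (a *: u)) (addrAC x (h *: w) (h *: u)) => -> <-.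
by ring.
Qed.

Lemma dist_le_of_halves (e p q c : R) :
  `|p - c| < e / 2 -> `|q - c| < e / 2 -> `|p - q| <= e.
Proof.
move=> pc qc; have := ler_distD c p q; rewrite (distrC c q).
by move: `|p - c| `|q - c| `|p - q| pc qc => x y z; lra.
Qed.

(** The second difference is unchanged when [u] and [w] are exchanged, so the two mixed derivatives
    take a common value at two points of a small parallelogram; by continuity that value is within
    [e / 2] of both derivatives at [x]. *)
Lemma derive_comm (V : normedModType R) (f : V -> R) (U : set V) (x u w : V) :
  open U -> U x ->
  (forall y, U y -> differentiable f y) ->
  (forall y, U y -> differentiable (fun z => 'D_u f z) y) ->
  (forall y, U y -> differentiable (fun z => 'D_w f z) y) ->
  {for x, continuous (fun y => 'D_w (fun z => 'D_u f z) y)} ->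
  {for x, continuous (fun y => 'D_u (fun z => 'D_w f z) y)} ->
  'D_w (fun z => 'D_u f z) x = 'D_u (fun z => 'D_w f z) x.
Proof.
move=> oU Ux df du dw cwu cuw; apply/eqP; rewrite -subr_eq0 -normr_le0.
apply/ler_addgt0Pr => e e0; rewrite add0r.
have e20 : 0 < e / 2 by rewrite divr_gt0.
have /cvgrPdist_lt/(_ _ e20) n1 := cwu.
have /cvgrPdist_lt/(_ _ e20) n2 := cuw.
have n3 : \forall y \near x, U y by exact: open_nbhs_nbhs.
have [d /= d0 bd] := (nbhs_ballP x _).1 (filterI n3 (filterI n1 n2)).
(* The summand 1 keeps [N] positive when [u] and [w] vanish, and [h * N = d / 2] keeps the whole
   parallelogram inside the ball. *)
pose N := `|u| + `|w| + 1; have N0 : 0 < N by rewrite ltr_wpDl // addr_ge0.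
pose h := d / 2 / N; have h0 : 0 < h by rewrite !divr_gt0.
have hball a b : 0 <= a <= h -> 0 <= b <= h -> ball x d (x + a *: u + b *: w).
  move=> /andP[a0 ah] /andP[b0 bh]; rewrite -ball_normE /ball_ /=.
  rewrite -addrA opprD addrA subrr sub0r normrN (le_lt_trans (ler_normD _ _)) //.
  rewrite !normrZ (ger0_norm a0) (ger0_norm b0).
  have : a * `|u| + b * `|w| <= h * N.
    rewrite /N !mulrDr mulr1 ler_wpDr ?(ltW h0) //.
    by apply: lerD; apply: ler_wpM2r.
  move=> /le_lt_trans; apply; rewrite /h divfK ?gt_eqF //.
  by rewrite ltr_pdivrMr // ltr_pMr // ltr1n.
have [||a [b [ha hb E1]]] := @mean_value_square _ f (ball x d) x u w h h0 hball.
- by move=> y /bd[/df].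
- by move=> y /bd[/du].
have [|||a' [b' [ha' hb' E2]]] := @mean_value_square _ f (ball x d) x w u h h0.
- by move=> a' b' ha' hb'; rewrite addrAC; exact: hball.
- by move=> y /bd[/df].
- by move=> y /bd[/dw].
have [_ [b1 _]] := bd _ (hball _ _ ha hb).
have [_ [_ b2]] : (U `&` ((fun t => `|'D_w (fun z => 'D_u f z) x -
    'D_w (fun z => 'D_u f z) t| < e / 2) `&` (fun t => `|'D_u (fun z => 'D_w f z) x -
    'D_u (fun z => 'D_w f z) t| < e / 2))) (x + a' *: w + b' *: u).
  by apply: bd; rewrite addrAC; exact: hball.
have EE : 'D_w (fun z => 'D_u f z) (x + a *: u + b *: w) =
          'D_u (fun z => 'D_w f z) (x + a' *: w + b' *: u).
  apply: (mulIf (lt0r_neq0 h0)); apply: (mulIf (lt0r_neq0 h0)).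
  apply: etrans (esym E1) _; apply: etrans _ E2.
  by rewrite (addrAC x (h *: w) (h *: u)); ring.
by move: b2; rewrite /= -EE; exact: dist_le_of_halves b1.
Qed.

Local Notation E := 'rV[R]_2.

Lemma smooth_on_derive_comm m n (U : set E) (f : E -> 'M[R]_(m, n)) x :
  open U -> smooth_on U f -> U x ->
  'D_(e0 R) (fun y => 'D_(e1 R) f y) x = 'D_(e1 R) (fun y => 'D_(e0 R) f y) x.
Proof.
move=> oU sf Ux.
have df y : U y -> differentiable f y by exact: smooth_on_differentiable.
have s0 := smooth_on_derive0 sf; have s1 := smooth_on_derive1 sf.
apply/matrixP => i j.
apply: etrans (esym (derive_entry _ i j (smooth_on_differentiable s1 Ux))) _.
apply: etrans _ (derive_entry _ i j (smooth_on_differentiable s0 Ux)).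
have nearD v : \forall y \near x, ('D_v f y) i j = 'D_v (fun y => f y i j : R) y.
  apply: filterS (open_nbhs_nbhs (conj oU Ux)) => y Uy.
  by rewrite derive_entry //; exact: df.
rewrite (near_eq_derive _ (nearD (e1 R))) (near_eq_derive _ (nearD (e0 R))).
have sfij : smooth_on U (fun y => f y i j : R) by exact: smooth_on_entry.
have t0 := smooth_on_derive0 sfij; have t1 := smooth_on_derive1 sfij.
apply: (@derive_comm _ _ U) => //.
- by move=> y; exact: smooth_on_differentiable.
- by move=> y; exact: smooth_on_differentiable.
- by move=> y; exact: smooth_on_differentiable.
- exact: differentiable_continuous (smooth_on_differentiable (smooth_on_derive0 t1) Ux).
- exact: differentiable_continuous (smooth_on_differentiable (smooth_on_derive1 t0) Ux).
Qed.

End MixedDerivatives.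

(** * Calculus in charts *)

Section Charts.
Variables (R : realType) (M : surface R).
Implicit Types (c d : chart R M) (U V : set M) (p q : M).

Lemma row2E (X : 'rV[R]_2) : X = X 0 ord0 *: e0 R + X 0 ord_max *: e1 R.
Proof.
apply/rowP => -[[|[|//]] h]; rewrite !mxE /=.
- by rewrite mulr1 mulr0 addr0; congr (X 0 _); exact/val_inj.
- by rewrite mulr1 mulr0 add0r; congr (X 0 _); exact/val_inj.
Qed.

(* [smooth_map] read in a single chart; forms are only smooth in this sense,
   since their coefficients depend on the chart. *)
Definition smooth_in (W : normedModType R) c U (g : M -> W) :=
  smooth_on (cmap c @` (cdom c `&` U)) (g \o cinv c).

(** Inside the open image of the chart, this set is the preimage of [U] under the continuous
    [cinv c]. *)
Lemma open_cmap_image c U : atlas c -> open U -> open (cmap c @` (cdom c `&` U)).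
Proof.
move=> /atlas_chart [oc oi cK _ ci] oU; rewrite openE => x [p [cp Up] <-].
have ip : (cmap c @` cdom c) (cmap c p) by exists p.
have n1 : \forall y \near cmap c p, (cmap c @` cdom c) y by exact: open_nbhs_nbhs.
have n2 : \forall y \near cmap c p, U (cinv c y).
  by apply: (ci _ ip); rewrite cK //; exact: open_nbhs_nbhs.
rewrite /interior; apply: filterS2 n1 n2 => y [q cq <-]; rewrite cK // => Uq.
by exists q.
Qed.

Lemma smooth_in_sub (W : normedModType R) c U V (f : M -> W) :
  U `<=` V -> smooth_in c V f -> smooth_in c U f.
Proof. by move=> UV; apply: smooth_on_sub => x [p [cp /UV Vp] <-]; exists p. Qed.

Lemma open_cdom c : atlas c -> open (cdom c).
Proof. by move=> /atlas_chart []. Qed.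

Lemma cmapK c p : atlas c -> cdom c p -> cinv c (cmap c p) = p.
Proof. by move=> /atlas_chart [_ _ cK _ _]; exact: cK. Qed.

Lemma near_chart c U p : atlas c -> open U -> cdom c p -> U p ->
  \forall x \near cmap c p, (cmap c @` (cdom c `&` U)) x.
Proof.
move=> ac oU cp Up; apply: open_nbhs_nbhs; split; first exact: open_cmap_image.
by exists p.
Qed.

Section OneChart.
Variables (c : chart R M) (U : set M).
Hypotheses (ac : atlas c) (oU : open U).
Local Notation oW := (open_cmap_image ac oU).

Lemma smooth_in_ext (W : normedModType R) (f g : M -> W) :
  (forall p, cdom c p -> U p -> f p = g p) -> smooth_in c U f -> smooth_in c U g.
Proof.
move=> fg; apply: (smooth_on_ext oW) => x [p [cp Up] <-] /=.
by rewrite cmapK //; exact: fg.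
Qed.

Lemma smooth_inD (W : normedModType R) (f g : M -> W) :
  smooth_in c U f -> smooth_in c U g -> smooth_in c U (fun p => f p + g p).
Proof. by move=> sf sg; exact: (smooth_onD oW sf sg). Qed.

Lemma smooth_inM (f g : M -> R) :
  smooth_in c U f -> smooth_in c U g -> smooth_in c U (fun p => f p * g p).
Proof. by move=> sf sg; exact: (smooth_onM oW sf sg). Qed.

Lemma smooth_in_cst (W : normedModType R) (w : W) : smooth_in c U (fun=> w).
Proof. exact: (smooth_on_cst oW w). Qed.

Lemma smooth_inN (W : normedModType R) (f : M -> W) :
  smooth_in c U f -> smooth_in c U (fun p => - f p).
Proof. by apply: (smooth_on_linear oW (L := @GRing.opp W)) => w; exact: opp_continuous. Qed.

Lemma smooth_inB (W : normedModType R) (f g : M -> W) :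
  smooth_in c U f -> smooth_in c U g -> smooth_in c U (fun p => f p - g p).
Proof. by move=> sf sg; apply: smooth_inD => //; exact: smooth_inN. Qed.

Lemma smooth_inV (f : M -> R) : (forall p, cdom c p -> U p -> f p != 0) ->
  smooth_in c U f -> smooth_in c U (fun p => (f p)^-1).
Proof.
move=> f0 sf; apply: (smooth_onV oW) sf => x [p [cp Up] <-] /=.
by rewrite cmapK //; exact: f0.
Qed.

Lemma smooth_in_sum (W : normedModType R) n (f : 'I_n -> M -> W) :
  (forall i, smooth_in c U (f i)) -> smooth_in c U (fun p => \sum_(i < n) f i p).
Proof. by move=> sf; exact: (smooth_on_sum oW sf). Qed.

Lemma smooth_in_entry m n (f : M -> 'M[R]_(m, n)) i j :
  smooth_in c U f -> smooth_in c U (fun p => f p i j : R).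
Proof. by move=> sf; exact: (smooth_on_entry oW i j sf). Qed.

Lemma smooth_in_mx m n (f : M -> 'M[R]_(m, n)) :
  (forall i j, smooth_in c U (fun p => f p i j : R)) -> smooth_in c U f.
Proof. by move=> sf; exact: (smooth_on_mx oW sf). Qed.

Lemma smooth_in_scale m n (k : M -> R) (f : M -> 'M[R]_(m, n)) :
  smooth_in c U k -> smooth_in c U f -> smooth_in c U (fun p => k p *: f p).
Proof.
move=> sk sf; apply: smooth_in_mx => i j.
apply: smooth_in_ext (smooth_inM sk (smooth_in_entry i j sf)) => p _ _.
by rewrite mxE.
Qed.

Lemma smooth_in_mulmx m n k (f : M -> 'M[R]_(m, n)) (g : M -> 'M[R]_(n, k)) :
  smooth_in c U f -> smooth_in c U g -> smooth_in c U (fun p => f p *m g p).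
Proof.
move=> sf sg; apply: smooth_in_mx => i j.
apply: smooth_in_ext (smooth_in_sum
  (fun l => smooth_inM (smooth_in_entry i l sf) (smooth_in_entry l j sg))) => p _ _.
by rewrite mxE.
Qed.

Lemma smooth_in_tr m n (f : M -> 'M[R]_(m, n)) :
  smooth_in c U f -> smooth_in c U (fun p => (f p)^T).
Proof.
move=> sf; apply: smooth_in_mx => i j.
by apply: smooth_in_ext (smooth_in_entry j i sf) => p _ _; rewrite mxE.
Qed.

Lemma smooth_in_pair (W W' : normedModType R) (f : M -> W) (g : M -> W') :
  smooth_in c U f -> smooth_in c U g -> smooth_in c U (fun p => (f p, g p)).
Proof. by move=> sf sg; exact: (smooth_on_pair oW sf sg). Qed.

Lemma smooth_in_fst (W W' : normedModType R) (f : M -> (W * W')%type) :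
  smooth_in c U f -> smooth_in c U (fun p => (f p).1).
Proof. by move=> sf; exact: (smooth_on_fst oW sf). Qed.

Lemma smooth_in_snd (W W' : normedModType R) (f : M -> (W * W')%type) :
  smooth_in c U f -> smooth_in c U (fun p => (f p).2).
Proof. by move=> sf; exact: (smooth_on_snd oW sf). Qed.

Lemma smooth_in_dmap0 (W : normedModType R) (f : M -> W) :
  smooth_in c U f -> smooth_in c U (fun p => dmap c f p (e0 R)).
Proof.
move=> /smooth_on_derive0; apply: (smooth_on_ext oW) => x [p [cp Up] <-] /=.
by rewrite /dmap cmapK.
Qed.

Lemma smooth_in_dmap1 (W : normedModType R) (f : M -> W) :
  smooth_in c U f -> smooth_in c U (fun p => dmap c f p (e1 R)).
Proof.
move=> /smooth_on_derive1; apply: (smooth_on_ext oW) => x [p [cp Up] <-] /=.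
by rewrite /dmap cmapK.
Qed.

Section AtPoint.
Variable p : M.
Hypotheses (cp : cdom c p) (Up : U p).

Lemma smooth_in_differentiable (W : normedModType R) (f : M -> W) :
  smooth_in c U f -> differentiable (f \o cinv c) (cmap c p).
Proof. by move=> sf; apply: (smooth_on_differentiable sf); exists p. Qed.

Lemma dmap_ext (W : normedModType R) (f g : M -> W) X :
  (forall q, cdom c q -> U q -> f q = g q) -> dmap c f p X = dmap c g p X.
Proof.
move=> fg; apply: near_eq_derive; apply: filterS (near_chart ac oU cp Up).
by move=> x [q [cq Uq] <-] /=; rewrite cmapK //; exact: fg.
Qed.

Lemma dmap_linear (W : normedModType R) (f : M -> W) a X Y :
  smooth_in c U f -> dmap c f p (a *: X + Y) = a *: dmap c f p X + dmap c f p Y.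
Proof.
move=> sf; have df := smooth_in_differentiable sf.
by rewrite /dmap !deriveE // linearP.
Qed.

Lemma dmap_cst (W : normedModType R) (w : W) X : dmap c (fun=> w) p X = 0.
Proof. exact: derive_cst. Qed.

Lemma dmapD (W : normedModType R) (f g : M -> W) X :
  smooth_in c U f -> smooth_in c U g ->
  dmap c (fun q => f q + g q) p X = dmap c f p X + dmap c g p X.
Proof.
move=> /smooth_in_differentiable df /smooth_in_differentiable dg.
rewrite -[LHS]/('D_X ((f \o cinv c) + (g \o cinv c)) (cmap c p)).
by rewrite deriveD //; exact: diff_derivable.
Qed.

Lemma dmapM (f g : M -> R) X : smooth_in c U f -> smooth_in c U g ->
  dmap c (fun q => f q * g q) p X = dmap c f p X * g p + f p * dmap c g p X.
Proof.
move=> /smooth_in_differentiable df /smooth_in_differentiable dg.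
rewrite -[LHS]/('D_X ((f \o cinv c) * (g \o cinv c)) (cmap c p)).
rewrite deriveM; try exact: diff_derivable.
by rewrite /= cmapK // addrC; congr (_ + _); exact: mulrC.
Qed.

Lemma dmapN (W : normedModType R) (f : M -> W) X : smooth_in c U f ->
  dmap c (fun q => - f q) p X = - dmap c f p X.
Proof.
move=> /smooth_in_differentiable df.
by rewrite -[LHS]/('D_X (- (f \o cinv c)) (cmap c p)) deriveN //; exact: diff_derivable.
Qed.

Lemma dmapB (W : normedModType R) (f g : M -> W) X : smooth_in c U f -> smooth_in c U g ->
  dmap c (fun q => f q - g q) p X = dmap c f p X - dmap c g p X.
Proof.
by move=> sf sg; rewrite dmapD ?dmapN //; exact: smooth_inN.
Qed.

Lemma dmap_entry m n (f : M -> 'M[R]_(m, n)) i j X : smooth_in c U f ->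
  dmap c (fun q => f q i j : R) p X = (dmap c f p X) i j.
Proof. by move=> /smooth_in_differentiable df; exact: (derive_entry X i j df). Qed.

Lemma dmap_mulmx m n k (f : M -> 'M[R]_(m, n)) (g : M -> 'M[R]_(n, k)) X :
  smooth_in c U f -> smooth_in c U g ->
  dmap c (fun q => f q *m g q) p X = dmap c f p X *m g p + f p *m dmap c g p X.
Proof.
move=> /smooth_in_differentiable df /smooth_in_differentiable dg.
by rewrite {1}/dmap (derive_mulmx X df dg) /= cmapK.
Qed.

Lemma dmap_scale m n (k : M -> R) (f : M -> 'M[R]_(m, n)) X :
  smooth_in c U k -> smooth_in c U f ->
  dmap c (fun q => k q *: f q) p X = dmap c k p X *: f p + k p *: dmap c f p X.
Proof.
move=> /smooth_in_differentiable df /smooth_in_differentiable dg.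
by rewrite {1}/dmap (derive_scale X df dg) /= cmapK.
Qed.

Lemma dmap_tr m n (f : M -> 'M[R]_(m, n)) X : smooth_in c U f ->
  dmap c (fun q => (f q)^T) p X = (dmap c f p X)^T.
Proof.
move=> sf; apply/matrixP => i j; rewrite -dmap_entry; last exact: smooth_in_tr.
rewrite mxE -dmap_entry //; congr (dmap c _ p X).
by apply/funext => q; rewrite mxE.
Qed.

Lemma dmap_pair (W W' : normedModType R) (f : M -> W) (g : M -> W') X :
  smooth_in c U f -> smooth_in c U g ->
  dmap c (fun q => (f q, g q)) p X = (dmap c f p X, dmap c g p X).
Proof.
move=> /smooth_in_differentiable df /smooth_in_differentiable dg.
exact: (derive_pair X df dg).
Qed.

Lemma dmap_comm m n (f : M -> 'M[R]_(m, n)) : smooth_in c U f ->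
  dmap c (fun q => dmap c f q (e1 R)) p (e0 R) =
  dmap c (fun q => dmap c f q (e0 R)) p (e1 R).
Proof.
move=> sf; have Wp : (cmap c @` (cdom c `&` U)) (cmap c p) by exists p.
(* Read in the chart, [dmap] is an ordinary directional derivative only on the image of the domain,
   where [cinv c] inverts [cmap c]; this suffices near [cmap c p]. *)
have near_dmap X : \forall x \near cmap c p,
    ((fun q => dmap c f q X) \o cinv c) x = 'D_X (f \o cinv c) x.
  apply: filterS (near_chart ac oU cp Up) => x [q [cq Uq] <-].
  by rewrite /dmap /= cmapK.
rewrite /dmap (near_eq_derive (e0 R) (near_dmap (e1 R))).
rewrite (near_eq_derive (e1 R) (near_dmap (e0 R))).
exact: smooth_on_derive_comm oW sf Wp.
Qed.

End AtPoint.
End OneChart.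

Section ChartChange.
Variables (c d : chart R M) (p : M).
Hypotheses (ac : atlas c) (ad : atlas d) (cp : cdom c p) (dp : cdom d p).

Lemma smooth_in_cmap : smooth_in d (cdom c) (cmap c).
Proof. by have [] := atlas_compatible ad ac. Qed.

(** The chain rule for the transition map: [dmap d (cmap c) p] converts the components of a tangent
    vector from [d] to [c]. Forms change charts through it. *)
Lemma dmap_chart (W : normedModType R) U (f : M -> W) X :
  open U -> U p -> smooth_in c U f ->
  dmap d f p X = dmap c f p (dmap d (cmap c) p X).
Proof.
move=> oU Up sf; have df := smooth_in_differentiable cp Up sf.
have dc : differentiable (cmap c \o cinv d) (cmap d p).
  by exact: (smooth_in_differentiable dp cp smooth_in_cmap).
have E : (cmap c \o cinv d) (cmap d p) = cmap c p by rewrite /= cmapK.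
have -> : dmap d f p X = 'D_X ((f \o cinv c) \o (cmap c \o cinv d)) (cmap d p).
  apply: near_eq_derive; apply: filterS (near_chart ad (open_cdom ac) dp cp).
  by move=> x [q [dq cq] <-] /=; rewrite !cmapK.
rewrite deriveE; last by apply: differentiable_comp => //; rewrite E.
rewrite diff_comp //; last by rewrite E.
by rewrite /dmap /= cmapK // !deriveE.
Qed.

(** This is where the orientation of the atlas enters; it later excludes antiholomorphic changes of
    coordinates. *)
Lemma chart_change_det :
  0 < wedge (fun X => dmap d (cmap c) p X 0 ord0)
            (fun X => dmap d (cmap c) p X 0 ord_max).
Proof.
have [_ /(_ (cmap d p))] := atlas_compatible ad ac.
have Wp : (cmap d @` (cdom d `&` cdom c)) (cmap d p) by exists p.
move=> /(_ Wp); rewrite (expand_det_row _ ord0) !big_ord_recl big_ord0 addr0.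
rewrite /cofactor !det_mx11 /= !mxE /= expr0 !mul1r.
rewrite (_ : (-1) ^+ _ = -1 :> R) // mulN1r mulrN.
have o1 (i : 'I_2) : i != ord0 -> i = ord_max by case: i => [[|[|]]] // ? _; exact/val_inj.
have -> : lift ord0 0 = ord_max :> 'I_2 by exact: o1.
have -> : lift ord_max 0 = ord0 :> 'I_2 by exact/val_inj.
by rewrite /wedge /dmap [X in _ - X]mulrC.
Qed.

End ChartChange.

End Charts.

Section ChangeOfVariables.
Variable R : realType.
Local Notation E := 'rV[R]_2.

Lemma derive_comp2 (f : E -> R) (t : E -> E) x v :
  differentiable t x -> differentiable f (t x) ->
  'D_v (f \o t) x =
  ('D_v t x) 0 ord0 * 'D_(e0 R) f (t x) + ('D_v t x) 0 ord_max * 'D_(e1 R) f (t x).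
Proof.
move=> dt df; rewrite (deriveE v (differentiable_comp dt df)) (diff_comp dt df) /=.
rewrite -(deriveE v dt) [X in 'd f (t x) X]row2E linearD !linearZ /=.
by rewrite -!deriveE.
Qed.

Lemma Ck_comp (W V : set E) (t : E -> E) k (f : E -> R) :
  open W -> open V -> smooth_on W t -> (forall x, W x -> V (t x)) ->
  Ck k V f -> Ck k W (f \o t).
Proof.
move=> oW oV st WV; elim: k f => [|k IHk] f.
  move=> cf x Wx; apply: continuous_comp; last exact: cf (WV _ Wx).
  exact: differentiable_continuous (smooth_on_differentiable st Wx).
move=> [df f0 f1]; split.
- move=> x Wx; apply: differentiable_comp; last exact: df (WV _ Wx).
  exact: (smooth_on_differentiable st Wx).
- have sD := smooth_on_derive0 st.
  apply: (Ck_ext oW _ (CkD oW (CkM oW (smooth_on_entry oW 0 ord0 sD k) (IHk _ f0))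
    (CkM oW (smooth_on_entry oW 0 ord_max sD k) (IHk _ f1)))) => x Wx.
  apply/esym/derive_comp2; last exact: df (WV _ Wx).
  exact: (smooth_on_differentiable st Wx).
- have sD := smooth_on_derive1 st.
  apply: (Ck_ext oW _ (CkD oW (CkM oW (smooth_on_entry oW 0 ord0 sD k) (IHk _ f0))
    (CkM oW (smooth_on_entry oW 0 ord_max sD k) (IHk _ f1)))) => x Wx.
  apply/esym/derive_comp2; last exact: df (WV _ Wx).
  exact: (smooth_on_differentiable st Wx).
Qed.

(** The coefficient of a form depends on the chart and is first seen to be smooth in that chart
    only. Composition with transition maps then gives smoothness in all the others, as a quadratic
    differential requires. *)
Lemma smooth_in_smooth_map (M : surface R) (c : chart R M) (U : set M) (f : M -> R) :
  atlas c -> open U -> U `<=` cdom c -> smooth_in c U f -> smooth_map U f.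
Proof.
move=> ac oU Uc sf d ad; have oc := open_cdom ac; have od := open_cdom ad.
pose t := cmap c \o cinv d.
have oV := open_cmap_image ac oU; have oW := open_cmap_image ad oU.
have st : smooth_on (cmap d @` (cdom d `&` U)) t.
  exact: (smooth_in_sub Uc (smooth_in_cmap ac ad)).
have WV x : (cmap d @` (cdom d `&` U)) x -> (cmap c @` (cdom c `&` U)) (t x).
  move=> [q [dq Uq] <-]; exists q; first by split=> //; exact: Uc.
  by rewrite /t /= cmapK.
apply: (smooth_on_ext oW (f := (f \o cinv c) \o t)).
  move=> x [q [dq Uq] <-]; rewrite /t /= cmapK // cmapK //; exact: Uc.
by move=> k; exact: (Ck_comp oW oV st WV (sf k)).
Qed.

End ChangeOfVariables.

(** * Minkowski frames *)

Section Matrices4.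
Variable R : realType.

Lemma ord4P (P : 'I_4 -> Prop) : P i1 -> P i2 -> P i3 -> P i4 -> forall i, P i.
Proof.
move=> p1 p2 p3 p4 [[|[|[|[|//]]]] h].
- by rewrite (_ : Ordinal h = i1) //; exact/val_inj.
- by rewrite (_ : Ordinal h = i2) //; exact/val_inj.
- by rewrite (_ : Ordinal h = i3) //; exact/val_inj.
- by rewrite (_ : Ordinal h = i4) //; exact/val_inj.
Qed.

Lemma sum4 (V : nmodType) (F : 'I_4 -> V) :
  \sum_(i < 4) F i = F i1 + F i2 + F i3 + F i4.
Proof.
rewrite !big_ord_recl big_ord0 addr0 !addrA.
by congr (F _ + F _ + F _ + F _); exact/val_inj.
Qed.

Definition gram : 'M[R]_4 := \matrix_(i < 4, j < 4) nth 0 (nth [::]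
  [:: [:: 0; 0; 0; -1]; [:: 0; 1; 0; 0]; [:: 0; 0; 1; 0]; [:: -1; 0; 0; 0]] i) j.

Lemma mink_gram (x y : 'cV[R]_4) : mink x y = (x^T *m gram *m y) 0 0.
Proof.
rewrite mxE sum4 !mxE !sum4 !mxE /= /mink; ring.
Qed.

Lemma gramK : gram *m gram = 1%:M.
Proof.
apply/matrixP; apply: ord4P; apply: ord4P; rewrite mxE sum4 !mxE /=; ring.
Qed.

Lemma mink_isometryE (a : 'M[R]_4) :
  (forall x y, mink (a *m x) (a *m y) = mink x y) -> a^T *m gram *m a = gram.
Proof.
move=> ha; apply/matrixP => i j.
have dE (N : 'M[R]_4) : ((delta_mx i 0 : 'cV[R]_4)^T *m N *m (delta_mx j 0 : 'cV[R]_4)) 0 0 = N i j.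
  by rewrite trmx_delta -rowE -colE !mxE.
by rewrite -[LHS]dE -[RHS]dE -mink_gram -ha mink_gram trmx_mul !mulmxA.
Qed.

(** The matrix [gram] squares to 1 and is preserved by [a]. The inverse is thus polynomial in the
    entries of [a], so the inverse of a smooth frame is smooth. *)
Lemma invmx_isometry (a : 'M[R]_4) :
  (forall x y, mink (a *m x) (a *m y) = mink x y) -> \det a = 1 ->
  invmx a = gram *m a^T *m gram.
Proof.
move=> /mink_isometryE ha da; have ua : a \in unitmx by rewrite unitmxE da unitr1.
have e : gram *m a^T *m gram *m a = 1%:M by rewrite -!mulmxA (mulmxA a^T) ha gramK.
by rewrite -[RHS](mulmxK ua) e mul1mx.
Qed.

(** The Lie algebra of the isometry group, from differentiating [a^T *m gram *m a = gram] at the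
    identity. *)
Definition so31 (m : 'M[R]_4) := m^T *m gram + gram *m m = 0.

(** A product of equations instead of a conjunction, so that the whole result serves as one rewrite
    rule. *)
Lemma so31E (m : 'M[R]_4) : so31 m ->
  (((m i4 i1 = 0) * (m i1 i4 = 0) * (m i2 i2 = 0) * (m i3 i3 = 0)) *
   ((m i4 i4 = - m i1 i1) * (m i2 i3 = - m i3 i2)) *
   ((m i2 i4 = m i1 i2) * (m i3 i4 = m i1 i3) *
    (m i4 i2 = m i2 i1) * (m i4 i3 = m i3 i1)))%type.
Proof.
move=> /matrixP so.
have e i j := so i j.
have := e i1 i1; have := e i4 i4; have := e i2 i2; have := e i3 i3.
have := e i1 i4; have := e i2 i3; have := e i2 i1; have := e i3 i1.
have := e i2 i4; have := e i3 i4.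
rewrite !mxE !sum4 !mxE /= => h1 h2 h3 h4 h5 h6 h7 h8 h9 h10.
by do ![split]; lra.
Qed.

(** Infinitesimal null rotations fixing the first basis vector: [rhoP] sends the fourth to the
    second and the second to the first, and [rhoQ] does the same with the third in place of the
    second. They commute (both products are zero), so the commutator of two values of [so31_rho r]
    has no term in [r ^+ 2]. *)
Definition rhoP : 'M[R]_4 := delta_mx i1 i2 + delta_mx i2 i4.
Definition rhoQ : 'M[R]_4 := delta_mx i1 i3 + delta_mx i3 i4.
Definition so31_rho (r : R) (m : 'M[R]_4) : 'M[R]_4 :=
  m + (r * m i2 i1) *: rhoP - (r * m i3 i1) *: rhoQ.

(** Here [u], [w] are the values of the connection form on the two coordinate vectors and [r0], [r1]
    the derivatives of [r]; the exterior derivative of the connection has already been replaced by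
    minus the commutator. The two equations eliminate the derivatives of [r], after which every
    entry is a polynomial identity. *)
Lemma so31_rho_integrable (u w : 'M[R]_4) (r r0 r1 : R) : so31 u -> so31 w ->
  2 * r * (u i1 i1 * w i2 i1 - w i1 i1 * u i2 i1
    + (u i3 i2 * w i3 i1 - w i3 i2 * u i3 i1)) = - (r0 * w i2 i1 - r1 * u i2 i1) ->
  2 * r * (u i1 i1 * w i3 i1 - w i1 i1 * u i3 i1
    - (u i3 i2 * w i2 i1 - w i3 i2 * u i2 i1)) = - (r0 * w i3 i1 - r1 * u i3 i1) ->
  - (u *m w - w *m u)
  + (r0 * w i2 i1 - r1 * u i2 i1 - r * (u *m w - w *m u) i2 i1) *: rhoP
  - (r0 * w i3 i1 - r1 * u i3 i1 - r * (u *m w - w *m u) i3 i1) *: rhoQ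
  + (so31_rho r u *m so31_rho r w - so31_rho r w *m so31_rho r u) = 0.
Proof.
move=> /so31E su /so31E sw e1 e2.
have e1' : r0 * w i2 i1 - r1 * u i2 i1 = - (2 * r * (u i1 i1 * w i2 i1 - w i1 i1 * u i2 i1
    + (u i3 i2 * w i3 i1 - w i3 i2 * u i3 i1))) by rewrite e1 opprK.
have e2' : r0 * w i3 i1 - r1 * u i3 i1 = - (2 * r * (u i1 i1 * w i3 i1 - w i1 i1 * u i3 i1
    - (u i3 i2 * w i2 i1 - w i3 i2 * u i2 i1))) by rewrite e2 opprK.
rewrite e1' e2'.
apply/matrixP; apply: ord4P; apply: ord4P;
  rewrite !mxE !sum4 !mxE /= ?su ?sw;
  move: (u i1 i1) (u i1 i2) (u i1 i3) (u i2 i1) (u i3 i1) (u i3 i2)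
    (w i1 i1) (w i1 i2) (w i1 i3) (w i2 i1) (w i3 i1) (w i3 i2)
    => u11 u12 u13 u21 u31 u32 w11 w12 w13 w21 w31 w32; ring.
Qed.

Lemma so31_rho_frobenius (u w X Y : 'M[R]_4) (r r0 r1 : R) : so31 u -> so31 w ->
  2 * r * (u i1 i1 * w i2 i1 - w i1 i1 * u i2 i1
    + (u i3 i2 * w i3 i1 - w i3 i2 * u i3 i1)) = - (r0 * w i2 i1 - r1 * u i2 i1) /\
  2 * r * (u i1 i1 * w i3 i1 - w i1 i1 * u i3 i1
    - (u i3 i2 * w i2 i1 - w i3 i2 * u i2 i1)) = - (r0 * w i3 i1 - r1 * u i3 i1) ->
  X - Y = - (u *m w - w *m u) ->
  (X + (r0 * w i2 i1 + r * X i2 i1) *: rhoP - (r0 * w i3 i1 + r * X i3 i1) *: rhoQ) -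
  (Y + (r1 * u i2 i1 + r * Y i2 i1) *: rhoP - (r1 * u i3 i1 + r * Y i3 i1) *: rhoQ)
  + (so31_rho r u *m so31_rho r w - so31_rho r w *m so31_rho r u) = 0.
Proof.
move=> su sw [h1 h2] /eqP; rewrite subr_eq => /eqP ->.
rewrite -[RHS](so31_rho_integrable su sw h1 h2); congr (_ + _).
move: (u *m w - w *m u) => K.
by apply/matrixP => i j; rewrite !mxE; ring.
Qed.

(** Substitution by unification: the four computed values are supplied in one [exact], up to
    conversion, so that nothing has to be located inside large derivatives. *)
Lemma curvature_eq0_congr (D1 D0 P0 P1 D1' D0' P0' P1' : 'M[R]_4) :
  D1 = D1' -> D0 = D0' -> P0 = P0' -> P1 = P1' ->
  D1' - D0' + (P0' *m P1' - P1' *m P0') = 0 ->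
  D1 - D0 + (P0 *m P1 - P1 *m P0) = 0.
Proof. by move=> -> -> -> ->. Qed.

End Matrices4.

Lemma unitmx_cancel (R : comUnitRingType) n (a X Y K L : 'M[R]_n) : a \in unitmx ->
  a *m K + a *m X = a *m L + a *m Y -> X - Y = - (K - L).
Proof.
move=> ua; rewrite -!mulmxDr => /(can_inj (mulKmx ua)) h.
by rewrite -(addKr K X) h opprB addrA addrK addrC.
Qed.

(** Wedging the equation for [rho] with [x] and with [y] removes the star, since
    [star w /\ x = - w /\ y] and [star w /\ y = w /\ x]; multiplication by [r] clears the
    logarithmic derivative. *)
Lemma star_wedge (R : realType) (x y t w : 'rV[R]_2 -> R) (r r0 r1 : R) :
  wedge x y != 0 -> r != 0 ->
  2 * (t (e0 R) - star x y w (e0 R)) = - (r0 / r) ->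
  2 * (t (e1 R) - star x y w (e1 R)) = - (r1 / r) ->
  2 * r * (t (e0 R) * x (e1 R) - t (e1 R) * x (e0 R)
    + (w (e0 R) * y (e1 R) - w (e1 R) * y (e0 R))) = - (r0 * x (e1 R) - r1 * x (e0 R)) /\
  2 * r * (t (e0 R) * y (e1 R) - t (e1 R) * y (e0 R)
    - (w (e0 R) * x (e1 R) - w (e1 R) * x (e0 R))) = - (r0 * y (e1 R) - r1 * y (e0 R)).
Proof.
rewrite /star /wedge.
move: (x _) (x _) (y _) (y _) (t _) (t _) (w _) (w _) => x0 x1 y0 y1 t0 t1 w0 w1.
move=> W0 rn0 h0 h1.
have -> : r0 = - r * (- (r0 / r)) by field.
have -> : r1 = - r * (- (r1 / r)) by field.
by rewrite -h0 -h1; split; field.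
Qed.

(** * The connection form of a framing and the flatness of its deformation *)

Section FrameCalculus.
Variables (R : realType) (M : surface R).

Section Mink.
Variables (c : chart R M) (U : set M).
Hypotheses (ac : atlas c) (oU : open U).

Lemma dmap_mink (f g : M -> 'cV[R]_4) p X : cdom c p -> U p ->
  smooth_in c U f -> smooth_in c U g ->
  dmap c (fun q => mink (f q) (g q)) p X =
  mink (dmap c f p X) (g p) + mink (f p) (dmap c g p X).
Proof.
move=> cp Up sf sg; pose h q := (f q)^T *m gram R *m g q.
have sh1 : smooth_in c U (fun q => (f q)^T *m gram R).
  by apply: smooth_in_mulmx => //; [exact: smooth_in_tr|exact: smooth_in_cst].
have sh : smooth_in c U h by exact: smooth_in_mulmx.
have -> : dmap c (fun q => mink (f q) (g q)) p X = dmap c (fun q => h q 0 0) p X.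
  by congr (dmap c _ p X); apply/funext => q; rewrite mink_gram.
rewrite (dmap_entry cp Up) // (dmap_mulmx ac cp Up) // (dmap_mulmx ac cp Up) //.
- rewrite (dmap_tr ac oU cp Up) // dmap_cst mulmx0 addr0 !mink_gram.
  by rewrite [in LHS]mxE.
- exact: smooth_in_tr.
- exact: smooth_in_cst.
Qed.

End Mink.

Lemma minkC (x y : 'cV[R]_4) : mink x y = mink y x.
Proof. by rewrite /mink; ring. Qed.

Lemma minkZl k (x y : 'cV[R]_4) : mink (k *: x) y = k * mink x y.
Proof. by rewrite /mink !mxE; ring. Qed.

Lemma minkZr k (x y : 'cV[R]_4) : mink x (k *: y) = k * mink x y.
Proof. by rewrite /mink !mxE; ring. Qed.

Variable A : M -> frame R.
Hypotheses (smA : smooth_map setT A) (SOA : forall p, in_SO0 (A p).2).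
Local Notation a0 := (fun q => (A q).1).
Local Notation a := (fun q => (A q).2).

Definition alpha_mx c p X : 'M[R]_4 := invmx (A p).2 *m dmap c a p X.
Definition alpha0_cv c p X : 'cV[R]_4 := invmx (A p).2 *m dmap c a0 p X.

Lemma frame_unit p : (A p).2 \in unitmx.
Proof. by have [_ d _] := SOA p; rewrite unitmxE d unitr1. Qed.

Lemma frame_mink p x y : mink ((A p).2 *m x) ((A p).2 *m y) = mink x y.
Proof. by have [-> _ _] := SOA p. Qed.

Lemma dmap_frame c p X : dmap c a p X = (A p).2 *m alpha_mx c p X.
Proof. by rewrite mulKVmx // frame_unit. Qed.

Lemma dmap_frame0 c p X : dmap c a0 p X = (A p).2 *m alpha0_cv c p X.
Proof. by rewrite mulKVmx // frame_unit. Qed.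

Section InChart.
Variable c : chart R M.
Hypothesis ac : atlas c.
Let oT : open [set: M] := openT.

Lemma smooth_in_frame : smooth_in c setT a.
Proof. exact: smooth_in_snd (smA ac). Qed.

Lemma smooth_in_frame0 : smooth_in c setT a0.
Proof. exact: smooth_in_fst (smA ac). Qed.

Lemma smooth_in_invframe : smooth_in c setT (fun p => invmx (A p).2).
Proof.
apply: (smooth_in_ext ac oT (f := fun p => gram R *m (A p).2^T *m gram R)).
  by move=> p _ _; have [h d _] := SOA p; rewrite invmx_isometry.
apply: smooth_in_mulmx => //; last exact: smooth_in_cst.
apply: smooth_in_mulmx => //; first exact: smooth_in_cst.
exact/smooth_in_tr/smooth_in_frame.
Qed.

Lemma smooth_in_alpha_mx0 : smooth_in c setT (fun p => alpha_mx c p (e0 R)).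
Proof.
apply: smooth_in_mulmx => //; first exact: smooth_in_invframe.
exact/smooth_in_dmap0/smooth_in_frame.
Qed.

Lemma smooth_in_alpha_mx1 : smooth_in c setT (fun p => alpha_mx c p (e1 R)).
Proof.
apply: smooth_in_mulmx => //; first exact: smooth_in_invframe.
exact/smooth_in_dmap1/smooth_in_frame.
Qed.

Lemma smooth_in_alpha0_cv0 : smooth_in c setT (fun p => alpha0_cv c p (e0 R)).
Proof.
apply: smooth_in_mulmx => //; first exact: smooth_in_invframe.
exact/smooth_in_dmap0/smooth_in_frame0.
Qed.

Lemma smooth_in_alpha0_cv1 : smooth_in c setT (fun p => alpha0_cv c p (e1 R)).
Proof.
apply: smooth_in_mulmx => //; first exact: smooth_in_invframe.
exact/smooth_in_dmap1/smooth_in_frame0.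
Qed.

Section AtPoint.
Variables (p : M).
Hypothesis cp : cdom c p.

Lemma alpha_mx_linear k X Y :
  alpha_mx c p (k *: X + Y) = k *: alpha_mx c p X + alpha_mx c p Y.
Proof.
rewrite /alpha_mx (dmap_linear cp I); last exact: smooth_in_frame.
by rewrite mulmxDr scalemxAr.
Qed.

Lemma alpha0_cv_linear k X Y :
  alpha0_cv c p (k *: X + Y) = k *: alpha0_cv c p X + alpha0_cv c p Y.
Proof.
rewrite /alpha0_cv (dmap_linear cp I); last exact: smooth_in_frame0.
by rewrite mulmxDr scalemxAr.
Qed.

(** Differentiate the constant map [a^T *m gram *m a] with [da = a *m m]: the frame is absorbed,
    because [a^T *m gram *m a] is again [gram]. *)
Lemma alpha_mx_so31 X : so31 (alpha_mx c p X).
Proof.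
have sa := smooth_in_frame; have sT := smooth_in_tr ac oT sa.
have sG := smooth_in_cst ac oT (gram R).
have h : dmap c (fun q => (A q).2^T *m gram R *m (A q).2) p X = 0.
  rewrite -(dmap_cst c p (gram R) X); congr (dmap c _ p X); apply/funext => q.
  by apply: mink_isometryE; exact: frame_mink.
move: h; rewrite (dmap_mulmx ac cp I) //; last exact: smooth_in_mulmx.
rewrite (dmap_mulmx ac cp I) // dmap_cst mulmx0 addr0 (dmap_tr ac oT cp I) //.
rewrite dmap_frame trmx_mul /so31.
have e := mink_isometryE (frame_mink p).
by move=> <-; congr (_ + _); rewrite -[in LHS]e !mulmxA.
Qed.

(** The Maurer-Cartan equation: the two mixed derivatives of the frame agree, each is expanded by
    [da = a *m m], and the invertible frame is cancelled. *)
Lemma alpha_mx_structure :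
  dmap c (fun q => alpha_mx c q (e1 R)) p (e0 R) -
  dmap c (fun q => alpha_mx c q (e0 R)) p (e1 R) =
  - (alpha_mx c p (e0 R) *m alpha_mx c p (e1 R) -
     alpha_mx c p (e1 R) *m alpha_mx c p (e0 R)).
Proof.
have sa := smooth_in_frame.
have D0 : dmap c (fun q => dmap c a q (e1 R)) p (e0 R) =
    (A p).2 *m (alpha_mx c p (e0 R) *m alpha_mx c p (e1 R)) +
    (A p).2 *m dmap c (fun q => alpha_mx c q (e1 R)) p (e0 R).
  rewrite mulmxA -dmap_frame -(dmap_mulmx ac cp I) //; last exact: smooth_in_alpha_mx1.
  by apply: (dmap_ext ac oT cp I) => q _ _; rewrite dmap_frame.
have D1 : dmap c (fun q => dmap c a q (e0 R)) p (e1 R) =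
    (A p).2 *m (alpha_mx c p (e1 R) *m alpha_mx c p (e0 R)) +
    (A p).2 *m dmap c (fun q => alpha_mx c q (e0 R)) p (e1 R).
  rewrite mulmxA -dmap_frame -(dmap_mulmx ac cp I) //; last exact: smooth_in_alpha_mx0.
  by apply: (dmap_ext ac oT cp I) => q _ _; rewrite dmap_frame.
apply: (unitmx_cancel (frame_unit p)).
exact: (etrans (esym D0) (etrans (dmap_comm ac oT cp I sa) D1)).
Qed.

End AtPoint.
End InChart.

Section Rho.
Variable rho : M -> R.
Hypotheses (rho_sm : smooth_map setT rho) (rho_gt0 : forall p, 0 < rho p).
Hypothesis rho_eq : forall c p, atlas c -> cdom c p -> forall X,
  2 * (alpha A i1 i1 c p X - framing_star A c p (alpha A i3 i2 c p) X)
  = - dmap c (fun q => ln (rho q)) p X.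
Hypothesis wedge_neq0 : forall c p, atlas c -> cdom c p ->
  wedge (alpha A i2 i1 c p) (alpha A i3 i1 c p) != 0.

Lemma alpha_rhoE c p X : atlas c -> cdom c p ->
  alpha_rho A rho c p X = so31_rho (rho p) (alpha_mx c p X).
Proof.
move=> ac cp; have so := so31E (alpha_mx_so31 ac cp X).
rewrite /alpha_rho /alpha -/(alpha_mx c p X); move: (alpha_mx c p X) so => m so.
apply/matrixP; apply: ord4P; apply: ord4P; rewrite !mxE /= ?so; ring.
Qed.

Section AtPoint.
Variables (c : chart R M) (p : M).
Hypotheses (ac : atlas c) (cp : cdom c p).
Local Notation m0 := (alpha_mx c p (e0 R)).
Local Notation m1 := (alpha_mx c p (e1 R)).
Local Notation r0 := (dmap c rho p (e0 R)).
Local Notation r1 := (dmap c rho p (e1 R)).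

Lemma dmap_ln X : dmap c (fun q => ln (rho q)) p X = dmap c rho p X / rho p.
Proof.
have df := smooth_in_differentiable cp I (rho_sm ac).
have [dln lnE] := is_derive1_ln (rho_gt0 p).
have dl : differentiable (@ln R) (rho p) by exact/derivable1_diffP.
have dlnE (h : R) : 'd (@ln R) (rho p) h = h / rho p.
  by rewrite -[h in LHS]mulr1 [LHS]linearZ -deriveE // lnE.
have E := cmapK ac cp.
have dl' : differentiable (@ln R) ((rho \o cinv c) (cmap c p)) by rewrite /= E.
rewrite -[LHS]/('D_X ((@ln R) \o (rho \o cinv c)) (cmap c p)).
rewrite (deriveE X (differentiable_comp df dl')) (diff_comp df dl') /= E dlnE.
by rewrite /dmap (deriveE X df).
Qed.

Lemma rho_eq_wedge :
  2 * rho p * (m0 i1 i1 * m1 i2 i1 - m1 i1 i1 * m0 i2 i1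
    + (m0 i3 i2 * m1 i3 i1 - m1 i3 i2 * m0 i3 i1)) = - (r0 * m1 i2 i1 - r1 * m0 i2 i1) /\
  2 * rho p * (m0 i1 i1 * m1 i3 i1 - m1 i1 i1 * m0 i3 i1
    - (m0 i3 i2 * m1 i2 i1 - m1 i3 i2 * m0 i2 i1)) = - (r0 * m1 i3 i1 - r1 * m0 i3 i1).
Proof.
have rn0 : rho p != 0 by rewrite gt_eqF.
have h0 := rho_eq ac cp (e0 R); have h1 := rho_eq ac cp (e1 R).
rewrite dmap_ln in h0; rewrite dmap_ln in h1.
exact: (star_wedge (wedge_neq0 ac cp) rn0 h0 h1).
Qed.

Lemma dmap_so31_rho (m : M -> 'M[R]_4) X : smooth_in c setT m ->
  dmap c (fun q => so31_rho (rho q) (m q)) p X =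
  dmap c m p X
  + (dmap c rho p X * m p i2 i1 + rho p * (dmap c m p X) i2 i1) *: rhoP R
  - (dmap c rho p X * m p i3 i1 + rho p * (dmap c m p X) i3 i1) *: rhoQ R.
Proof.
move=> sm; have sr := rho_sm ac.
have oT : open [set: M] := openT.
have sc i j (N : 'M[R]_4) : smooth_in c setT (fun q => (rho q * m q i j) *: N).
  apply: smooth_in_scale => //; last exact: smooth_in_cst.
  by apply: smooth_inM => //; exact: smooth_in_entry.
have dc i j (N : 'M[R]_4) : dmap c (fun q => (rho q * m q i j) *: N) p X =
    (dmap c rho p X * m p i j + rho p * (dmap c m p X) i j) *: N.
  rewrite (dmap_scale ac cp I).
  - rewrite dmap_cst scaler0 addr0 (dmapM ac cp I) //; last exact: smooth_in_entry.
    by rewrite (dmap_entry cp I).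
  - by apply: smooth_inM => //; exact: smooth_in_entry.
  - exact: smooth_in_cst.
rewrite (dmapB ac oT cp I); [|exact: smooth_inD|exact: sc].
by rewrite (dmapD cp I) // !dc.
Qed.

End AtPoint.

Lemma alpha_rho_integrable : completely_integrable (alpha_rho A rho).
Proof.
move=> c p ac cp; have oT : open [set: M] := openT.
have sm0 := smooth_in_alpha_mx0 ac; have sm1 := smooth_in_alpha_mx1 ac.
have E1 : dmap c (fun q => alpha_rho A rho c q (e1 R)) p (e0 R) =
    dmap c (fun q => so31_rho (rho q) (alpha_mx c q (e1 R))) p (e0 R).
  by apply: (dmap_ext ac oT cp I) => q cq _; exact: alpha_rhoE.
have E0 : dmap c (fun q => alpha_rho A rho c q (e0 R)) p (e1 R) =
    dmap c (fun q => so31_rho (rho q) (alpha_mx c q (e0 R))) p (e1 R).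
  by apply: (dmap_ext ac oT cp I) => q cq _; exact: alpha_rhoE.
exact: (curvature_eq0_congr
  (etrans E1 (dmap_so31_rho ac cp (e0 R) sm1))
  (etrans E0 (dmap_so31_rho ac cp (e1 R) sm0))
  (alpha_rhoE (e0 R) ac cp) (alpha_rhoE (e1 R) ac cp)
  (so31_rho_frobenius (alpha_mx_so31 ac cp _) (alpha_mx_so31 ac cp _)
     (rho_eq_wedge ac cp) (alpha_mx_structure ac cp))).
Qed.
End Rho.

End FrameCalculus.

(** * Legendre maps given by a point and a null vector *)

Section Dot.
Variable R : realType.

Lemma dotC (x y : 'rV[R]_3) : dot x y = dot y x.
Proof. by apply: eq_bigr => j _; rewrite mulrC. Qed.

Lemma dotDl (x y z : 'rV[R]_3) : dot (x + y) z = dot x z + dot y z.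
Proof. by rewrite /dot -big_split; apply: eq_bigr => j _; rewrite mxE mulrDl. Qed.

Lemma dotZl k (x y : 'rV[R]_3) : dot (k *: x) y = k * dot x y.
Proof. by rewrite /dot mulr_sumr; apply: eq_bigr => j _; rewrite mxE mulrA. Qed.

Lemma dotDr (x y z : 'rV[R]_3) : dot x (y + z) = dot x y + dot x z.
Proof. by rewrite dotC dotDl !(dotC x). Qed.

Lemma dotZr k (x y : 'rV[R]_3) : dot x (k *: y) = k * dot x y.
Proof. by rewrite dotC dotZl (dotC x). Qed.

Definition uspace_mx : 'M[R]_(4, 3) := \matrix_(i < 4) uspace (delta_mx i 0).
Definition utime_mx : 'cV[R]_4 := \col_(i < 4) utime (delta_mx i 0).

Lemma uspaceE (x : 'cV[R]_4) : uspace x = x^T *m uspace_mx.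
Proof.
by apply/rowP => -[[|[|[|//]]] h]; rewrite !mxE sum4 !mxE /=; ring.
Qed.

Lemma utimeE (x : 'cV[R]_4) : utime x = (x^T *m utime_mx) 0 0.
Proof. by rewrite !mxE sum4 !mxE /utime !mxE /=; ring. Qed.

(* The R^3-component of [y] along [w], i.e. of [y - (utime y / utime w) w]. *)
Definition proj_along (w y : 'cV[R]_4) : 'rV[R]_3 :=
  uspace y + utime y *: (- (utime w)^-1 *: uspace w).

Lemma proj_along_self w : utime w != 0 -> proj_along w w = 0.
Proof. by move=> w0; rewrite /proj_along scalerA mulrN divff // scaleN1r subrr. Qed.

Lemma proj_alongD w y z : proj_along w (y + z) = proj_along w y + proj_along w z.
Proof. by rewrite /proj_along uspaceD utimeD scalerDl addrACA. Qed.

Lemma proj_alongZ w k y : proj_along w (k *: y) = k *: proj_along w y.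
Proof. by rewrite /proj_along uspaceZ utimeZ scalerDr !scalerA. Qed.

Section Null.
Variable w : 'cV[R]_4.
Hypotheses (w0 : utime w != 0) (ww : mink w w = 0).
Local Notation n := (- (utime w)^-1 *: uspace w).

Lemma dot_normal y : mink y w = 0 -> dot (uspace y) n = - utime y.
Proof.
move=> /eqP; rewrite mink_u subr_eq0 => /eqP h.
by rewrite dotZr h mulrCA mulNr mulVf // mulrN1.
Qed.

Lemma dot_proj_along_normal y : mink y w = 0 -> dot (proj_along w y) n = 0.
Proof.
move=> h; rewrite dotDl dot_normal // dotZl.
by have := contact_of_unit 0 w0 ww; rewrite /= => ->; rewrite mulr1 addNr.
Qed.

(** Adding multiples of the null vector [w] does not change products of vectors orthogonal to [w],
    and the representative with zero time component lies in Euclidean space. This carries the metric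
    geometry of contact elements over to [mink]. *)
Lemma dot_proj_along y z : mink y w = 0 -> mink z w = 0 ->
  dot (proj_along w y) (proj_along w z) = mink y z.
Proof.
move=> hy hz; rewrite [X in dot _ X]/proj_along dotDr dotZr dot_proj_along_normal //.
rewrite mulr0 addr0 dotDl dotZl [dot n _]dotC dot_normal // mink_u.
by rewrite mulrN.
Qed.

End Null.
End Dot.

Section ContactMaps.
Variables (R : realType) (M : surface R) (U : set M) (S w : M -> 'cV[R]_4).
Hypotheses (oU : open U) (smS : smooth_map U S) (smw : smooth_map U w).
Hypothesis utw : forall p, U p -> utime (w p) != 0.
Local Notation n := (fun q => - (utime (w q))^-1 *: uspace (w q)).
Local Notation G := (fun q => contact_of (S q) (w q)).

Section InChart.
Variable c : chart R M.
Hypothesis ac : atlas c.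

Lemma smooth_in_uspace (f : M -> 'cV[R]_4) :
  smooth_in c U f -> smooth_in c U (fun q => uspace (f q)).
Proof.
move=> sf; apply: (smooth_in_ext ac oU (f := fun q => (f q)^T *m uspace_mx R)).
  by move=> q _ _; rewrite uspaceE.
by apply: smooth_in_mulmx => //; [exact: smooth_in_tr|exact: smooth_in_cst].
Qed.

Lemma smooth_in_utime (f : M -> 'cV[R]_4) :
  smooth_in c U f -> smooth_in c U (fun q => utime (f q)).
Proof.
move=> sf; apply: (smooth_in_ext ac oU (f := fun q => ((f q)^T *m utime_mx R) 0 0)).
  by move=> q _ _; rewrite utimeE.
apply: smooth_in_entry => //.
by apply: smooth_in_mulmx => //; [exact: smooth_in_tr|exact: smooth_in_cst].
Qed.

Lemma smooth_in_normal : smooth_in c U n.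
Proof.
apply: smooth_in_scale => //; last exact: smooth_in_uspace (smw ac).
apply: smooth_inN => //; apply: smooth_inV => //; last exact: smooth_in_utime (smw ac).
by move=> q _; exact: utw.
Qed.

Lemma smooth_in_foot : smooth_in c U (fun q => (G q).1).
Proof.
apply: smooth_inD => //; first exact: smooth_in_uspace (smS ac).
by apply: smooth_in_scale => //; [exact: smooth_in_utime (smS ac)|exact: smooth_in_normal].
Qed.

Variable p : M.
Hypotheses (cp : cdom c p) (Up : U p).

Lemma dmap_uspace (f : M -> 'cV[R]_4) X : smooth_in c U f ->
  dmap c (fun q => uspace (f q)) p X = uspace (dmap c f p X).
Proof.
move=> sf; have sT := smooth_in_tr ac oU sf.
rewrite (dmap_ext ac oU cp Up X (fun q _ _ => uspaceE (f q))).
rewrite (dmap_mulmx ac cp Up) //; last exact: smooth_in_cst.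
by rewrite dmap_cst mulmx0 addr0 (dmap_tr ac oU cp Up) // uspaceE.
Qed.

Lemma dmap_utime (f : M -> 'cV[R]_4) X : smooth_in c U f ->
  dmap c (fun q => utime (f q)) p X = utime (dmap c f p X).
Proof.
move=> sf; have sT := smooth_in_tr ac oU sf.
have sm : smooth_in c U (fun q => (f q)^T *m utime_mx R).
  by apply: smooth_in_mulmx => //; exact: smooth_in_cst.
rewrite (dmap_ext ac oU cp Up X (fun q _ _ => utimeE (f q))).
rewrite (dmap_entry cp Up) // (dmap_mulmx ac cp Up) //; last exact: smooth_in_cst.
by rewrite dmap_cst mulmx0 addr0 (dmap_tr ac oU cp Up) // utimeE.
Qed.

(** Obtained from [utime w *: n = - uspace w] by the product rule, so that no inverse is
    differentiated. *)
Lemma dmap_normal X :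
  dmap c n p X = - (utime (w p))^-1 *: proj_along (w p) (dmap c w p X).
Proof.
have sn := smooth_in_normal; have sw := smw ac.
have st : smooth_in c U (fun q => utime (w q)) by exact: smooth_in_utime.
have h : dmap c (fun q => utime (w q) *: n q) p X = - uspace (dmap c w p X).
  rewrite -dmap_uspace // -(dmapN cp Up); last exact: smooth_in_uspace.
  apply: (dmap_ext ac oU cp Up) => q _ Uq.
  by rewrite scalerA mulrN divff ?utw // scaleN1r.
move: h; rewrite (dmap_scale ac cp Up) // dmap_utime // => h.
have w0 := utw Up; apply: (scalerI w0); rewrite scalerA mulrN divff // scaleN1r.
by rewrite /proj_along opprD -h addrAC subrr add0r.
Qed.

Lemma dmap_foot X : dmap c (fun q => (G q).1) p X =
  proj_along (w p) (dmap c S p X) + utime (S p) *: dmap c n p X.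
Proof.
have sn := smooth_in_normal; have sS := smS ac.
have st : smooth_in c U (fun q => utime (S q)) by exact: smooth_in_utime.
have ss : smooth_in c U (fun q => uspace (S q)) by exact: smooth_in_uspace.
rewrite -[LHS]/(dmap c (fun q => uspace (S q) + utime (S q) *: n q) p X).
rewrite (dmapD cp Up) //; last exact: smooth_in_scale.
by rewrite (dmap_scale ac cp Up) // dmap_uspace // dmap_utime // addrA.
Qed.

End InChart.

Lemma contact_smooth : smooth_map U G.
Proof.
move=> c ac; apply: smooth_in_pair => //; first exact: smooth_in_foot.
exact: smooth_in_normal.
Qed.

(** Projection along [w] kills [l *: w] and turns [dw] into [- utime w] times the differential of
    the normal; the principal coefficient is therefore [utime S - k * utime w]. *)
Lemma contact_curvature_direction c p X k l : atlas c -> cdom c p -> U p -> X != 0 ->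
  dmap c S p X = k *: dmap c w p X + l *: w p -> curvature_direction G c p X.
Proof.
move=> ac cp Up X0 h; have w0 := utw Up; split=> //.
exists (utime (S p) - k * utime (w p)).
rewrite dmap_foot // h proj_alongD !proj_alongZ proj_along_self // scaler0 addr0.
rewrite scalerBl addrC; congr (_ + _).
by rewrite [X in _ = - (_ *: X)]dmap_normal // scalerA mulrN mulfK // scaleNr opprK.
Qed.

Hypothesis nullw : forall p, U p -> mink (w p) (w p) = 0.
Hypothesis perpS : forall c p, atlas c -> cdom c p -> U p ->
  forall X, mink (dmap c S p X) (w p) = 0.

Lemma dmap_null_perp c p X : atlas c -> cdom c p -> U p ->
  mink (dmap c w p X) (w p) = 0.
Proof.
move=> ac cp Up; have sw := smw ac.
have := dmap_mink ac oU X cp Up sw sw.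
rewrite (dmap_ext ac oU cp Up X (g := fun=> 0)); last by move=> q _; exact: nullw.
rewrite dmap_cst [mink (w p) _]minkC => h.
by lra.
Qed.

Lemma contact_legendre : legendre G U.
Proof.
split; first exact: contact_smooth.
  by move=> p Up; apply: contact_of_unit; [exact: utw|exact: nullw].
move=> c p ac cp Up X; rewrite dmap_foot // dotDl dotZl.
have [w0 ww] := (utw Up, nullw Up).
rewrite [X in X + _](dot_proj_along_normal w0 ww (perpS ac cp Up X)).
rewrite dmap_normal // dotZl.
rewrite [X in _ * (_ * X)](dot_proj_along_normal w0 ww (dmap_null_perp X ac cp Up)).
by rewrite !mulr0 addr0.
Qed.

(** The differential of a null field is orthogonal to the field, where projection along [w] is
    isometric: III is the metric induced by the null lift [w], divided by the square of its
    scale. *)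
Lemma contact_III c p X Y : atlas c -> cdom c p -> U p ->
  III G c p X Y = mink (dmap c w p X) (dmap c w p Y) / utime (w p) ^+ 2.
Proof.
move=> ac cp Up; have [w0 ww] := (utw Up, nullw Up).
rewrite -[LHS]/(dot (dmap c n p X) (dmap c n p Y)) !dmap_normal // dotZl dotZr.
rewrite dot_proj_along //; [by field|exact: dmap_null_perp|exact: dmap_null_perp].
Qed.

Lemma contact_II c p X Y : atlas c -> cdom c p -> U p ->
  II G c p X Y = mink (dmap c S p X) (dmap c w p Y) / utime (w p)
                 - utime (S p) * III G c p X Y.
Proof.
move=> ac cp Up; have [w0 ww] := (utw Up, nullw Up).
rewrite -[II G c p X Y]/(- dot (dmap c (fun q => (G q).1) p X) (dmap c n p Y)).
rewrite dmap_foot // dotDl dotZl opprD; congr (_ - _).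
rewrite dmap_normal // dotZr dot_proj_along //; [by field| |exact: dmap_null_perp].
exact: perpS.
Qed.

Hypothesis spacew : forall c p, atlas c -> cdom c p -> U p ->
  forall X, X != 0 -> 0 < mink (dmap c w p X) (dmap c w p X).

Lemma contact_III_posdef : III_posdef G U.
Proof.
move=> c p ac cp Up X X0; rewrite contact_III // divr_gt0 ?spacew //.
by rewrite exprn_even_gt0 //= utw.
Qed.

(** The normal component alone already has injective differential, because III is positive
    definite. *)
Lemma contact_immersion : immersion U G.
Proof.
split; first exact: contact_smooth.
move=> c p ac cp Up X dX; apply/eqP/negPn/negP => X0.
have := contact_III_posdef ac cp Up X0; rewrite /III.
have -> : dmap c (fun q => (G q).2) p X = (dmap c G p X).2.
  rewrite -[X in _ = X.2]/(dmap c (fun q => ((G q).1, (G q).2)) p X).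
  by rewrite (dmap_pair cp Up) //; [exact: smooth_in_foot|exact: smooth_in_normal].
rewrite dX (_ : dot _ _ = 0) ?ltxx //.
by rewrite /dot big1 // => j _; rewrite /= mxE mul0r.
Qed.

End ContactMaps.

(** * Principal framings *)

Section IsothermicAlgebra.
Variable R : realType.

(* [x], [y] are the coefficients of a coframe conformal to the Euclidean one,
   [xij] is the derivative of [xj] in the direction [i], and the first two
   hypotheses say that [sqrt r * x] and [sqrt r * y] are closed.  Then both are
   also coclosed, whence the Cauchy-Riemann equations. *)
Lemma conformal_coframe_CR (r r0 r1 x0 x1 y0 y1
    x00 x10 x01 x11 y00 y10 y01 y11 : R) :
  x0 * y1 - x1 * y0 != 0 ->
  2 * r * (x01 - x10) = - (r0 * x1 - r1 * x0) ->
  2 * r * (y01 - y10) = - (r0 * y1 - r1 * y0) ->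
  x0 * x0 + y0 * y0 - (x1 * x1 + y1 * y1) = 0 ->
  x0 * x1 + y0 * y1 = 0 ->
  x00 * x0 + x0 * x00 + (y00 * y0 + y0 * y00)
    - (x01 * x1 + x1 * x01 + (y01 * y1 + y1 * y01)) = 0 ->
  x10 * x0 + x0 * x10 + (y10 * y0 + y0 * y10)
    - (x11 * x1 + x1 * x11 + (y11 * y1 + y1 * y11)) = 0 ->
  x00 * x1 + x0 * x01 + (y00 * y1 + y0 * y01) = 0 ->
  x10 * x1 + x0 * x11 + (y10 * y1 + y0 * y11) = 0 ->
  r0 * (x0 * x0 - y0 * y0 - (x1 * x1 - y1 * y1)) + r *
    (x00 * x0 + x0 * x00 - (y00 * y0 + y0 * y00)
     - (x01 * x1 + x1 * x01 - (y01 * y1 + y1 * y01))) =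
  - 2 * (r1 * (x0 * x1 - y0 * y1) + r *
    (x10 * x1 + x0 * x11 - (y10 * y1 + y0 * y11))) /\
  r1 * (x0 * x0 - y0 * y0 - (x1 * x1 - y1 * y1)) + r *
    (x10 * x0 + x0 * x10 - (y10 * y0 + y0 * y10)
     - (x11 * x1 + x1 * x11 - (y11 * y1 + y1 * y11))) =
  2 * (r0 * (x0 * x1 - y0 * y1) + r *
    (x00 * x1 + x0 * x01 - (y00 * y1 + y0 * y01))).
Proof.
move=> W0 cx cy k1 k2 d01 d11 d02 d12.
(* [P] and [Q] are [2 sqrt r] times the divergences of [sqrt r * x] and [sqrt r * y]. Closedness and
   the differentiated conformality relations give two linear equations for them, whose determinant
   is the nonzero wedge. *)
pose P := 2 * r * (x00 + x11) + r0 * x0 + r1 * x1.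
pose Q := 2 * r * (y00 + y11) + r0 * y0 + r1 * y1.
have cx0 : 2 * r * (x01 - x10) + (r0 * x1 - r1 * x0) = 0 by rewrite cx addNr.
have cy0 : 2 * r * (y01 - y10) + (r0 * y1 - r1 * y0) = 0 by rewrite cy addNr.
have PQ0 : x0 * P + y0 * Q = 0.
  have -> : x0 * P + y0 * Q =
      r * (x00 * x0 + x0 * x00 + (y00 * y0 + y0 * y00)
        - (x01 * x1 + x1 * x01 + (y01 * y1 + y1 * y01)))
      + 2 * r * (x10 * x1 + x0 * x11 + (y10 * y1 + y0 * y11))
      + x1 * (2 * r * (x01 - x10) + (r0 * x1 - r1 * x0))
      + y1 * (2 * r * (y01 - y10) + (r0 * y1 - r1 * y0))
      + r0 * (x0 * x0 + y0 * y0 - (x1 * x1 + y1 * y1))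
      + 2 * r1 * (x0 * x1 + y0 * y1) by rewrite /P /Q; ring.
  by rewrite d01 d12 cx0 cy0 k1 k2; ring.
have PQ1 : x1 * P + y1 * Q = 0.
  have -> : x1 * P + y1 * Q =
      2 * r * (x00 * x1 + x0 * x01 + (y00 * y1 + y0 * y01))
      - r * (x10 * x0 + x0 * x10 + (y10 * y0 + y0 * y10)
        - (x11 * x1 + x1 * x11 + (y11 * y1 + y1 * y11)))
      - x0 * (2 * r * (x01 - x10) + (r0 * x1 - r1 * x0))
      - y0 * (2 * r * (y01 - y10) + (r0 * y1 - r1 * y0))
      - r1 * (x0 * x0 + y0 * y0 - (x1 * x1 + y1 * y1))
      + 2 * r0 * (x0 * x1 + y0 * y1) by rewrite /P /Q; ring.
  by rewrite d02 d11 cx0 cy0 k1 k2; ring.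
have P0 : P = 0.
  apply: (mulfI W0); rewrite mulr0.
  have -> : (x0 * y1 - x1 * y0) * P = y1 * (x0 * P + y0 * Q) - y0 * (x1 * P + y1 * Q) by ring.
  by rewrite PQ0 PQ1 !mulr0 subr0.
have Q0 : Q = 0.
  apply: (mulfI W0); rewrite mulr0.
  have -> : (x0 * y1 - x1 * y0) * Q = x0 * (x1 * P + y1 * Q) - x1 * (x0 * P + y0 * Q) by ring.
  by rewrite PQ0 PQ1 !mulr0 subr0.
(* Each defect of the Cauchy-Riemann equations is a linear combination of the two divergences and of
   the two expressions that vanish by closedness. *)
split; apply/eqP; rewrite -subr_eq0; apply/eqP.
- set lhs := (X in X = 0).
  have -> : lhs = x0 * P - y0 * Q
      - x1 * (2 * r * (x01 - x10) + (r0 * x1 - r1 * x0))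
      + y1 * (2 * r * (y01 - y10) + (r0 * y1 - r1 * y0)) by rewrite /lhs /P /Q; ring.
  by rewrite P0 Q0 cx0 cy0; ring.
- set lhs := (X in X = 0).
  have -> : lhs = - (x1 * P) + y1 * Q
      - x0 * (2 * r * (x01 - x10) + (r0 * x1 - r1 * x0))
      + y0 * (2 * r * (y01 - y10) + (r0 * y1 - r1 * y0)) by rewrite /lhs /P /Q; ring.
  by rewrite P0 Q0 cx0 cy0; ring.
Qed.

(** Lagrange's identity gives [det^2 = |m|^4]; positivity selects the root [det = |m|^2], and then
    the squared distance from [n] to the quarter turn of [m] is [2 |m|^2 - 2 det = 0]. *)
Lemma conformal_rotation (k k' m0 m1 n0 n1 : R) : 0 < k ->
  k * (m0 * m0 + m1 * m1) = k' -> k * (n0 * n0 + n1 * n1) = k' ->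
  k * (m0 * n0 + m1 * n1) = 0 -> 0 < m0 * n1 - m1 * n0 -> n0 = - m1 /\ n1 = m0.
Proof.
move=> k0 <- /(mulfI (lt0r_neq0 k0)) e1 /eqP; rewrite mulf_eq0 gt_eqF //= => /eqP e2 d0.
have : (n0 + m1) ^+ 2 + (n1 - m0) ^+ 2 = 0.
  have D2 : (m0 * n1 - m1 * n0) ^+ 2 = (m0 * m0 + m1 * m1) ^+ 2.
    have -> : (m0 * n1 - m1 * n0) ^+ 2 = (m0 * m0 + m1 * m1) * (n0 * n0 + n1 * n1)
      - (m0 * n0 + m1 * n1) ^+ 2 by ring.
    by rewrite e1 e2 expr0n subr0 expr2.
  have N0 : 0 <= m0 * m0 + m1 * m1 by rewrite -!expr2 addr_ge0 // sqr_ge0.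
  have D : m0 * n1 - m1 * n0 = m0 * m0 + m1 * m1.
    by apply: (pexpIrn (n := 2)); rewrite ?nnegrE // ltW.
  have -> : (n0 + m1) ^+ 2 + (n1 - m0) ^+ 2 = (n0 * n0 + n1 * n1) + (m0 * m0 + m1 * m1)
    - 2 * (m0 * n1 - m1 * n0) by ring.
  by rewrite e1 D; ring.
move/eqP; rewrite paddr_eq0 ?sqr_ge0 // !sqrf_eq0 addr_eq0 subr_eq0.
by move=> /andP[/eqP -> /eqP ->].
Qed.

(** Once [u /\ x = 0] makes [u] a multiple of [x], the factor is found by wedging both with [y]. *)
Lemma proportional_of_wedge (u0 u1 x0 x1 y0 y1 : R) :
  x0 * y1 - x1 * y0 != 0 -> u0 * x1 - u1 * x0 = 0 ->
  forall t0 t1, t0 * u0 + t1 * u1 =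
    (u0 * y1 - u1 * y0) / (x0 * y1 - x1 * y0) * (t0 * x0 + t1 * x1).
Proof.
move=> W0 h t0 t1; apply: (mulIf W0); rewrite mulrAC divfK //.
apply/eqP; rewrite -subr_eq0; apply/eqP.
transitivity (- (t0 * y0 + t1 * y1) * (u0 * x1 - u1 * x0)); first by ring.
by rewrite h mulr0.
Qed.

Lemma wedge_swap_neq0 (x0 x1 y0 y1 : R) :
  x0 * y1 - x1 * y0 != 0 -> y0 * x1 - y1 * x0 != 0.
Proof. by rewrite -oppr_eq0 opprB (mulrC y0) (mulrC y1). Qed.

Lemma ratio_of_wedge (a u0 u1 x0 x1 y0 y1 : R) :
  x0 * y1 - x1 * y0 != 0 -> u0 = a * x0 -> u1 = a * x1 ->
  (u0 * y1 - u1 * y0) / (x0 * y1 - x1 * y0) = a.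
Proof. by move=> W0 -> ->; field. Qed.

Lemma mx_comb2E m n (N N0 N1 : 'M[R]_(m, n)) k l i j :
  N = k *: N0 + l *: N1 -> N i j = k * N0 i j + l * N1 i j.
Proof. by move=> ->; rewrite !mxE. Qed.

End IsothermicAlgebra.

Section PrincipalFraming.
Variables (R : realType) (M : surface R) (A : M -> frame R).
Hypotheses (smA : smooth_map setT A) (SOA : forall p, in_SO0 (A p).2).
Hypothesis pfA : forall c p, atlas c -> cdom c p ->
  [/\ forall X, alpha0 A i4 c p X = 0,
      wedge (alpha A i2 i1 c p) (alpha A i3 i1 c p) != 0,
      wedge (alpha0 A i2 c p) (alpha A i2 i1 c p) = 0
    & wedge (alpha0 A i3 c p) (alpha A i3 i1 c p) = 0].

Lemma alpha_mxE c p X : atlas c -> cdom c p -> alpha_mx A c p X =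
  X 0 ord0 *: alpha_mx A c p (e0 R) + X 0 ord_max *: alpha_mx A c p (e1 R).
Proof.
move=> ac cp; have z : alpha_mx A c p 0 = 0 by rewrite /alpha_mx /dmap derive0 mulmx0.
have L := alpha_mx_linear smA ac cp.
have L1 := L (X 0 ord_max) (e1 R) 0; rewrite z !addr0 in L1.
by rewrite -L1 -L -row2E.
Qed.

Lemma alpha0_cvE c p X : atlas c -> cdom c p -> alpha0_cv A c p X =
  X 0 ord0 *: alpha0_cv A c p (e0 R) + X 0 ord_max *: alpha0_cv A c p (e1 R).
Proof.
move=> ac cp; have z : alpha0_cv A c p 0 = 0 by rewrite /alpha0_cv /dmap derive0 mulmx0.
have L := alpha0_cv_linear smA ac cp.
have L1 := L (X 0 ord_max) (e1 R) 0; rewrite z !addr0 in L1.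
by rewrite -L1 -L -row2E.
Qed.

Lemma alpha_mx_chart c d p X : atlas c -> atlas d -> cdom c p -> cdom d p ->
  alpha_mx A d p X = alpha_mx A c p (dmap d (cmap c) p X).
Proof.
move=> ac ad cp dp; rewrite /alpha_mx.
by rewrite (dmap_chart ac ad cp dp X openT I (smooth_in_frame smA ac)).
Qed.

Lemma alpha0_cv_chart c d p X : atlas c -> atlas d -> cdom c p -> cdom d p ->
  alpha0_cv A d p X = alpha0_cv A c p (dmap d (cmap c) p X).
Proof.
move=> ac ad cp dp; rewrite /alpha0_cv.
by rewrite (dmap_chart ac ad cp dp X openT I (smooth_in_frame0 smA ac)).
Qed.

Lemma wedge_alpha_neq0 c p : atlas c -> cdom c p ->
  alpha_mx A c p (e0 R) i2 i1 * alpha_mx A c p (e1 R) i3 i1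
  - alpha_mx A c p (e1 R) i2 i1 * alpha_mx A c p (e0 R) i3 i1 != 0.
Proof. by move=> ac cp; have [_ h _ _] := pfA ac cp. Qed.

(** The coefficients [a] and [b] are the k and l of the overview; they exist because neither
    [alpha^2_1] nor [alpha^3_1] vanishes anywhere. *)
Lemma principal_curvatures : exists a b : M -> R,
  (smooth_map setT a /\ smooth_map setT b) /\
  forall c p X, atlas c -> cdom c p ->
    [/\ alpha0_cv A c p X i2 0 = a p * alpha_mx A c p X i2 i1,
        alpha0_cv A c p X i3 0 = b p * alpha_mx A c p X i3 i1
      & alpha0_cv A c p X i4 0 = 0].
Proof.
pose x c p X := alpha_mx A c p X i2 i1; pose y c p X := alpha_mx A c p X i3 i1.
pose u i c p X := alpha0_cv A c p X i 0.
pose rel p (ab : R * R) := forall c X, atlas c -> cdom c p ->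
  u i2 c p X = ab.1 * x c p X /\ u i3 c p X = ab.2 * y c p X.
pose ra c p := (u i2 c p (e0 R) * y c p (e1 R) - u i2 c p (e1 R) * y c p (e0 R))
  / (x c p (e0 R) * y c p (e1 R) - x c p (e1 R) * y c p (e0 R)).
pose rb c p := (u i3 c p (e0 R) * x c p (e1 R) - u i3 c p (e1 R) * x c p (e0 R))
  / (y c p (e0 R) * x c p (e1 R) - y c p (e1 R) * x c p (e0 R)).
have W0 c p : atlas c -> cdom c p ->
    x c p (e0 R) * y c p (e1 R) - x c p (e1 R) * y c p (e0 R) != 0.
  exact: wedge_alpha_neq0.
have W0' c p : atlas c -> cdom c p ->
    y c p (e0 R) * x c p (e1 R) - y c p (e1 R) * x c p (e0 R) != 0.
  by move=> ac cp; exact: wedge_swap_neq0 (W0 c p ac cp).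
have xE c p X : atlas c -> cdom c p -> x c p X =
    X 0 ord0 * x c p (e0 R) + X 0 ord_max * x c p (e1 R).
  by move=> ac cp; exact: mx_comb2E (alpha_mxE X ac cp).
have yE c p X : atlas c -> cdom c p -> y c p X =
    X 0 ord0 * y c p (e0 R) + X 0 ord_max * y c p (e1 R).
  by move=> ac cp; exact: mx_comb2E (alpha_mxE X ac cp).
have uE i c p X : atlas c -> cdom c p -> u i c p X =
    X 0 ord0 * u i c p (e0 R) + X 0 ord_max * u i c p (e1 R).
  by move=> ac cp; exact: mx_comb2E (alpha0_cvE X ac cp).
(* The coefficients must be functions on [M], while the ratios [ra] and [rb] are computed in a
   chart. A pair satisfying the relation in every chart is chosen at each point; it then equals the
   ratio in each chart, which yields smoothness. *)
have /choice[ab abP] : forall p, exists ab, rel p ab.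
  move=> p; have [c ac cp] := atlas_cover p; exists (ra c p, rb c p) => d X ad dp.
  have [_ _ w2 w3] := pfA ac cp.
  rewrite /u /x /y !(alpha0_cv_chart X ac ad cp dp) !(alpha_mx_chart X ac ad cp dp).
  move: (dmap d (cmap c) p X) => Y.
  rewrite -![alpha0_cv A c p Y _ _]/(u _ c p Y) -[alpha_mx A c p Y _ _]/(x c p Y).
  rewrite -[alpha_mx A c p Y i3 i1]/(y c p Y); split; rewrite /=.
    rewrite (uE _ _ _ _ ac cp) (xE _ _ _ ac cp).
    exact: (proportional_of_wedge (W0 c p ac cp) w2).
  rewrite (uE _ _ _ _ ac cp) (yE _ _ _ ac cp).
  exact: (proportional_of_wedge (W0' c p ac cp) w3).
have oT : open [set: M] := openT.
have sx0 c : atlas c -> smooth_in c setT (fun p => x c p (e0 R)).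
  by move=> ac; apply: smooth_in_entry => //; exact: smooth_in_alpha_mx0.
have sx1 c : atlas c -> smooth_in c setT (fun p => x c p (e1 R)).
  by move=> ac; apply: smooth_in_entry => //; exact: smooth_in_alpha_mx1.
have sy0 c : atlas c -> smooth_in c setT (fun p => y c p (e0 R)).
  by move=> ac; apply: smooth_in_entry => //; exact: smooth_in_alpha_mx0.
have sy1 c : atlas c -> smooth_in c setT (fun p => y c p (e1 R)).
  by move=> ac; apply: smooth_in_entry => //; exact: smooth_in_alpha_mx1.
have su0 i c : atlas c -> smooth_in c setT (fun p => u i c p (e0 R)).
  by move=> ac; apply: smooth_in_entry => //; exact: smooth_in_alpha0_cv0.
have su1 i c : atlas c -> smooth_in c setT (fun p => u i c p (e1 R)).
  by move=> ac; apply: smooth_in_entry => //; exact: smooth_in_alpha0_cv1.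
exists (fun p => (ab p).1), (fun p => (ab p).2); split; [split|].
- move=> c ac; apply: (smooth_in_ext ac oT (f := ra c)).
    move=> p cp _; have W1 := W0 c p ac cp.
    have [[h0 _] [h1 _]] := (abP p c (e0 R) ac cp, abP p c (e1 R) ac cp).
    by exact: ratio_of_wedge W1 h0 h1.
  have D := smooth_inB ac oT (smooth_inM ac oT (sx0 c ac) (sy1 c ac))
                             (smooth_inM ac oT (sx1 c ac) (sy0 c ac)).
  have N := smooth_inB ac oT (smooth_inM ac oT (su0 i2 c ac) (sy1 c ac))
                             (smooth_inM ac oT (su1 i2 c ac) (sy0 c ac)).
  exact: (smooth_inM ac oT N (smooth_inV ac oT (fun p cp _ => W0 c p ac cp) D)).
- move=> c ac; apply: (smooth_in_ext ac oT (f := rb c)).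
    move=> p cp _; have W1 := W0' c p ac cp.
    have [[_ h0] [_ h1]] := (abP p c (e0 R) ac cp, abP p c (e1 R) ac cp).
    by exact: ratio_of_wedge W1 h0 h1.
  have D := smooth_inB ac oT (smooth_inM ac oT (sy0 c ac) (sx1 c ac))
                             (smooth_inM ac oT (sy1 c ac) (sx0 c ac)).
  have N := smooth_inB ac oT (smooth_inM ac oT (su0 i3 c ac) (sx1 c ac))
                             (smooth_inM ac oT (su1 i3 c ac) (sx0 c ac)).
  exact: (smooth_inM ac oT N (smooth_inV ac oT (fun p cp _ => W0' c p ac cp) D)).
- move=> c p X ac cp; have [h2 h3] := abP p c X ac cp.
  by have [h4 _ _ _] := pfA ac cp; split=> //; exact: h4.
Qed.

End PrincipalFraming.

(** * Isothermic coordinates *)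

Section QuadraticForms.
Local Open Scope complex_scope.
Variable R : realType.

(* The coefficient of [dz^2] in [r (th2^2 - th3^2)], where [xi] and [yi] are
   the components of the covectors [th2] and [th3]. *)
Definition quad_dz2 (r x0 x1 y0 y1 : R) : R[i] :=
  (r * (x0 * x0 - y0 * y0 - (x1 * x1 - y1 * y1)) / 4) +i*
  (- (r * (x0 * x1 - y0 * y1) / 2)).

(** A rotation-dilation of the coordinate vectors, that is, [dz] multiplied by [m0 + i m1],
    multiplies the coefficient by the square of that number: the transformation law of a quadratic
    differential. *)
Lemma quad_dz2_rotate (r x0 x1 y0 y1 m0 m1 : R) :
  quad_dz2 r (m0 * x0 + m1 * x1) (- m1 * x0 + m0 * x1)
             (m0 * y0 + m1 * y1) (- m1 * y0 + m0 * y1) =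
  quad_dz2 r x0 x1 y0 y1 * (m0 +i* m1) ^+ 2.
Proof.
have mulE (a b c d : R) : (a +i* b) * (c +i* d) = (a * c - b * d) +i* (a * d + b * c) by [].
by rewrite expr2 !mulE /quad_dz2; congr (_ +i* _); field.
Qed.

Lemma quad_dz2_scale (mu r x0 x1 y0 y1 : R) (I00 I01 I11 : R) :
  I00 - I11 = mu * (r * (x0 * x0 - y0 * y0 - (x1 * x1 - y1 * y1))) ->
  I01 = mu * (r * (x0 * x1 - y0 * y1)) ->
  ((I00 - I11) / 4) +i* (- (I01 / 2)) = mu%:C * quad_dz2 r x0 x1 y0 y1.
Proof.
have mulE (a b c d : R) : (a +i* b) * (c +i* d) = (a * c - b * d) +i* (a * d + b * c) by [].
move=> -> ->; rewrite /quad_dz2 (_ : mu%:C = mu +i* 0) // mulE.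
by congr (_ +i* _); field.
Qed.

Lemma two_form_eq0 (s t x0 x1 y0 y1 : R) : x0 * y1 - x1 * y0 != 0 ->
  s * x0 + t * x1 = 0 -> s * y0 + t * y1 = 0 -> s = 0 /\ t = 0.
Proof.
move=> W0 h1 h2; split; apply: (mulIf W0); rewrite mul0r.
- transitivity (y1 * (s * x0 + t * x1) - x1 * (s * y0 + t * y1)); first by ring.
  by rewrite h1 h2 !mulr0 subr0.
- transitivity (x0 * (s * y0 + t * y1) - y0 * (s * x0 + t * x1)); first by ring.
  by rewrite h1 h2 !mulr0 subr0.
Qed.

Lemma det2E (N : 'I_2 -> 'I_2 -> R) :
  \det (\matrix_(i < 2, j < 2) N i j) =
  N ord0 ord0 * N ord_max ord_max - N ord0 ord_max * N ord_max ord0.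
Proof.
rewrite (expand_det_row _ ord0) !big_ord_recl big_ord0 addr0.
rewrite /cofactor !det_mx11 /= !mxE /= expr0 !mul1r.
rewrite (_ : (-1) ^+ _ = -1 :> R) // mulN1r mulrN.
have o1 (i : 'I_2) : i != ord0 -> i = ord_max by case: i => [[|[|]]] // ? _; exact/val_inj.
have -> : lift ord0 0 = ord_max :> 'I_2 by exact: o1.
by have -> : lift ord_max 0 = ord0 :> 'I_2 by exact/val_inj.
Qed.

(** The point only slides along its null line; hence [a_0 + s a_1] and [a_0] define the same contact
    element in the direction [a_1]. *)
Lemma contact_of_shift (p w : 'cV[R]_4) (s : R) : utime w != 0 ->
  contact_of (p + s *: w) w = contact_of p w.
Proof.
move=> w0; rewrite /contact_of uspaceD uspaceZ utimeD utimeZ; congr (_, _).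
rewrite scalerDl addrACA -[RHS]addr0; congr (_ + _).
by rewrite scalerA mulrN mulfK // scaleNr subrr.
Qed.

Lemma utime_Lplus (w : 'cV[R]_4) : Lplus w -> 0 < utime w.
Proof. by move=> [_ _ h]; rewrite /utime divr_gt0 // sqrtr_gt0. Qed.

End QuadraticForms.

Section ConformalForms.
Variables (R : realType) (M : surface R) (c : chart R M) (U : set M).
Hypotheses (ac : atlas c) (oU : open U).
Variables r x0 x1 y0 y1 : M -> R.
Hypotheses (sr : smooth_in c U r) (sx0 : smooth_in c U x0) (sx1 : smooth_in c U x1).
Hypotheses (sy0 : smooth_in c U y0) (sy1 : smooth_in c U y1).

Let re q := r q * (x0 q * x0 q - y0 q * y0 q - (x1 q * x1 q - y1 q * y1 q)) / 4.
Let im q := - (r q * (x0 q * x1 q - y0 q * y1 q) / 2).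

Let sre1 : smooth_in c U (fun q => x0 q * x0 q - y0 q * y0 q - (x1 q * x1 q - y1 q * y1 q)).
Proof.
exact (smooth_inB ac oU (smooth_inB ac oU (smooth_inM ac oU sx0 sx0) (smooth_inM ac oU sy0 sy0))
   (smooth_inB ac oU (smooth_inM ac oU sx1 sx1) (smooth_inM ac oU sy1 sy1))).
Qed.

Let sim1 : smooth_in c U (fun q => x0 q * x1 q - y0 q * y1 q).
Proof.
exact (smooth_inB ac oU (smooth_inM ac oU sx0 sx1) (smooth_inM ac oU sy0 sy1)).
Qed.

Lemma smooth_in_re : smooth_in c U re.
Proof.
exact (smooth_inM ac oU (smooth_inM ac oU sr sre1) (smooth_in_cst ac oU (4^-1 : R))).
Qed.

Lemma smooth_in_im : smooth_in c U im.
Proof.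
exact (smooth_inN ac oU
  (smooth_inM ac oU (smooth_inM ac oU sr sim1) (smooth_in_cst ac oU (2^-1 : R)))).
Qed.

Hypothesis conformal : forall q, cdom c q -> U q ->
  x0 q * x0 q + y0 q * y0 q - (x1 q * x1 q + y1 q * y1 q) = 0.
Hypothesis orthogonal : forall q, cdom c q -> U q -> x0 q * x1 q + y0 q * y1 q = 0.
Variable p : M.
Hypotheses (cp : cdom c p) (Up : U p).
Local Notation D0 f := (dmap c f p (e0 R)).
Local Notation D1 f := (dmap c f p (e1 R)).
Hypothesis W0 : x0 p * y1 p - x1 p * y0 p != 0.
Hypothesis closed_x : 2 * r p * (D0 x1 - D1 x0) = - (D0 r * x1 p - D1 r * x0 p).
Hypothesis closed_y : 2 * r p * (D0 y1 - D1 y0) = - (D0 r * y1 p - D1 r * y0 p).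

Let dM f g X (sf : smooth_in c U f) (sg : smooth_in c U g) := dmapM ac cp Up X sf sg.

Let d_re X : dmap c re p X =
  (dmap c r p X * (x0 p * x0 p - y0 p * y0 p - (x1 p * x1 p - y1 p * y1 p)) + r p *
    (dmap c x0 p X * x0 p + x0 p * dmap c x0 p X - (dmap c y0 p X * y0 p + y0 p * dmap c y0 p X)
     - (dmap c x1 p X * x1 p + x1 p * dmap c x1 p X
        - (dmap c y1 p X * y1 p + y1 p * dmap c y1 p X)))) / 4.
Proof.
have s1 := smooth_inM ac oU sx0 sx0; have s2 := smooth_inM ac oU sy0 sy0.
have s3 := smooth_inM ac oU sx1 sx1; have s4 := smooth_inM ac oU sy1 sy1.
have E := dmapM ac cp Up X (smooth_inM ac oU sr sre1) (smooth_in_cst ac oU (4^-1 : R)).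
rewrite [LHS]E dmap_cst mulr0 addr0; congr (_ / _).
rewrite (dM X sr sre1); congr (_ + _ * _).
rewrite (dmapB ac oU cp Up X (smooth_inB ac oU s1 s2) (smooth_inB ac oU s3 s4)).
rewrite (dmapB ac oU cp Up X s1 s2) (dmapB ac oU cp Up X s3 s4).
by rewrite (dM X sx0 sx0) (dM X sy0 sy0) (dM X sx1 sx1) (dM X sy1 sy1).
Qed.

Let d_im X : dmap c im p X =
  - ((dmap c r p X * (x0 p * x1 p - y0 p * y1 p) + r p *
    (dmap c x0 p X * x1 p + x0 p * dmap c x1 p X
     - (dmap c y0 p X * y1 p + y0 p * dmap c y1 p X))) / 2).
Proof.
have s1 := smooth_inM ac oU sx0 sx1; have s2 := smooth_inM ac oU sy0 sy1.
have sm := smooth_inM ac oU sr sim1; have sc := smooth_in_cst ac oU (2^-1 : R).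
have E := dmapN cp Up X (smooth_inM ac oU sm sc).
rewrite [LHS]E (dM X sm sc) dmap_cst mulr0 addr0; congr (- (_ / _)).
rewrite (dM X sr sim1) (dmapB ac oU cp Up X s1 s2).
by rewrite (dM X sx0 sx1) (dM X sy0 sy1).
Qed.

Let d_conformal X : dmap c x0 p X * x0 p + x0 p * dmap c x0 p X
    + (dmap c y0 p X * y0 p + y0 p * dmap c y0 p X)
    - (dmap c x1 p X * x1 p + x1 p * dmap c x1 p X
       + (dmap c y1 p X * y1 p + y1 p * dmap c y1 p X)) = 0.
Proof.
have s1 := smooth_inM ac oU sx0 sx0; have s2 := smooth_inM ac oU sy0 sy0.
have s3 := smooth_inM ac oU sx1 sx1; have s4 := smooth_inM ac oU sy1 sy1.
rewrite -(dM X sx0 sx0) -(dM X sy0 sy0) -(dM X sx1 sx1) -(dM X sy1 sy1).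
rewrite -(dmapD cp Up X s1 s2) -(dmapD cp Up X s3 s4).
rewrite -(dmapB ac oU cp Up X (smooth_inD ac oU s1 s2) (smooth_inD ac oU s3 s4)).
rewrite -(dmap_cst c p (0 : R) X); apply: (dmap_ext ac oU cp Up) => q cq Uq.
exact: conformal.
Qed.

Let d_orthogonal X : dmap c x0 p X * x1 p + x0 p * dmap c x1 p X
    + (dmap c y0 p X * y1 p + y0 p * dmap c y1 p X) = 0.
Proof.
have s1 := smooth_inM ac oU sx0 sx1; have s2 := smooth_inM ac oU sy0 sy1.
rewrite -(dM X sx0 sx1) -(dM X sy0 sy1) -(dmapD cp Up X s1 s2).
rewrite -(dmap_cst c p (0 : R) X); apply: (dmap_ext ac oU cp Up) => q cq Uq.
exact: orthogonal.
Qed.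

(** The conformality relations hold around [p], so their derivatives are available as well; with
    closedness they are the input of [conformal_coframe_CR]. *)
Lemma quad_dz2_CR : D0 re = D1 im /\ D1 re = - D0 im.
Proof.
have [h1 h2] := conformal_coframe_CR W0 closed_x closed_y (conformal cp Up)
  (orthogonal cp Up) (d_conformal _) (d_conformal _) (d_orthogonal _) (d_orthogonal _).
rewrite !d_re !d_im h1 h2; split; by field.
Qed.

End ConformalForms.

(** * The transform *)

Section ColumnVectors.
Variable R : realType.

Definition col4 (x1 x2 x3 x4 : R) : 'cV[R]_4 :=
  \col_(i < 4) nth 0 [:: x1; x2; x3; x4] i.

Lemma mink_col4 x1 x2 x3 x4 y1 y2 y3 y4 :
  mink (col4 x1 x2 x3 x4) (col4 y1 y2 y3 y4) =
  - (x1 * y4 + x4 * y1) + x2 * y2 + x3 * y3.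
Proof. by rewrite /mink !mxE. Qed.

Lemma mink_col4l x1 x2 x3 x4 (v : 'cV[R]_4) : mink (col4 x1 x2 x3 x4) v =
  - (x1 * v i4 0 + x4 * v i1 0) + x2 * v i2 0 + x3 * v i3 0.
Proof. by rewrite /mink !mxE. Qed.

Lemma colP4 (u w : 'cV[R]_4) : u i1 0 = w i1 0 -> u i2 0 = w i2 0 ->
  u i3 0 = w i3 0 -> u i4 0 = w i4 0 -> u = w.
Proof.
by move=> h1 h2 h3 h4; apply/matrixP; apply: ord4P => j; rewrite ord1.
Qed.

(** Because [dv = - alpha_rho v], the left-hand side is [dV] in frame components. Only the null
    rotations survive, so there is no [a_4]-component and the tangential part carries the factor
    [v^4]. *)
Lemma so31_rho_mulmx (m : 'M[R]_4) (v : 'cV[R]_4) (r : R) :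
  m *m v - so31_rho r m *m v =
  r *: col4 (- (m i2 i1 * v i2 0 - m i3 i1 * v i3 0))
            (- (m i2 i1 * v i4 0)) (m i3 i1 * v i4 0) 0.
Proof.
rewrite /so31_rho mulmxBl mulmxDl opprB addrCA opprD addNKr.
by apply: colP4; rewrite !mxE !sum4 !mxE /=; ring.
Qed.

Lemma mink_col4_principal (u v : 'cV[R]_4) (m n : 'M[R]_4) (k a b t : R) :
  u i2 0 = a * n i2 i1 -> u i3 0 = b * n i3 i1 -> u i4 0 = 0 ->
  mink (k *: col4 t (- (m i2 i1 * v i4 0)) (m i3 i1 * v i4 0) 0) u =
  k * v i4 0 * (b * m i3 i1 * n i3 i1 - a * m i2 i1 * n i2 i1).
Proof. by move=> h2 h3 h4; rewrite minkZl mink_col4l h2 h3 h4; ring. Qed.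

Lemma principal_sym (k a b x x' y y' : R) :
  k * (b * y * y' - a * x * x') = k * (b * y' * y - a * x' * x).
Proof. by ring. Qed.

Lemma sub_eq0_congr (g1 g0 m1 m0 t1 t0 : R) :
  g1 = m1 + t1 -> g0 = m0 + t0 -> t1 = t0 -> m1 = m0 -> g1 - g0 = 0.
Proof. by move=> -> -> -> ->; rewrite subrr. Qed.

End ColumnVectors.

Section Transform.
Variables (R : realType) (M : surface R) (A : M -> frame R).
Hypotheses (smA : smooth_map setT A) (SOA : forall p, in_SO0 (A p).2).
Variables (a b : M -> R).
Hypothesis abP : forall c p X, atlas c -> cdom c p ->
  [/\ alpha0_cv A c p X i2 0 = a p * alpha_mx A c p X i2 i1,
      alpha0_cv A c p X i3 0 = b p * alpha_mx A c p X i3 i1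
    & alpha0_cv A c p X i4 0 = 0].
Variables (rho : M -> R) (v : M -> 'cV[R]_4).
Hypothesis v_smooth : smooth_map setT v.
Hypothesis v_eq : forall c p, atlas c -> cdom c p -> forall X,
  dmap c v p X = - (alpha_rho A rho c p X *m v p).
Local Notation V := (fun p => (A p).2 *m v p).
Let oT : open [set: M] := openT.

Lemma smooth_in_V c : atlas c -> smooth_in c setT V.
Proof.
move=> ac; exact (smooth_in_mulmx ac oT (smooth_in_frame smA ac) (v_smooth ac)).
Qed.

Section InChart.
Variables (c : chart R M) (p : M) (X : 'rV[R]_2).
Hypotheses (ac : atlas c) (cp : cdom c p).
Local Notation x := (alpha_mx A c p X i2 i1).
Local Notation y := (alpha_mx A c p X i3 i1).

Lemma dmap_V : dmap c V p X = (A p).2 *m (rho p *: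
  col4 (- (x * v p i2 0 - y * v p i3 0)) (- (x * v p i4 0)) (y * v p i4 0) 0).
Proof.
rewrite -so31_rho_mulmx -(alpha_rhoE smA SOA rho X ac cp).
have D := dmap_mulmx ac cp I X (smooth_in_frame smA ac) (v_smooth ac).
rewrite [LHS]D (v_eq ac cp) (dmap_frame SOA).
by rewrite mulmxN mulmxBr !mulmxA.
Qed.

(** The term in [v^1] drops out because [alpha^4_0 = 0]. In this frame-free form the closedness of
    [gamma] becomes visible. *)
Lemma gammaE : gamma A v c p X = mink (V p) (dmap c (fun q => (A q).1) p X).
Proof.
rewrite (dmap_frame0 SOA) (frame_mink SOA) /gamma.
rewrite -![alpha0 A _ c p X]/(alpha0_cv A c p X _ 0).
have [_ _ h] := abP X ac cp; rewrite /mink h; ring.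
Qed.

(** The fourth rows of [rhoP] and [rhoQ] are zero, so the derivative of [v^4] does not involve
    [rho]. *)
Lemma dmap_v4 : dmap c (fun q => v q i4 0 : R) p X =
  - (x * v p i2 0 + y * v p i3 0 - alpha_mx A c p X i1 i1 * v p i4 0).
Proof.
have D := dmap_entry cp I i4 0 X (v_smooth ac).
rewrite [LHS]D (v_eq ac cp) mxE; congr (- _).
have so := so31E (alpha_mx_so31 smA SOA ac cp X).
rewrite (alpha_rhoE smA SOA rho X ac cp) /so31_rho.
move: (alpha_mx A c p X) so => m so.
by rewrite !mxE sum4 !mxE /= ?so; ring.
Qed.

End InChart.

Lemma mink_dmap_V c p X Y : atlas c -> cdom c p ->
  mink (dmap c V p X) (dmap c (fun q => (A q).1) p Y) = rho p * v p i4 0 *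
    (b p * alpha_mx A c p X i3 i1 * alpha_mx A c p Y i3 i1
     - a p * alpha_mx A c p X i2 i1 * alpha_mx A c p Y i2 i1).
Proof.
move=> ac cp; rewrite (dmap_V X ac cp) (dmap_frame0 SOA) (frame_mink SOA).
have [h2 h3 h4] := abP Y ac cp.
exact: mink_col4_principal.
Qed.

(** The exterior derivative splits into the antisymmetrized pairing of [dV] with [da_0] and the
    pairing of [V] with the second derivatives of [a_0]. The latter are symmetric; the former
    pairing is symmetric too, since both differentials are diagonal in the coframe. *)
Lemma gamma_closed : closed_form (gamma A v).
Proof.
move=> c p ac cp.
have sV := smooth_in_V ac; have sa := smooth_in_frame0 smA ac.
have G1 : dmap c (fun q => gamma A v c q (e1 R)) p (e0 R) =
    dmap c (fun q => mink (V q) (dmap c (fun q => (A q).1) q (e1 R))) p (e0 R).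
  by apply: (dmap_ext ac oT cp I) => q cq _; exact: gammaE.
have G0 : dmap c (fun q => gamma A v c q (e0 R)) p (e1 R) =
    dmap c (fun q => mink (V q) (dmap c (fun q => (A q).1) q (e0 R))) p (e1 R).
  by apply: (dmap_ext ac oT cp I) => q cq _; exact: gammaE.
have D1 := dmap_mink ac oT (e0 R) cp I sV (smooth_in_dmap1 ac oT sa).
have D0 := dmap_mink ac oT (e1 R) cp I sV (smooth_in_dmap0 ac oT sa).
have C := dmap_comm ac oT cp I sa.
apply: (sub_eq0_congr (etrans G1 D1) (etrans G0 D0) (congr1 (mink (V p)) C)).
exact (etrans (mink_dmap_V (e0 R) (e1 R) ac cp)
  (etrans (principal_sym _ _ _ _ _ _ _) (esym (mink_dmap_V (e1 R) (e0 R) ac cp)))).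
Qed.

Variables (U : set M) (r : M -> R).
Hypotheses (oU : open U) (v4_neq0 : forall p, U p -> v p i4 0 != 0).
Hypothesis r_smooth : smooth_map U r.
Hypothesis r_eq : forall c p, atlas c -> cdom c p -> U p -> forall X,
  dmap c r p X = gamma A v c p X.
Local Notation s := (fun p => r p / v p i4 0).
Local Notation S := (fun p => (A p).1 + s p *: ((A p).2 *m delta_mx i1 0)).

Lemma smooth_in_s c : atlas c -> smooth_in c U s.
Proof.
move=> ac; apply: (smooth_inM ac oU (r_smooth ac)).
apply: (smooth_inV ac oU (fun p _ Up => v4_neq0 Up)).
exact: (smooth_in_sub (@subsetT _ U) (smooth_in_entry ac oT i4 0 (v_smooth ac))).
Qed.

Lemma smooth_in_a1 c : atlas c -> smooth_in c U (fun p => (A p).2 *m (delta_mx i1 0 : 'cV[R]_4)).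
Proof.
move=> ac; apply: (smooth_in_sub (@subsetT _ U)).
exact: (smooth_in_mulmx ac oT (smooth_in_frame smA ac) (smooth_in_cst ac oT _)).
Qed.

Lemma smooth_in_S c : atlas c -> smooth_in c U S.
Proof.
move=> ac; apply: (smooth_inD ac oU _ (smooth_in_scale ac oU (smooth_in_s ac) (smooth_in_a1 ac))).
exact: (smooth_in_sub (@subsetT _ U) (smooth_in_frame0 smA ac)).
Qed.

(* The first component is fixed by [dS] being orthogonal to [V]. *)
Lemma dmap_S c p X : atlas c -> cdom c p -> U p ->
  let x := alpha_mx A c p X i2 i1 in let y := alpha_mx A c p X i3 i1 in
  dmap c S p X = (A p).2 *m
    col4 (((a p + s p) * x * v p i2 0 + (b p + s p) * y * v p i3 0) / v p i4 0)
         ((a p + s p) * x) ((b p + s p) * y) 0.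
Proof.
move=> ac cp Up /=; have v0 := v4_neq0 Up.
have sa1 := smooth_in_a1 ac; have ss := smooth_in_s ac.
have sa0 : smooth_in c U (fun q => (A q).1).
  exact: (smooth_in_sub (@subsetT _ U) (smooth_in_frame0 smA ac)).
have s4 : smooth_in c U (fun q => v q i4 0 : R).
  exact: (smooth_in_sub (@subsetT _ U) (smooth_in_entry ac oT i4 0 (v_smooth ac))).
have Da1 : dmap c (fun q => (A q).2 *m (delta_mx i1 0 : 'cV[R]_4)) p X =
    (A p).2 *m (alpha_mx A c p X *m delta_mx i1 0).
  have D := dmap_mulmx ac cp I X (smooth_in_frame smA ac)
    (smooth_in_cst ac oT (delta_mx i1 0 : 'cV[R]_4)).
  by rewrite [LHS]D dmap_cst mulmx0 addr0 (dmap_frame SOA) mulmxA.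
have DS : dmap c S p X = (A p).2 *m (alpha0_cv A c p X +
    (dmap c s p X *: delta_mx i1 0 + s p *: (alpha_mx A c p X *m delta_mx i1 0))).
  have D := dmapD cp Up X sa0 (smooth_in_scale ac oU ss sa1).
  rewrite [LHS]D (dmap_frame0 SOA) (dmap_scale ac cp Up X ss sa1) Da1.
  by rewrite !mulmxDr !scalemxAr.
(* Differentiating [r = s v^4] and using [dr = gamma] determines [ds], which enters only the
   [a_1]-component of [dS]. *)
have Dr : dmap c r p X = dmap c s p X * v p i4 0 + s p * dmap c (fun q => v q i4 0 : R) p X.
  rewrite -(dmapM ac cp Up X ss s4).
  by apply: (dmap_ext ac oU cp Up) => q _ Uq; rewrite divfK // v4_neq0.
have [h2 h3 h4] := abP X ac cp.
have g : gamma A v c p X = v p i2 0 * (a p * alpha_mx A c p X i2 i1)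
    + v p i3 0 * (b p * alpha_mx A c p X i3 i1) - v p i4 0 * alpha0_cv A c p X i1 0.
  by rewrite -h2 -h3.
have so := so31E (alpha_mx_so31 smA SOA ac cp X).
move: Dr; rewrite (r_eq ac cp Up) g (dmap_v4 X ac cp).
rewrite DS; move: (alpha_mx A c p X) (alpha0_cv A c p X) (dmap c s p X) so h2 h3 h4.
move=> m u ds so h2 h3 h4 Dr; congr (_ *m _).
rewrite -colE; apply: colP4; rewrite !mxE ?h2 ?h3 ?h4 ?so /=.
- have -> : ds = (v p i2 0 * (a p * m i2 i1) + v p i3 0 * (b p * m i3 i1)
      - v p i4 0 * u i1 0 + s p * (m i2 i1 * v p i2 0 + m i3 i1 * v p i3 0
      - m i1 i1 * v p i4 0)) / v p i4 0.
    apply: (mulIf v0); rewrite divfK // Dr; ring.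
  by field.
- by ring.
- by ring.
- by ring.
Qed.

End Transform.

Section TransformColumns.
Local Open Scope complex_scope.
Variable R : realType.

Lemma mink_col4_VV (m n : 'M[R]_4) (k w t t' : R) :
  mink (k *: col4 t (- (m i2 i1 * w)) (m i3 i1 * w) 0)
       (k *: col4 t' (- (n i2 i1 * w)) (n i3 i1 * w) 0) =
  (k * w) ^+ 2 * (m i2 i1 * n i2 i1 + m i3 i1 * n i3 i1).
Proof. by rewrite minkZl minkZr mink_col4; ring. Qed.

Lemma mink_col4_SV (m n : 'M[R]_4) (a b k w t t' : R) :
  mink (col4 t (a * m i2 i1) (b * m i3 i1) 0)
       (k *: col4 t' (- (n i2 i1 * w)) (n i3 i1 * w) 0) =
  k * w * (b * m i3 i1 * n i3 i1 - a * m i2 i1 * n i2 i1).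
Proof. by rewrite minkZr mink_col4; ring. Qed.

Lemma mink_col4_SS (a b t t' a' b' : R) :
  mink (col4 t a b 0) (col4 t' a' b' 0) = a * a' + b * b'.
Proof. by rewrite mink_col4; ring. Qed.

Lemma mink_col4_perp (a b : R) (v : 'cV[R]_4) : v i4 0 != 0 ->
  mink (col4 ((a * v i2 0 + b * v i3 0) / v i4 0) a b 0) v = 0.
Proof. by move=> v0; rewrite mink_col4l; field. Qed.

Lemma so31_col1 (m : 'M[R]_4) : so31 m ->
  m *m delta_mx i1 0 = col4 (m i1 i1) (m i2 i1) (m i3 i1) 0.
Proof. by move=> /so31E so; rewrite -colE; apply: colP4; rewrite !mxE ?so. Qed.

Lemma delta1_col4 : delta_mx i1 0 = col4 1 0 0 0 :> 'cV[R]_4.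
Proof. by apply: colP4; rewrite !mxE. Qed.

Lemma col4_0 : col4 0 0 0 0 = 0 :> 'cV[R]_4.
Proof. by apply: colP4; rewrite !mxE. Qed.

Lemma Lplus_delta1 : Lplus (delta_mx i1 0 : 'cV[R]_4).
Proof.
split; first by apply/negP => /eqP/matrixP/(_ i1 0); rewrite !mxE /= => /eqP; rewrite oner_eq0.
- by rewrite delta1_col4 mink_col4; ring.
- by rewrite !mxE /= addr0 ltr01.
Qed.

(** The dual basis up to scale: [(y1, - y0)] is annihilated by [g] and [(x1, - x0)] by [f]. For the
    coframe these are the common principal directions. *)
Lemma dual_vectors (f g : 'rV[R]_2 -> R) (x0 x1 y0 y1 : R) :
  (forall X, f X = X 0 ord0 * x0 + X 0 ord_max * x1) ->
  (forall X, g X = X 0 ord0 * y0 + X 0 ord_max * y1) ->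
  x0 * y1 - x1 * y0 != 0 ->
  exists X Y : 'rV[R]_2, [/\ f X != 0 /\ g X = 0, f Y = 0 /\ g Y != 0
    & forall k l : R, k *: X + l *: Y = 0 -> k = 0 /\ l = 0].
Proof.
move=> fE gE W0; pose mk (k l : R) : 'rV[R]_2 := k *: e0 R + l *: e1 R.
have mk0 k l : mk k l 0 ord0 = k by rewrite !mxE /= mulr1 mulr0 addr0.
have mk1 k l : mk k l 0 ord_max = l by rewrite !mxE /= mulr1 mulr0 add0r.
exists (mk y1 (- y0)), (mk x1 (- x0)); rewrite !fE !gE !mk0 !mk1; split.
- by rewrite mulNr (mulrC y1) (mulrC y0); split=> //; ring.
- split; first by ring.
  by rewrite (_ : _ + _ = - (x0 * y1 - x1 * y0)) ?oppr_eq0 //; ring.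
- move=> k l /matrixP h; have := h 0 ord0; have := h 0 ord_max.
  rewrite mxE mxE [in X in _ + X]mxE mk1 mk1 mxE => h1.
  rewrite mxE mxE [in X in _ + X]mxE mk0 mk0 mxE => h0.
  have W1 : y1 * - x0 - x1 * - y0 != 0.
    by rewrite (_ : _ - _ = - (x0 * y1 - x1 * y0)) ?oppr_eq0 //; ring.
  exact: two_form_eq0 W1 h0 h1.
Qed.

Lemma sub_congr (p p' q q' : R) : p = p' -> q = q' -> p - q = p' - q'.
Proof. by move=> -> ->. Qed.

Lemma conformal_factor (k w n u : R) : n != 0 -> u != 0 ->
  k ^+ 2 * w / u ^+ 2 = k ^+ 2 * n ^+ 2 / u ^+ 2 * (w / n ^+ 2).
Proof. by move=> n0 u0; field; rewrite n0 u0. Qed.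

Lemma opposite_signs (k t : R) : k != 0 -> t != 0 -> t * - (k ^+ 2 * t) < 0.
Proof.
move=> k0 t0; rewrite mulrN oppr_lt0 mulrCA -expr2 mulr_gt0 //.
  by rewrite exprn_even_gt0.
by rewrite exprn_even_gt0.
Qed.

Lemma det_congr (p00 p11 p01 p10 q00 q11 q01 q10 : R) :
  p00 = q00 -> p11 = q11 -> p01 = q01 -> p10 = q10 ->
  p00 * p11 - p01 * p10 = q00 * q11 - q01 * q10.
Proof. by move=> -> -> -> ->. Qed.

Lemma orientation_N (a b x0 x1 y0 y1 : R) :
  (x0 * (a * x0) + y0 * (b * y0)) * (x1 * (a * x1) + y1 * (b * y1))
  - (x0 * (a * x1) + y0 * (b * y1)) * (x1 * (a * x0) + y1 * (b * y0)) =
  a * b * (x0 * y1 - x1 * y0) ^+ 2.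
Proof. by ring. Qed.

(** The diagonal coefficients are [- k a] and [k b] in place of [a] and [b]: one eigenvalue changes
    sign relative to the other, whence the minus sign. *)
Lemma orientation_V (k a b x0 x1 y0 y1 : R) :
  k * (b * y0 * y0 - a * x0 * x0) * (k * (b * y1 * y1 - a * x1 * x1))
  - k * (b * y1 * y0 - a * x1 * x0) * (k * (b * y0 * y1 - a * x0 * x1)) =
  - (k ^+ 2 * (a * b * (x0 * y1 - x1 * y0) ^+ 2)).
Proof. by ring. Qed.

(** With [t], [o] for [alpha^1_1], [alpha^3_2], the first column of the structure equation reads
    [dx = t /\ x + o /\ y] and [dy = t /\ y - o /\ x]. These are the combinations in the wedged
    equation for [rho], so [sqrt rho x] and [sqrt rho y] are closed. *)
Lemma structure_closed (u w X Y : 'M[R]_4) (r r0 r1 : R) : so31 u -> so31 w ->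
  X - Y = - (u *m w - w *m u) ->
  2 * r * (u i1 i1 * w i2 i1 - w i1 i1 * u i2 i1
    + (u i3 i2 * w i3 i1 - w i3 i2 * u i3 i1)) = - (r0 * w i2 i1 - r1 * u i2 i1) /\
  2 * r * (u i1 i1 * w i3 i1 - w i1 i1 * u i3 i1
    - (u i3 i2 * w i2 i1 - w i3 i2 * u i2 i1)) = - (r0 * w i3 i1 - r1 * u i3 i1) ->
  2 * r * (X i2 i1 - Y i2 i1) = - (r0 * w i2 i1 - r1 * u i2 i1) /\
  2 * r * (X i3 i1 - Y i3 i1) = - (r0 * w i3 i1 - r1 * u i3 i1).
Proof.
move=> /so31E su /so31E sw /eqP; rewrite subr_eq => /eqP -> [<- <-].
by split; congr (_ * _); rewrite !mxE !sum4 ?su ?sw; ring.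
Qed.

(* The two equalities say that III is conformal, so that the second fundamental
   form, diagonal in the same coframe, loses its trace. *)
Lemma traceless_part (x0 x1 y0 y1 k a b w u t I00 I01 I11 : R) : u != 0 ->
  x0 * x0 + y0 * y0 - (x1 * x1 + y1 * y1) = 0 -> x0 * x1 + y0 * y1 = 0 ->
  I00 = I11 -> I01 = 0 ->
  let mu := - ((a + b) / 2 * w / u) in
  (k * w * (b * y0 * y0 - a * x0 * x0) / u - t * I00) -
  (k * w * (b * y1 * y1 - a * x1 * x1) / u - t * I11) =
    mu * (k * (x0 * x0 - y0 * y0 - (x1 * x1 - y1 * y1))) /\
  k * w * (b * y0 * y1 - a * x0 * x1) / u - t * I01 =
    mu * (k * (x0 * x1 - y0 * y1)).
Proof.
move=> u0 k1 k2 -> -> /=; split; apply/eqP; rewrite -subr_eq0; apply/eqP.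
- transitivity (k * w * (b - a) / (2 * u) * (x0 * x0 + y0 * y0 - (x1 * x1 + y1 * y1))).
    by field.
  by rewrite k1 mulr0.
- transitivity (k * w * (b - a) / (2 * u) * (x0 * x1 + y0 * y1)); first by field.
  by rewrite k2 mulr0.
Qed.

Lemma conformal_coordinates (k u x0 x1 y0 y1 : R) : k != 0 -> u != 0 ->
  k ^+ 2 * (x0 * x0 + y0 * y0) / u ^+ 2 = k ^+ 2 * (x1 * x1 + y1 * y1) / u ^+ 2 ->
  k ^+ 2 * (x0 * x1 + y0 * y1) / u ^+ 2 = 0 ->
  x0 * x0 + y0 * y0 - (x1 * x1 + y1 * y1) = 0 /\ x0 * x1 + y0 * y1 = 0.
Proof.
move=> k0 u0 h1 h2; have c0 : k ^+ 2 / u ^+ 2 != 0 by rewrite mulf_neq0 ?invr_eq0 ?expf_neq0.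
split; apply: (mulfI c0); rewrite mulr0.
- rewrite mulrBr ![_ / _ * _]mulrAC h1; exact: subrr.
- by rewrite mulrAC.
Qed.

(** The coframe metric is conformal in both charts, so their Jacobian is conformal; being
    orientation-preserving it is a rotation-dilation, and [quad_dz2_rotate] applies. *)
Lemma quad_dz2_chart (r x0 x1 y0 y1 x0' x1' y0' y1' m0 m1 n0 n1 : R) :
  0 < x0 * x0 + y0 * y0 ->
  x0 * x0 + y0 * y0 - (x1 * x1 + y1 * y1) = 0 -> x0 * x1 + y0 * y1 = 0 ->
  x0' * x0' + y0' * y0' - (x1' * x1' + y1' * y1') = 0 -> x0' * x1' + y0' * y1' = 0 ->
  x0' = m0 * x0 + m1 * x1 -> x1' = n0 * x0 + n1 * x1 ->
  y0' = m0 * y0 + m1 * y1 -> y1' = n0 * y0 + n1 * y1 ->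
  0 < m0 * n1 - n0 * m1 ->
  quad_dz2 r x0' x1' y0' y1' = quad_dz2 r x0 x1 y0 y1 * (m0 +i* m1) ^+ 2.
Proof.
move=> pos k1 k2 l1 l2 ex0 ex1 ey0 ey1 d0.
have n2 : x1 * x1 + y1 * y1 = x0 * x0 + y0 * y0.
  by apply/eqP; rewrite eq_sym -subr_eq0; apply/eqP.
(* In conformal coordinates the metric [x^2 + y^2] is its first diagonal coefficient times the
   Euclidean product. *)
have K (p0 p1 q0 q1 : R) : (p0 * x0 + p1 * x1) * (q0 * x0 + q1 * x1)
    + (p0 * y0 + p1 * y1) * (q0 * y0 + q1 * y1) =
    (x0 * x0 + y0 * y0) * (p0 * q0 + p1 * q1).
  transitivity ((x0 * x0 + y0 * y0) * (p0 * q0) + (x1 * x1 + y1 * y1) * (p1 * q1)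
    + (x0 * x1 + y0 * y1) * (p0 * q1 + p1 * q0)); first by ring.
  by rewrite n2 k2; ring.
have [n0E n1E] : n0 = - m1 /\ n1 = m0.
  apply: (conformal_rotation (k := x0 * x0 + y0 * y0) (k' := x0' * x0' + y0' * y0')) => //.
  - by rewrite ex0 ey0 K.
  - rewrite -K -ex1 -ey1; apply/eqP; rewrite eq_sym -subr_eq0; exact/eqP.
  - by rewrite -K -ex0 -ey0 -ex1 -ey1.
  - by rewrite (mulrC m1).
by rewrite ex0 ex1 ey0 ey1 n0E n1E quad_dz2_rotate.
Qed.

End TransformColumns.

(** * Geometry of the two envelopes of [S] *)

Section BianchiDarboux.
Variables (R : realType) (M : surface R) (A : M -> frame R).
Hypotheses (smA : smooth_map setT A) (SOA : forall p, in_SO0 (A p).2).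
Variables (a b : M -> R).
Hypotheses (sma : smooth_map setT a) (smb : smooth_map setT b).
Hypothesis abP : forall c p X, atlas c -> cdom c p ->
  [/\ alpha0_cv A c p X i2 0 = a p * alpha_mx A c p X i2 i1,
      alpha0_cv A c p X i3 0 = b p * alpha_mx A c p X i3 i1
    & alpha0_cv A c p X i4 0 = 0].
Variables (rho : M -> R) (v : M -> 'cV[R]_4).
Hypotheses (rho_sm : smooth_map setT rho) (rho_gt0 : forall p, 0 < rho p).
Hypothesis rho_eq : forall c p, atlas c -> cdom c p -> forall X,
  2 * (alpha A i1 i1 c p X - framing_star A c p (alpha A i3 i2 c p) X)
  = - dmap c (fun q => ln (rho q)) p X.
Hypothesis wedge_neq0 : forall c p, atlas c -> cdom c p ->
  wedge (alpha A i2 i1 c p) (alpha A i3 i1 c p) != 0.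
Hypothesis v_smooth : smooth_map setT v.
Hypothesis v_Lplus : forall p, Lplus (v p).
Hypothesis v_eq : forall c p, atlas c -> cdom c p -> forall X,
  dmap c v p X = - (alpha_rho A rho c p X *m v p).
Variables (U : set M) (r : M -> R).
Hypotheses (oU : open U) (v4_neq0 : forall p, U p -> v p i4 0 != 0).
Hypothesis r_smooth : smooth_map U r.
Hypothesis r_eq : forall c p, atlas c -> cdom c p -> U p -> forall X,
  dmap c r p X = gamma A v c p X.
Let oT : open [set: M] := openT.
Let V := (fun p => (A p).2 *m v p).
Let N := (fun p => (A p).2 *m (delta_mx i1 0 : 'cV[R]_4)).
Let s := (fun p => r p / v p i4 0).
Let S := (fun p => (A p).1 + s p *: N p).
Local Notation x c p X := (alpha_mx A c p X i2 i1).
Local Notation y c p X := (alpha_mx A c p X i3 i1).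

Let V_Lplus p : Lplus (V p).
Proof. by have [_ _ h] := SOA p; exact: h. Qed.

Let N_Lplus p : Lplus (N p).
Proof. by have [_ _ h] := SOA p; apply: h; exact: Lplus_delta1. Qed.

Let uV p : utime (V p) != 0.
Proof. by rewrite gt_eqF // utime_Lplus. Qed.

Let uN p : utime (N p) != 0.
Proof. by rewrite gt_eqF // utime_Lplus. Qed.

Let VV p : mink (V p) (V p) = 0.
Proof. by have [] := V_Lplus p. Qed.

Let NN p : mink (N p) (N p) = 0.
Proof. by have [] := N_Lplus p. Qed.

Let smV : smooth_map U V.
Proof.
move=> c ac; exact (smooth_in_sub (@subsetT _ U) (smooth_in_V smA v_smooth ac)).
Qed.

Let smN : smooth_map U N.
Proof. move=> c ac; exact (smooth_in_a1 smA U ac). Qed.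

Let smS : smooth_map U S.
Proof. move=> c ac; exact (smooth_in_S smA v_smooth oU v4_neq0 r_smooth ac). Qed.

Section AtPoint.
Variables (c : chart R M) (p : M).
Hypotheses (ac : atlas c) (cp : cdom c p).

Let W0 : x c p (e0 R) * y c p (e1 R) - x c p (e1 R) * y c p (e0 R) != 0.
Proof. exact (wedge_neq0 ac cp). Qed.

Let xE X : x c p X = X 0 ord0 * x c p (e0 R) + X 0 ord_max * x c p (e1 R).
Proof. exact (mx_comb2E i2 i1 (alpha_mxE smA X ac cp)). Qed.

Let yE X : y c p X = X 0 ord0 * y c p (e0 R) + X 0 ord_max * y c p (e1 R).
Proof. exact (mx_comb2E i3 i1 (alpha_mxE smA X ac cp)). Qed.

Lemma coframe_eq0 X : x c p X = 0 -> y c p X = 0 -> X = 0.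
Proof.
move=> hx hy.
have [h0 h1] := two_form_eq0 W0 (etrans (esym (xE X)) hx) (etrans (esym (yE X)) hy).
by rewrite (row2E X) h0 h1 !scale0r addr0.
Qed.

Lemma coframe_gt0 X : X != 0 -> 0 < x c p X * x c p X + y c p X * y c p X.
Proof.
move=> X0; rewrite lt0r addr_ge0 ?andbT -?expr2 ?sqr_ge0 //.
apply: contraNneq X0 => /eqP; rewrite paddr_eq0 ?sqr_ge0 // !sqrf_eq0.
by move=> /andP[/eqP hx /eqP hy]; apply/eqP; exact: coframe_eq0.
Qed.

Lemma principal_vectors : exists X Y : 'rV[R]_2,
  [/\ x c p X != 0 /\ y c p X = 0, x c p Y = 0 /\ y c p Y != 0
    & forall k l : R, k *: X + l *: Y = 0 -> k = 0 /\ l = 0].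
Proof.
exact (dual_vectors xE yE W0).
Qed.

Let dV X := dmap_V smA SOA v_smooth v_eq X ac cp.

Lemma mink_dV X Y : mink (dmap c V p X) (dmap c V p Y) =
  (rho p * v p i4 0) ^+ 2 * (x c p X * x c p Y + y c p X * y c p Y).
Proof. by rewrite (dV X) (dV Y) (frame_mink SOA); exact: mink_col4_VV. Qed.

Lemma dN X : dmap c N p X =
  (A p).2 *m col4 (alpha_mx A c p X i1 i1) (x c p X) (y c p X) 0.
Proof.
have D := dmap_mulmx ac cp I X (smooth_in_frame smA ac)
  (smooth_in_cst ac oT (delta_mx i1 0 : 'cV[R]_4)).
rewrite -(so31_col1 (alpha_mx_so31 smA SOA ac cp X)).
by rewrite [LHS]D dmap_cst mulmx0 addr0 (dmap_frame SOA) mulmxA.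
Qed.

Lemma mink_dN X Y : mink (dmap c N p X) (dmap c N p Y) =
  x c p X * x c p Y + y c p X * y c p Y.
Proof. by rewrite !dN (frame_mink SOA); exact: mink_col4_SS. Qed.

Hypothesis Up : U p.

Let dS X := dmap_S smA SOA abP v_smooth v_eq oU v4_neq0 r_smooth r_eq X ac cp Up.

Lemma mink_dS_V X : mink (dmap c S p X) (V p) = 0.
Proof. by rewrite dS (frame_mink SOA); apply: mink_col4_perp; exact: v4_neq0. Qed.

Lemma mink_dS_N X : mink (dmap c S p X) (N p) = 0.
Proof. by rewrite dS (frame_mink SOA) delta1_col4 mink_col4; ring. Qed.

Lemma mink_dS_dV X Y : mink (dmap c S p X) (dmap c V p Y) = rho p * v p i4 0 *
  ((b p + s p) * y c p X * y c p Y - (a p + s p) * x c p X * x c p Y).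
Proof. by rewrite dS (dV Y) (frame_mink SOA); exact: mink_col4_SV. Qed.

Lemma mink_dN_dS X Y : mink (dmap c N p X) (dmap c S p Y) =
  x c p X * ((a p + s p) * x c p Y) + y c p X * ((b p + s p) * y c p Y).
Proof. by rewrite dS dN (frame_mink SOA); exact: mink_col4_SS. Qed.

Lemma mink_dS X : mink (dmap c S p X) (dmap c S p X) =
  ((a p + s p) * x c p X) ^+ 2 + ((b p + s p) * y c p X) ^+ 2.
Proof. by rewrite dS (frame_mink SOA) !expr2; exact: mink_col4_SS. Qed.

Lemma dS_eq0 X : (a p + s p) * x c p X = 0 -> (b p + s p) * y c p X = 0 ->
  dmap c S p X = 0.
Proof.
move=> h1 h2; rewrite dS.
rewrite -[r p / _]/(s p) h1 h2 !mul0r addr0 mul0r col4_0; exact: mulmx0.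
Qed.

Lemma rho_v4_neq0 : rho p * v p i4 0 != 0.
Proof. by rewrite mulf_neq0 ?v4_neq0 // gt_eqF. Qed.

Lemma dV_gt0 X : X != 0 -> 0 < mink (dmap c V p X) (dmap c V p X).
Proof.
move=> X0; rewrite mink_dV mulr_gt0 ?coframe_gt0 //.
by rewrite exprn_even_gt0 //= rho_v4_neq0.
Qed.

End AtPoint.

Let Fhat := (fun p => contact_of (S p) (V p)).

Lemma closed_coframe c p : atlas c -> cdom c p ->
  2 * rho p * (dmap c (fun q => x c q (e1 R) : R) p (e0 R)
               - dmap c (fun q => x c q (e0 R) : R) p (e1 R)) =
    - (dmap c rho p (e0 R) * x c p (e1 R) - dmap c rho p (e1 R) * x c p (e0 R)) /\
  2 * rho p * (dmap c (fun q => y c q (e1 R) : R) p (e0 R)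
               - dmap c (fun q => y c q (e0 R) : R) p (e1 R)) =
    - (dmap c rho p (e0 R) * y c p (e1 R) - dmap c rho p (e1 R) * y c p (e0 R)).
Proof.
move=> ac cp; have s0 := smooth_in_alpha_mx0 smA SOA ac; have s1 := smooth_in_alpha_mx1 smA SOA ac.
have E1 i j := dmap_entry cp I i j (e0 R) s1; have E0 i j := dmap_entry cp I i j (e1 R) s0.
have [h1 h2] := structure_closed (alpha_mx_so31 smA SOA ac cp _) (alpha_mx_so31 smA SOA ac cp _)
  (alpha_mx_structure smA SOA ac cp) (rho_eq_wedge rho_sm rho_gt0 rho_eq wedge_neq0 ac cp).
split.
- exact (etrans (congr1 ( *%R (2 * rho p)) (sub_congr (E1 i2 i1) (E0 i2 i1))) h1).
- exact (etrans (congr1 ( *%R (2 * rho p)) (sub_congr (E1 i3 i1) (E0 i3 i1))) h2).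
Qed.

Lemma Fhat_III c p X Y : atlas c -> cdom c p -> U p ->
  III Fhat c p X Y = (rho p * v p i4 0) ^+ 2 * (x c p X * x c p Y + y c p X * y c p Y)
    / utime (V p) ^+ 2.
Proof.
move=> ac cp Up; rewrite -(mink_dV ac cp).
exact (contact_III S oU smV (fun p _ => uV p) (fun p _ => VV p) X Y ac cp Up).
Qed.

Lemma Fhat_II c p X Y : atlas c -> cdom c p -> U p ->
  II Fhat c p X Y = rho p * v p i4 0 *
    ((b p + s p) * y c p X * y c p Y - (a p + s p) * x c p X * x c p Y) / utime (V p)
    - utime (S p) * III Fhat c p X Y.
Proof.
move=> ac cp Up; rewrite -(mink_dS_dV ac cp Up).
exact (contact_II oU smS smV (fun p _ => uV p) (fun p _ => VV p)
  (fun c p ac cp Up => mink_dS_V ac cp Up) X Y ac cp Up).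
Qed.

(** Complex charts are defined through III of the transform, a multiple of [x^2 + y^2]; the factor
    cancels. *)
Lemma complex_chart_coframe c p : complex_chart Fhat U c -> cdom c p ->
  x c p (e0 R) * x c p (e0 R) + y c p (e0 R) * y c p (e0 R)
    - (x c p (e1 R) * x c p (e1 R) + y c p (e1 R) * y c p (e1 R)) = 0 /\
  x c p (e0 R) * x c p (e1 R) + y c p (e0 R) * y c p (e1 R) = 0.
Proof.
move=> [ac cU conf] cp; have Up := cU _ cp; have [h1 h2] := conf _ cp.
have E X Y := Fhat_III X Y ac cp Up.
exact (conformal_coordinates (rho_v4_neq0 Up) (uV p)
  (etrans (esym (E _ _)) (etrans h1 (E _ _))) (etrans (esym (E _ _)) h2)).
Qed.

Let h c p := quad_dz2 (rho p) (x c p (e0 R)) (x c p (e1 R)) (y c p (e0 R)) (y c p (e1 R)).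
(** With [a' = a + s] and [b' = b + s], split [b' y^2 - a' x^2] as [- (a' + b') / 2 (x^2 - y^2) +
    (b' - a') / 2 (x^2 + y^2)]. The last term is a multiple of III and has no [dz^2] part; the
    factor [rho] is kept in [h]. *)
Let mu p := - ((a p + s p + (b p + s p)) / 2 * v p i4 0 / utime (V p)).

Lemma smooth_mu : smooth_map U mu.
Proof.
move=> c ac; have ss := smooth_in_s v_smooth oU v4_neq0 r_smooth ac.
have TU := @subsetT _ U.
have s4 := smooth_in_sub TU (smooth_in_entry ac oT i4 0 (v_smooth ac)).
have sA := smooth_inD ac oU (smooth_in_sub TU (sma ac)) ss.
have sB := smooth_inD ac oU (smooth_in_sub TU (smb ac)) ss.
have sk := smooth_inM ac oU (smooth_inD ac oU sA sB) (smooth_in_cst ac oU (2^-1 : R)).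
have su := smooth_inV ac oU (fun p _ _ => uV p) (smooth_in_utime oU ac (smV ac)).
exact (smooth_inN ac oU (smooth_inM ac oU (smooth_inM ac oU sk s4) su)).
Qed.

Lemma holomorphic_h : holomorphic_quadratic_differential Fhat U h.
Proof.
have sm c i j : atlas c ->
    smooth_in c (cdom c) (fun q => alpha_mx A c q (e0 R) i j : R) /\
    smooth_in c (cdom c) (fun q => alpha_mx A c q (e1 R) i j : R).
  move=> ac; have sub := @subsetT _ (cdom c).
  split; apply: (smooth_in_sub sub).
    exact (smooth_in_entry ac oT i j (smooth_in_alpha_mx0 smA SOA ac)).
  exact (smooth_in_entry ac oT i j (smooth_in_alpha_mx1 smA SOA ac)).
have sr c : atlas c -> smooth_in c (cdom c) rho.
  by move=> ac; apply: (smooth_in_sub (@subsetT _ (cdom c))); exact: rho_sm.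
split.
- move=> c [ac _ _]; have oc := open_cdom ac.
  have [sx0 sx1] := sm c i2 i1 ac; have [sy0 sy1] := sm c i3 i1 ac.
  split; apply: (smooth_in_smooth_map ac oc (@subset_refl _ _)).
    exact (smooth_in_re ac oc (sr c ac) sx0 sx1 sy0 sy1).
  exact (smooth_in_im ac oc (sr c ac) sx0 sx1 sy0 sy1).
- move=> c p cc cp; have [ac _ _] := cc; have oc := open_cdom ac.
  have [sx0 sx1] := sm c i2 i1 ac; have [sy0 sy1] := sm c i3 i1 ac.
  have [cx cy] := closed_coframe ac cp.
  exact (quad_dz2_CR ac oc (sr c ac) sx0 sx1 sy0 sy1
    (fun q cq _ => (complex_chart_coframe cc cq).1)
    (fun q cq _ => (complex_chart_coframe cc cq).2) cp cp (wedge_neq0 ac cp) cx cy).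
- move=> c d p cc cd cp dp; have [ac _ _] := cc; have [ad _ _] := cd.
  have [k1 k2] := complex_chart_coframe cc cp; have [l1 l2] := complex_chart_coframe cd dp.
  have sc := smooth_in_cmap ac ad.
  have jE X i j : alpha_mx A d p X i j =
      dmap d (cmap c) p X 0 ord0 * alpha_mx A c p (e0 R) i j
      + dmap d (cmap c) p X 0 ord_max * alpha_mx A c p (e1 R) i j.
    rewrite (alpha_mx_chart smA X ac ad cp dp).
    exact (mx_comb2E i j (alpha_mxE smA _ ac cp)).
  rewrite /dz_dz (dmap_entry dp cp 0 ord0 (e0 R) sc) (dmap_entry dp cp 0 ord_max (e0 R) sc).
  have e0N0 : e0 R != 0.
    by apply/negP => /eqP/matrixP/(_ 0 ord0); rewrite !mxE /= => /eqP; rewrite oner_eq0.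
  exact (quad_dz2_chart (rho p) (coframe_gt0 ac cp e0N0) k1 k2 l1 l2
    (jE _ _ _) (jE _ _ _) (jE _ _ _) (jE _ _ _) (chart_change_det ac ad cp dp)).
Qed.

Lemma Fhat_L_isothermic : L_isothermic Fhat U.
Proof.
exists h, mu; split; [exact: holomorphic_h|exact: smooth_mu|].
move=> c p cc cp; have [ac cU conf] := cc; have Up := cU _ cp.
have [k1 k2] := complex_chart_coframe cc cp; have [h1 h2] := conf _ cp.
have [t1 t2] := traceless_part (rho p) (a p + s p) (b p + s p) (v p i4 0)
  (utime (S p)) (uV p) k1 k2 h1 h2.
have E X Y := Fhat_II X Y ac cp Up.
exact (quad_dz2_scale (etrans (sub_congr (E _ _) (E _ _)) t1) (etrans (E _ _) t2)).
Qed.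

Lemma Fhat_L_isothermic_immersion : L_isothermic_immersion Fhat U.
Proof.
have perp c p (ac : atlas c) (cp : cdom c p) (Up : U p) X := mink_dS_V ac cp Up X.
have pos c p (ac : atlas c) (cp : cdom c p) (Up : U p) X := @dV_gt0 c p ac cp Up X.
split; last exact: Fhat_L_isothermic.
- exact (contact_immersion oU smS smV (fun p _ => uV p) (fun p _ => VV p) pos).
- exact (contact_legendre oU smS smV (fun p _ => uV p) (fun p _ => VV p) perp).
- exact (contact_III_posdef S oU smV (fun p _ => uV p) (fun p _ => VV p) pos).
Qed.

Let F := (fun p => contact_of (A p).1 (N p)).

(** A complex chart inside [U] is a complex chart of [M], the conformality condition being
    pointwise; so the quadratic differential and its factor restrict. *)
Lemma L_isothermic_immersion_sub (G : M -> contact R) :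
  L_isothermic_immersion G setT -> L_isothermic_immersion G U.
Proof.
have TU := @subsetT _ U.
move=> [[sG imG] [_ nG perpG] posG [h0 [m0 [[smh crh trh] smm IIh]]]].
have cc c : complex_chart G U c -> complex_chart G setT c.
  by move=> [ac _ hc]; split=> //; exact: subsetT.
have sGU : smooth_map U G by move=> c ac; exact (smooth_in_sub TU (sG c ac)).
split.
- by split=> // c p ac cp _; exact: imG.
- split=> //; first by move=> p _; exact: nG.
  by move=> c p ac cp _; exact: perpG.
- by move=> c p ac cp _; exact: posG.
- exists h0, m0; split.
  + split.
    * by move=> c /cc; exact: smh.
    * by move=> c p /cc; exact: crh.
    * by move=> c d p /cc cc1 /cc; exact: trh.
  + by move=> c ac; exact (smooth_in_sub TU (smm c ac)).
  + by move=> c p /cc; exact: IIh.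
Qed.

Lemma F_III c p X Y : atlas c -> cdom c p ->
  III F c p X Y = (x c p X * x c p Y + y c p X * y c p Y) / utime (N p) ^+ 2.
Proof.
move=> ac cp; rewrite -(mink_dN ac cp).
exact (contact_III (fun q => (A q).1) oT (fun c ac => smooth_in_a1 smA setT ac)
  (fun p _ => uN p) (fun p _ => NN p) X Y ac cp I).
Qed.

(** The coefficient [l] absorbs the [a_1]-component of [da_0 - k dN], which does not affect contact
    elements in the direction [a_1]. *)
Lemma F_curvature_direction c p X k : atlas c -> cdom c p -> X != 0 ->
  a p * x c p X = k * x c p X -> b p * y c p X = k * y c p X ->
  curvature_direction F c p X.
Proof.
move=> ac cp X0 hx hy; have [h2 h3 h4] := abP X ac cp.
apply: (contact_curvature_direction oT (fun c ac => smooth_in_frame0 smA ac)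
  (fun c ac => smooth_in_a1 smA setT ac) (fun p _ => uN p) (k := k)
  (l := alpha0_cv A c p X i1 0 - k * alpha_mx A c p X i1 i1) ac cp I X0).
rewrite (dN ac cp X) (dmap_frame0 SOA) /N scalemxAr scalemxAr -mulmxDr.
congr (_ *m _); rewrite delta1_col4; apply: colP4; rewrite ?h2 ?h3 ?h4 ?hx ?hy;
  rewrite !mxE /=; ring.
Qed.

(** Comparing tangential components is enough: the [a_1]-components of [dS] and [k dV] are both
    forced by orthogonality to [V], as [v^4] is nonzero. *)
Lemma Fhat_curvature_direction c p X k : atlas c -> cdom c p -> U p -> X != 0 ->
  (a p + s p) * x c p X = - (k * (rho p * v p i4 0) * x c p X) ->
  (b p + s p) * y c p X = k * (rho p * v p i4 0) * y c p X ->
  curvature_direction Fhat c p X.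
Proof.
move=> ac cp Up X0 hx hy; have v0 := v4_neq0 Up.
apply: (contact_curvature_direction oU smS smV (fun p _ => uV p) (k := k) (l := 0) ac cp Up X0).
rewrite (dmap_S smA SOA abP v_smooth v_eq oU v4_neq0 r_smooth r_eq X ac cp Up).
rewrite (dmap_V smA SOA v_smooth v_eq X ac cp) scale0r addr0 scalemxAr.
congr (_ *m _); rewrite -[r p / _]/(s p) hx hy.
by apply: colP4; rewrite !mxE /=; field.
Qed.

Lemma F_Fhat_curvature_lines : preserves_curvature_lines U F Fhat.
Proof.
move=> c p ac cp Up; have [X [Y [[xX yX] [xY yY] XY]]] := principal_vectors ac cp.
have k0 := rho_v4_neq0 Up.
have X0 : X != 0.
  apply/negP => /eqP X0; have [] := XY 1 0 _; rewrite ?X0 ?scaler0 ?scale0r ?addr0 //.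
  by move=> /eqP; rewrite oner_eq0.
have Y0 : Y != 0.
  apply/negP => /eqP Y0; have [] := XY 0 1 _; rewrite ?Y0 ?scaler0 ?scale0r ?addr0 //.
  by move=> _ /eqP; rewrite oner_eq0.
exists X, Y; split; first exact: XY.
- split.
    by apply: (F_curvature_direction (k := a p) ac cp X0); rewrite ?yX ?mulr0.
  (* On [X], where [y] vanishes, the [a_2]-components of [dS] and [dV] are [(a + s) x] and
     [- rho v^4 x]; their ratio is [k]. On [Y] the [a_3]-components give the ratio with a plus
     sign. *)
  apply: (Fhat_curvature_direction (k := - ((a p + s p) / (rho p * v p i4 0))) ac cp Up X0).
    by rewrite mulNr divfK // mulNr opprK.
  by rewrite yX !mulr0.
- split.
    by apply: (F_curvature_direction (k := b p) ac cp Y0); rewrite ?xY ?mulr0.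
  apply: (Fhat_curvature_direction (k := (b p + s p) / (rho p * v p i4 0)) ac cp Up Y0).
    by rewrite xY !mulr0 oppr0.
  by rewrite divfK.
Qed.

Lemma F_Fhat_conformal : conformal_III U F Fhat.
Proof.
move=> c p ac cp Up; have k0 := rho_v4_neq0 Up.
exists ((rho p * v p i4 0) ^+ 2 * utime (N p) ^+ 2 / utime (V p) ^+ 2).
  have sq_gt0 (z : R) : z != 0 -> 0 < z ^+ 2 by move=> z0; rewrite exprn_even_gt0.
  by apply: divr_gt0; [apply: mulr_gt0|]; exact: sq_gt0.
move=> X Y; apply: etrans (Fhat_III X Y ac cp Up) _.
apply: etrans (congr1 ( *%R _) (esym (F_III X Y ac cp))).
exact: (conformal_factor _ _ (uN p) (uV p)).
Qed.

(** If [a + s] vanished, [dS] would kill the principal vector on which [y] is zero; if [b + s]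
    vanished, the one on which [x] is zero. *)
Lemma S_curvatures_neq0 c p : immersion U S -> atlas c -> cdom c p -> U p ->
  (a p + s p) * (b p + s p) != 0.
Proof.
move=> [_ imS] ac cp Up; have [X [Y [[xX yX] [xY yY] XY]]] := principal_vectors ac cp.
have im0 := imS c p ac cp Up.
have xy0 i : alpha_mx A c p 0 i i1 = 0.
  by rewrite /alpha_mx /dmap derive0 mulmx0 mxE.
apply/negP; rewrite mulf_eq0 => /orP[] /eqP h0.
- move: xX; rewrite (im0 X) ?xy0 ?eqxx //.
  by apply: (dS_eq0 ac cp Up); rewrite ?h0 ?yX ?mul0r ?mulr0.
- move: yY; rewrite (im0 Y) ?xy0 ?eqxx //.
  by apply: (dS_eq0 ac cp Up); rewrite ?h0 ?xY ?mul0r ?mulr0.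
Qed.

Lemma S_spacelike : immersion U S -> spacelike_with_normals U S N V.
Proof.
move=> imS; split.
- move=> c p ac cp Up X X0; have := S_curvatures_neq0 imS ac cp Up.
  rewrite mulf_eq0 negb_or => /andP[a0 b0].
  rewrite (mink_dS ac cp Up) lt0r addr_ge0 ?sqr_ge0 // andbT.
  apply: contraNneq X0 => /eqP; rewrite paddr_eq0 ?sqr_ge0 // !sqrf_eq0 !mulf_eq0.
  rewrite (negPf a0) (negPf b0) /= => /andP[/eqP hx /eqP hy].
  by apply/eqP; exact: (coframe_eq0 ac cp hx hy).
- by split; [exact: smN|exact: smV].
- move=> p Up; split; [exact: N_Lplus|exact: V_Lplus|].
  move=> t; apply/negP => /eqP NV.
  (* Proportional null vectors would be orthogonal, whereas this product is [- v^4]. *)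
  have : mink (N p) (V p) = 0 by rewrite NV minkZl VV mulr0.
  rewrite (frame_mink SOA) delta1_col4 mink_col4l => /eqP.
  rewrite mul1r !mul0r !addr0 oppr_eq0; apply/negP; exact: v4_neq0.
- move=> c p ac cp Up X; split; rewrite minkC; first exact: (mink_dS_N ac cp Up).
  exact: (mink_dS_V ac cp Up).
Qed.

Lemma S_opposite_orientations : immersion U S -> opposite_orientations U S N V.
Proof.
move=> imS c p ac cp Up; have ab0 := S_curvatures_neq0 imS ac cp Up.
have VS X Y : mink (dmap c V p X) (dmap c S p Y) = rho p * v p i4 0 *
    ((b p + s p) * y c p Y * y c p X - (a p + s p) * x c p Y * x c p X).
  by rewrite minkC; exact: (mink_dS_dV ac cp Up).
have NS X Y := mink_dN_dS ac cp Up X Y.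
have E1 : envelope_orientation S N c p = (a p + s p) * (b p + s p) *
    (x c p (e0 R) * y c p (e1 R) - x c p (e1 R) * y c p (e0 R)) ^+ 2.
  exact (etrans (det2E _) (etrans (det_congr (NS _ _) (NS _ _) (NS _ _) (NS _ _))
    (orientation_N _ _ _ _ _ _))).
have E2 : envelope_orientation S V c p =
    - ((rho p * v p i4 0) ^+ 2 * ((a p + s p) * (b p + s p) *
    (x c p (e0 R) * y c p (e1 R) - x c p (e1 R) * y c p (e0 R)) ^+ 2)).
  exact (etrans (det2E _) (etrans (det_congr (VS _ _) (VS _ _) (VS _ _) (VS _ _))
    (orientation_V _ _ _ _ _ _ _))).
rewrite E1 E2; apply: (opposite_signs (rho_v4_neq0 Up)).
by apply: (mulf_neq0 ab0); rewrite expf_neq0 //; exact: (wedge_neq0 ac cp).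
Qed.

Lemma F_Fhat_bianchi_darboux : L_isothermic_immersion F setT -> immersion U S ->
  bianchi_darboux U F Fhat.
Proof.
move=> isoF imS; split.
- exact: L_isothermic_immersion_sub.
- exact: Fhat_L_isothermic_immersion.
- exists S, N, V; split.
  + exact: imS.
  + exact: S_spacelike.
  + by move=> p _; split; rewrite // /F /S contact_of_shift.
  + by split; [exact: F_Fhat_curvature_lines|exact: F_Fhat_conformal].
  + exact: S_opposite_orientations.
Qed.

End BianchiDarboux.

Lemma sum_col_mulmx (R : realType) (m : 'M[R]_4) (v : 'cV[R]_4) :
  \sum_(j < 4) v j 0 *: col j m = m *m v.
Proof.
apply/matrixP => i k; rewrite (ord1 k) summxE mxE; apply: eq_bigr => j _.
by rewrite !mxE mulrC.
Qed.

Theorem theorem3 (R : realType) (M : surface R)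
    (F : M -> contact R) (A : M -> frame R) (rho : M -> R)
    (F_isothermic : L_isothermic_immersion F setT)
    (A_principal : principal_framing A F)
    (rho_smooth : smooth_map setT rho)
    (rho_gt0 : forall p, 0 < rho p)
    (rho_eq : forall c p, atlas c -> cdom c p -> forall X,
       2 * (alpha A i1 i1 c p X - framing_star A c p (alpha A i3 i2 c p) X)
       = - dmap c (fun q => ln (rho q)) p X) :
  completely_integrable (alpha_rho A rho) /\
  forall v : M -> 'cV[R]_4,
    smooth_map setT v ->
    (forall p, Lplus (v p)) ->
    (forall c p, atlas c -> cdom c p -> forall X,
       dmap c v p X = - (alpha_rho A rho c p X *m v p)) ->
    closed_form (gamma A v) /\
    forall (U : set M) (r : M -> R),
      open U ->
      (forall p, U p -> v p i4 0 != 0) ->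
      smooth_map U r ->
      (forall c p, atlas c -> cdom c p -> U p -> forall X,
         dmap c r p X = gamma A v c p X) ->
      let s := fun p => r p / v p i4 0 in
      let S := fun p => (A p).1 + s p *: col i1 (A p).2 in
      let V := fun p => \sum_(j < 4) v p j 0 *: col j (A p).2 in
      let Fhat := fun p => contact_of (S p) (V p) in
      L_isothermic_immersion Fhat U /\
      (immersion U S -> bianchi_darboux U F Fhat).
Proof.
have [smA SOA FE pfA] := A_principal.
have wedge_neq0 c p : atlas c -> cdom c p ->
    wedge (alpha A i2 i1 c p) (alpha A i3 i1 c p) != 0.
  by move=> ac cp; have [] := pfA c p ac cp.
split; first exact: alpha_rho_integrable.
have [a [b [[sma smb] abP]]] := principal_curvatures smA SOA pfA.
move=> v sv vL v_eq; split; first exact: (gamma_closed smA SOA abP sv v_eq).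
move=> U r oU v4 sr r_eq s S V Fhat.
(* The columns and the combination of columns become products of the frame with a constant vector or
   with [v], the form to which the matrix product rule was applied above. *)
have -> : Fhat = fun p => contact_of ((A p).1 + r p / v p i4 0 *:
    ((A p).2 *m (delta_mx i1 0 : 'cV[R]_4))) ((A p).2 *m v p).
  by apply/funext => p; rewrite /Fhat /S /V sum_col_mulmx colE.
have -> : S = fun p => (A p).1 + r p / v p i4 0 *:
    ((A p).2 *m (delta_mx i1 0 : 'cV[R]_4)).
  by apply/funext => p; rewrite /S colE.
have FE' : F = fun p => contact_of (A p).1 ((A p).2 *m (delta_mx i1 0 : 'cV[R]_4)).
  by apply/funext => p; rewrite FE colE.
move: F_isothermic; rewrite FE' => isoF; split.
  exact (Fhat_L_isothermic_immersion smA SOA sma smb abP rho_smooth rho_gt0 rho_eq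
    wedge_neq0 sv vL v_eq oU v4 sr r_eq).
exact (F_Fhat_bianchi_darboux smA SOA sma smb abP rho_smooth rho_gt0 rho_eq
  wedge_neq0 sv vL v_eq oU v4 sr r_eq isoF).
Qed.
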